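(* Let $l_1,l_2\ge 1$ be integers, $d=l_1+l_2$, and $\Omega=B_{l_1}\times B_{l_2}\subset\mathbb{C}^d$, where $B_l$ denotes the open Euclidean unit ball of $\mathbb{C}^l$. Let $\phi\colon\Omega\to\Omega$ be a truly $d$-dimensional Schur map inducing a compact composition operator $C_\phi\colon H^2(\Omega)\to H^2(\Omega)$, $C_\phi f=f\circ\phi$. If $\|\phi\|_\infty:=\sup_{z\in\Omega}|||\phi(z)|||<1$, then there exist constants $0<c\le C<\infty$, independent of $n$, such that $$a_n(C_\phi)\le C\,e^{-c\,n^{1/d}}\qquad (n=1,2,\ldots),$$ that is, $\gamma_d^{-}(C_\phi)>0$.
   Context: $\Omega$ is the unit ball of $\mathbb{C}^d$ for the norm $|||z|||=\max\big(\|u\|,\|v\|\big)$ where $z=(u,v)$, $u\in\mathbb{C}^{l_1}$, $v\in\mathbb{C}^{l_2}$ and $\|\cdot\|$ is the Euclidean (hermitian) norm. Its Shilov boundary is $S_{l_1}\times S_{l_2}$ ($S_l$ the unit sphere of $\mathbb{C}^l$), with normalized measure $\sigma=\sigma_{l_1}\otimes\sigma_{l_2}$, $\sigma_l$ the normalized surface measure on $S_l$. The Hardy space $H^2(\Omega)$ is the Hilbert space of holomorphic $f\colon\Omega\to\mathbb{C}$ with $\|f\|^2=\sup_{0<r<1}\int_{S_{l_1}\times S_{l_2}}|f(r\xi)|^2\,d\sigma(\xi)<\infty$. A Schur map is a non-constant holomorphic map $\phi\colon\Omega\to\Omega$; it is truly $d$-dimensional if $\phi'(a)$ is an invertible linear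 map of $\mathbb{C}^d$ for at least one $a\in\Omega$. The approximation numbers of a bounded operator $T$ on a Hilbert space are $a_n(T)=\inf\{\|T-R\|:\operatorname{rank}R<n\}$, and $\gamma_d^{-}(T)=\liminf_{n\to\infty}\frac{\log(1/a_n(T))}{n^{1/d}}$. *)

(* Defs.v *)
From HB Require Import structures.
From mathcomp Require Import all_boot all_order all_algebra.
From mathcomp Require Import all_classical all_reals all_analysis.
From mathcomp Require Import complex.
Set Implicit Arguments. Unset Strict Implicit. Unset Printing Implicit Defensive.
Import Order.TTheory GRing.Theory Num.Theory.
Local Open Scope ring_scope.
Local Open Scope classical_set_scope.

(* Points of C^d, d = l1 + l2, z = (u, v): u = first l1 coords, v = last l2. *)
Notation pt R l1 l2 := ('I_(l1 + l2) -> R[i]).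
(* Functions on C^d (only their values on Omega matter). *)
Notation Fn R l1 l2 := (pt R l1 l2 -> R[i]).

Definition abs2 (R : realType) (w : R[i]) : R :=
  complex.Re w ^+ 2 + complex.Im w ^+ 2.
Definition cabs (R : realType) (w : R[i]) : R := Num.sqrt (abs2 w).
Definition cscale (R : realType) (r : R) (w : R[i]) : R[i] :=
  Complex (r * complex.Re w) (r * complex.Im w).

Definition unorm2 (R : realType) (l1 l2 : nat) (z : pt R l1 l2) : R :=
  \sum_(i < l1 + l2 | (i < l1)%N) abs2 (z i).
Definition vnorm2 (R : realType) (l1 l2 : nat) (z : pt R l1 l2) : R :=
  \sum_(i < l1 + l2 | (l1 <= i)%N) abs2 (z i).
Definition cnorm (R : realType) (l1 l2 : nat) (z : pt R l1 l2) : R :=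
  Num.sqrt (\sum_(i < l1 + l2) abs2 (z i)).
Definition tnorm (R : realType) (l1 l2 : nat) (z : pt R l1 l2) : R :=
  Num.max (Num.sqrt (unorm2 z)) (Num.sqrt (vnorm2 z)).
Definition Omega (R : realType) (l1 l2 : nat) : set (pt R l1 l2) :=
  [set z | tnorm z < 1].

Definition addp (R : realType) (l1 l2 : nat) (z h : pt R l1 l2) : pt R l1 l2 :=
  fun i => z i + h i.
Definition dil (R : realType) (l1 l2 : nat) (r : R) (z : pt R l1 l2) : pt R l1 l2 :=
  fun i => cscale r (z i).
Definition radproj (R : realType) (l1 l2 : nat) (z : pt R l1 l2) : pt R l1 l2 :=
  fun i => cscale (if (i < l1)%N then (Num.sqrt (unorm2 z))^-1
                   else (Num.sqrt (vnorm2 z))^-1) (z i).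

Definition holo (R : realType) (l1 l2 : nat) (f : Fn R l1 l2) : Prop :=
  forall z, Omega z -> exists L : 'I_(l1 + l2) -> R[i],
    forall eps : R, 0 < eps -> exists2 delta : R, 0 < delta &
      forall h, Omega (addp z h) -> cnorm h < delta ->
        cabs (f (addp z h) - f z - \sum_j L j * h j) <= eps * cnorm h.

(* Lebesgue measure on C^n = R^{2n}, as iterated Lebesgue integrals of
   nonnegative functions (each complex coordinate = (real part, imag part)). *)
Fixpoint iint (R : realType) (n : nat) (F : (nat -> R[i]) -> \bar R) : \bar R :=
  match n with
  | 0 => F (fun _ => 0)
  | n'.+1 =>
    (\int[@lebesgue_measure R]_(x in setT)
       \int[@lebesgue_measure R]_(y in setT)
          iint n' (fun s => F (fun k => if k == n' then Complex x y else s k)))%E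
  end.
Definition cint (R : realType) (l1 l2 : nat) (G : pt R l1 l2 -> \bar R) : \bar R :=
  iint (l1 + l2) (fun s => G (fun i => s (nat_of_ord i))).

Definition volOmega (R : realType) (l1 l2 : nat) : \bar R :=
  cint (fun z : pt R l1 l2 => (\1_(Omega (l1:=l1) (l2:=l2)) z)%:E).

(* Integral of a nonnegative h over S_{l1} x S_{l2} against
   sigma = sigma_{l1} (x) sigma_{l2}, sigma_l the normalized surface measure,
   realized as the push-forward of normalized Lebesgue measure on the ball
   under radial projection (sigma_l(E) = vol{r xi : 0<r<1, xi in E}/vol(B_l)). *)
Definition sphere_mean (R : realType) (l1 l2 : nat) (h : pt R l1 l2 -> R) : \bar R :=
  ((fine (volOmega R l1 l2))^-1%:E *
   cint (fun z : pt R l1 l2 => (\1_(Omega (l1:=l1) (l2:=l2)) z * h (radproj z))%:E))%E.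

Definition H2sq (R : realType) (l1 l2 : nat) (f : Fn R l1 l2) : \bar R :=
  ereal_sup [set sphere_mean (fun xi => abs2 (f (dil r xi))) | r in [set r : R | 0 < r < 1]].
Definition H2norm (R : realType) (l1 l2 : nat) (f : Fn R l1 l2) : \bar R :=
  if H2sq f == +oo%E then +oo%E else (Num.sqrt (fine (H2sq f)))%:E.
Definition H2 (R : realType) (l1 l2 : nat) (f : Fn R l1 l2) : Prop :=
  holo f /\ (H2sq f < +oo)%E.

Definition eqOm (R : realType) (l1 l2 : nat) (f g : Fn R l1 l2) : Prop :=
  forall z, Omega z -> f z = g z.

(* operator norm of A (meaningful for A mapping H^2 to H^2) *)
Definition opnorm (R : realType) (l1 l2 : nat) (A : Fn R l1 l2 -> Fn R l1 l2) : \bar R :=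
  ereal_sup [set H2norm (A f) | f in [set f | H2 f /\ (H2norm f <= 1)%E]].

Definition finrank_op (R : realType) (l1 l2 : nat) (m : nat)
    (Rop : Fn R l1 l2 -> Fn R l1 l2) : Prop :=
  [/\ forall f, H2 f -> H2 (Rop f),
      forall (a : R[i]) f g, H2 f -> H2 g ->
        eqOm (Rop (fun z => a * f z + g z)) (fun z => a * Rop f z + Rop g z)
    & exists gs : 'I_m -> Fn R l1 l2, forall f, H2 f ->
        exists c : 'I_m -> R[i], eqOm (Rop f) (fun z => \sum_k c k * gs k z)].

Definition approx_num (R : realType) (l1 l2 : nat)
    (T : Fn R l1 l2 -> Fn R l1 l2) (n : nat) : \bar R :=
  ereal_inf [set opnorm (fun f z => T f z - Rop f z)
            | Rop in [set Rop | finrank_op n.-1 Rop]].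

Definition Cphi (R : realType) (l1 l2 : nat) (phi : pt R l1 l2 -> pt R l1 l2)
    (f : Fn R l1 l2) : Fn R l1 l2 := fun z => f (phi z).

Definition schur_map (R : realType) (l1 l2 : nat) (phi : pt R l1 l2 -> pt R l1 l2) : Prop :=
  [/\ forall i, holo (fun z => phi z i),
      forall z, Omega z -> Omega (phi z)
    & exists z1 z2, [/\ Omega z1, Omega z2 & phi z1 <> phi z2]].

Definition truly_d_dim (R : realType) (l1 l2 : nat) (phi : pt R l1 l2 -> pt R l1 l2) : Prop :=
  exists a, Omega a /\ exists M : 'M[R[i]]_(l1 + l2), M \in unitmx /\
    forall eps : R, 0 < eps -> exists2 delta : R, 0 < delta &
      forall h, Omega (addp a h) -> cnorm h < delta ->
        cnorm (fun i => phi (addp a h) i - phi a i - \sum_j M i j * h j)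
          <= eps * cnorm h.

Definition compact_Cphi (R : realType) (l1 l2 : nat) (phi : pt R l1 l2 -> pt R l1 l2) : Prop :=
  (forall f, H2 f -> H2 (Cphi phi f)) /\
  forall fs : nat -> Fn R l1 l2, (forall k, H2 (fs k) /\ (H2norm (fs k) <= 1)%E) ->
    exists sigma : nat -> nat, {homo sigma : m n / (m < n)%N >-> (m < n)%N} /\
      exists g, H2 g /\ forall eps : R, 0 < eps -> exists N : nat, forall k, (N <= k)%N ->
        (H2norm (fun z => (Cphi phi (fs (sigma k)) z - g z)%R) <= eps%:E)%E.

Definition supnorm_lt1 (R : realType) (l1 l2 : nat) (phi : pt R l1 l2 -> pt R l1 l2) : Prop :=
  exists rho : R, rho < 1 /\ forall z, Omega z -> tnorm (phi z) <= rho.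

(* Main.v *)
(* Let T_N f be the Taylor polynomial of f at 0 of degree less than N.  If f is holomorphic on
   Omega and bounded by K for |||w||| <= rho tau, where tau > 1 and rho tau < 1, then applying
   the one-variable Cauchy estimates to the slices l |-> f(l w) gives
   |f(w) - T_N f(w)| <= K tau^-N / (1 - 1/tau) for |||w||| <= rho.  Such a K exists uniformly on
   the unit ball of H^2: sigma is invariant under the torus action, and averaging |f|^2 over
   a torus orbit dominates |f(w)|^2 as soon as w lies well inside the corresponding polydisc.
   Hence f |-> (T_N f) o phi has rank at most N^d and approximates C_phi with error
   O(tau^-N). *)
Require Import Defs.
From HB Require Import structures.
From mathcomp Require Import all_boot all_order all_algebra.
From mathcomp Require Import all_classical all_reals all_analysis.
From mathcomp Require Import measurable_realfun complex.
From mathcomp Require Import ring lra.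
Set Implicit Arguments. Unset Strict Implicit. Unset Printing Implicit Defensive.
Import Order.TTheory GRing.Theory Num.Theory.
Import numFieldNormedType.Exports.
Local Open Scope ring_scope.
Local Notation cscale := Defs.cscale.

(** Three obstacles shape the argument. Holomorphy is bare complex differentiability at each point
    of [Omega], with no regularity of the derivative, so Cauchy's formula has to start from
    Goursat's bisection. The approximating operators must be linear on [H2], so Taylor coefficients
    are limits of root-of-unity averages along one fixed ultrafilter, taken at one radius [rad0]
    common to all functions. Finally, the norm is an iterated integral over a product of balls
    composed with a radial projection, and its symmetry is available as invariance under rotating
    each coordinate. A torus orbit is therefore replaced by a finite grid of roots of unity, on
    which Cauchy's formula is an exact identity for polynomials of low degree. Point evaluation is
    bounded first on Taylor polynomials, with a constant independent of the degree, and then on [f],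
    which is uniformly close to one of them on a smaller bidisc. The lower bound for the integral
    comes from a small box of points whose side does not depend on the evaluation point. *)

Section ComplexModulus.
Context {R : realType}.
Implicit Types (y z w : R[i]) (a b t : R).

(** * The complex modulus and the unit circle *)

Lemma cabs_normc z : cabs z = Normc.normc z.
Proof. by case: z. Qed.

Lemma cabs_ge0 z : 0 <= cabs z.
Proof. exact: sqrtr_ge0. Qed.

Lemma abs2_ge0 z : 0 <= abs2 z.
Proof. by rewrite addr_ge0 ?sqr_ge0. Qed.

Lemma abs2E z : abs2 z = cabs z ^+ 2.
Proof. by rewrite sqr_sqrtr ?abs2_ge0. Qed.

Lemma cabs0 : cabs (0 : R[i]) = 0.
Proof. by rewrite cabs_normc Normc.normc0. Qed.

Lemma cabs1 : cabs (1 : R[i]) = 1.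
Proof. by rewrite cabs_normc Normc.normc1. Qed.

Lemma cabs_eq0 z : (cabs z == 0) = (z == 0).
Proof.
apply/eqP/eqP => [|->]; last exact: cabs0.
by rewrite cabs_normc; exact: Normc.eq0_normc.
Qed.

Lemma cabs_gt0 z : (0 < cabs z) = (z != 0).
Proof. by rewrite lt_neqAle cabs_ge0 andbT eq_sym cabs_eq0. Qed.

Lemma cabsM z w : cabs (z * w) = cabs z * cabs w.
Proof. by rewrite !cabs_normc Normc.normcM. Qed.

Lemma cabsV z : cabs z^-1 = (cabs z)^-1.
Proof. by rewrite !cabs_normc Normc.normcV. Qed.

Lemma cabsX z n : cabs (z ^+ n) = cabs z ^+ n.
Proof. by elim: n => [|n IH]; rewrite ?expr0 ?cabs1// !exprS cabsM IH. Qed.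

Lemma cabsN z : cabs (- z) = cabs z.
Proof. by rewrite !cabs_normc normcN. Qed.

Lemma cabsD z w : cabs (z + w) <= cabs z + cabs w.
Proof. by rewrite !cabs_normc le_normcD. Qed.

Lemma cabsB z w : cabs (z - w) <= cabs z + cabs w.
Proof. by rewrite -(cabsN w) cabsD. Qed.

Lemma cabs_distC z w : cabs (z - w) = cabs (w - z).
Proof. by rewrite -cabsN opprB. Qed.

Lemma cabs_distD y z w : cabs (z - w) <= cabs (z - y) + cabs (y - w).
Proof. by rewrite -[z - w](subrKA y) cabsD. Qed.

Lemma cabs_le_dist z w : cabs z <= cabs w + cabs (z - w).
Proof. by rewrite -{1}(subrKC w z) cabsD. Qed.

Lemma cabs_sum (I : Type) (s : seq I) (P : pred I) (F : I -> R[i]) :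
  cabs (\sum_(i <- s | P i) F i) <= \sum_(i <- s | P i) cabs (F i).
Proof.
apply: (big_ind2 (fun u v => cabs u <= v)); first by rewrite cabs0.
  by move=> u1 v1 u2 v2 h1 h2; apply: (le_trans (cabsD _ _)); apply: lerD.
by [].
Qed.

Lemma cabs_prod (I : Type) (s : seq I) (P : pred I) (F : I -> R[i]) :
  cabs (\prod_(i <- s | P i) F i) = \prod_(i <- s | P i) cabs (F i).
Proof. by apply: (big_morph _ cabsM cabs1). Qed.

Lemma cabs_real a : cabs a%:C%C = `|a|.
Proof. by rewrite /cabs /abs2 /= expr0n addr0 sqrtr_sqr. Qed.

Lemma ReD z w : complex.Re (z + w) = complex.Re z + complex.Re w.
Proof. by case: z w => [? ?] []. Qed.

Lemma ImD z w : complex.Im (z + w) = complex.Im z + complex.Im w.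
Proof. by case: z w => [? ?] []. Qed.

Lemma ReB z w : complex.Re (z - w) = complex.Re z - complex.Re w.
Proof. by case: z w => [? ?] []. Qed.

Lemma ImB z w : complex.Im (z - w) = complex.Im z - complex.Im w.
Proof. by case: z w => [? ?] []. Qed.

Lemma Re_le_cabs z : `|complex.Re z| <= cabs z.
Proof. by rewrite -sqrtr_sqr ler_sqrt ?abs2_ge0// lerDl sqr_ge0. Qed.

Lemma Im_le_cabs z : `|complex.Im z| <= cabs z.
Proof. by rewrite -sqrtr_sqr ler_sqrt ?abs2_ge0// lerDr sqr_ge0. Qed.

Lemma cabs_le_ReIm z : cabs z <= `|complex.Re z| + `|complex.Im z|.
Proof.
rewrite -[leRHS]ger0_norm ?addr_ge0// -sqrtr_sqr ler_sqrt ?sqr_ge0//.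
rewrite /abs2 -(real_normK (num_real (complex.Re z))).
rewrite -(real_normK (num_real (complex.Im z))).
have := normr_ge0 (complex.Re z); have := normr_ge0 (complex.Im z); nra.
Qed.

Lemma cscaleE a z : cscale a z = a%:C%C * z.
Proof. by case: z => u v; rewrite /cscale; simpc. Qed.

Lemma cabs_scale a z : cabs (cscale a z) = `|a| * cabs z.
Proof. by rewrite cscaleE cabsM cabs_real. Qed.

Lemma realc_eq0 a : (a%:C%C == 0 :> R[i]) = (a == 0).
Proof. by rewrite -cabs_eq0 cabs_real normr_eq0. Qed.

Lemma natc n : (n%:R : R)%:C%C = n%:R :> R[i].
Proof. by rewrite rmorph_nat. Qed.

Lemma cabs_nat n : cabs (n%:R : R[i]) = n%:R.
Proof. by rewrite -natc cabs_real ger0_norm. Qed.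

Lemma cabs_le_eps z : (forall eps, 0 < eps -> cabs z <= eps) -> z = 0.
Proof.
move=> h; apply/eqP; rewrite -cabs_eq0; apply/eqP/le_anti.
rewrite cabs_ge0 andbT; apply/ler_addgt0Pr => e e0; rewrite add0r; exact: h.
Qed.

Definition cis t : R[i] := Complex (cos t) (sin t).

Lemma cisD a b : cis (a + b) = cis a * cis b.
Proof. by rewrite /cis cosD sinD; simpc; congr Complex; ring. Qed.

Lemma cis0 : cis 0 = 1.
Proof. by rewrite /cis cos0 sin0. Qed.

Lemma cabs_cis t : cabs (cis t) = 1.
Proof. by rewrite /cabs /abs2 /= cos2Dsin2 sqrtr1. Qed.

Lemma cisM n t : cis (n%:R * t) = cis t ^+ n.
Proof.
elim: n => [|n IH]; first by rewrite mul0r cis0.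
by rewrite -natr1 mulrDl mul1r cisD IH exprSr.
Qed.

Lemma cis2pi : cis (2 * pi) = 1.
Proof. by rewrite mulr_natl /cis cos2pi sin2pi. Qed.

Lemma cis_neq0 t : cis t != 0.
Proof. by rewrite -cabs_gt0 cabs_cis. Qed.

Lemma cisN t : cis (- t) = (cis t)^-1.
Proof.
by apply: (mulfI (cis_neq0 t)); rewrite -cisD subrr cis0 mulfV ?cis_neq0.
Qed.

Lemma lip1_derive (f f' : R -> R) a b :
  (forall x : R, is_derive x 1 f (f' x)) -> (forall x : R, `|f' x| <= 1) ->
  `|f b - f a| <= `|b - a|.
Proof.
move=> df f1; wlog ab : a b / a <= b.
  move=> h; have [/h//|/ltW/h] := leP a b.
  by rewrite distrC (distrC b a).
have cf : {within `[a, b], continuous f}%classic.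
  apply: continuous_subspaceT => x; apply: differentiable_continuous.
  by apply/derivable1_diffP; apply: ex_derive.
have [c _ ->] := MVT_segment ab (fun u _ => df u) cf.
by rewrite normrM ler_piMl.
Qed.

Lemma sin_lip a b : `|sin b - sin a| <= `|b - a|.
Proof.
by apply: (@lip1_derive sin cos _ _ (@is_derive_sin R)) => u; rewrite ler_norml cos_geN1 cos_le1.
Qed.

Lemma cos_lip a b : `|cos b - cos a| <= `|b - a|.
Proof.
by apply: (@lip1_derive cos (fun x => - sin x) _ _ (@is_derive_cos R)) => u; rewrite normrN ler_norml sin_geN1 sin_le1.
Qed.

Lemma cis_lip a b : cabs (cis b - cis a) <= 2 * `|b - a|.
Proof.
apply: (le_trans (cabs_le_ReIm _)); rewrite mulrDl mul1r; apply: lerD.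
  exact: cos_lip.
exact: sin_lip.
Qed.

Lemma sin_ge_half t : 0 <= t <= 1 -> t / 2 <= sin t.
Proof.
move=> /andP[t0 t1].
have csin : {within `[0, t], continuous (@sin R)}%classic.
  by apply: continuous_subspaceT; exact: continuous_sin.
have [c + h] := MVT_segment t0 (fun x _ => is_derive_sin x) csin.
rewrite in_itv /= => /andP[c0 ct].
(* Half-angle formula: cos c = 1 - 2 sin(c/2)^2 >= 1 - c^2/2, and c <= 1. *)
have cosc : 1 / 2 <= cos c.
  have -> : cos c = 1 - 2 * sin (c / 2) ^+ 2.
    rewrite {1}(_ : c = c / 2 *+ 2) ?cos_mulr2n ?cos2sin2 -mulr_natr; last by field.
    by ring.
  have := sin_lip 0 (c / 2); rewrite sin0 !subr0 (ger0_norm (divr_ge0 _ _))//.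
  rewrite -(real_normK (num_real (sin (c / 2)))).
  by have := normr_ge0 (sin (c / 2)); nra.
by move: h; rewrite sin0 !subr0 => ->; nra.
Qed.

End ComplexModulus.

(** * Goursat's theorem and Cauchy's formula *)

Section Goursat.
Context {R : realType}.
Notation C := R[i].

Definition cdiff (G : C -> C) (z : C) := exists b : C, forall eps : R, 0 < eps ->
  exists2 d : R, 0 < d & forall y : C, cabs (y - z) < d ->
    cabs (G y - G z - b * (y - z)) <= eps * cabs (y - z).

(** Trapezoidal sum with [2 ^ m] chords for the contour integral of [G] along [p] over [a, a + h].
    The recursion by halving makes it split exactly at the midpoint. *)
Fixpoint trap (G : C -> C) (p : R -> C) (m : nat) (a h : R) : C :=
  if m is n.+1 then trap G p n a (h / 2) + trap G p n (a + h / 2) (h / 2)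
  else (G (p a) + G (p (a + h))) / 2 * (p (a + h) - p a).

Lemma halves (a h : R) : a + h / 2 + h / 2 = a + h.
Proof. by field. Qed.

(** Since (z + w)/2 * (w - z) = (w^2 - z^2)/2, each chord contributes the exact increment of a
    primitive, and these increments telescope. *)
Lemma trap_affine (al be : C) p m a h :
  trap (fun z => al + be * z) p m a h =
  (al * p (a + h) + be / 2 * p (a + h) ^+ 2) - (al * p a + be / 2 * p a ^+ 2).
Proof.
elim: m a h => [|m IH] a h /=; first by field.
by rewrite !IH halves; ring.
Qed.

Lemma trapB G H p m a h :
  trap (fun z => G z - H z) p m a h = trap G p m a h - trap H p m a h.
Proof.
elim: m a h => [|m IH] a h /=; first by field.
by rewrite !IH; ring.
Qed.

Lemma trap_le G p m (a h eta K : R) : 0 <= h -> 0 <= eta -> 0 <= K ->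
  (forall t : R, a <= t <= a + h -> cabs (G (p t)) <= eta) ->
  (forall s t : R, a <= s <= a + h -> a <= t <= a + h ->
     cabs (p t - p s) <= K * `|t - s|) ->
  cabs (trap G p m a h) <= eta * K * h.
Proof.
move=> + eta0 K0; elim: m a h => [|m IH] a h h0 hG hp /=.
  have c2 : cabs (2 : C) = 2 := cabs_nat 2.
  rewrite cabsM cabsM cabsV c2.
  have ha : a <= a <= a + h by rewrite lexx lerDl.
  have hb : a <= a + h <= a + h by rewrite lexx lerDl h0.
  have := hp _ _ ha hb; rewrite addrAC subrr add0r (ger0_norm h0) => hp1.
  have hs : cabs (G (p a) + G (p (a + h))) <= 2 * eta.
    by apply: (le_trans (cabsD _ _)); have := hG _ ha; have := hG _ hb; lra.
  rewrite -[eta * K * h]mulrA; apply: ler_pM => //; rewrite ?divr_ge0 ?cabs_ge0//.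
  by rewrite ler_pdivrMr// mulrC.
apply: (le_trans (cabsD _ _)).
have -> : eta * K * h = eta * K * (h / 2) + eta * K * (h / 2) by field.
have h20 : 0 <= h / 2 by rewrite divr_ge0.
apply: lerD; apply: IH => //.
- by move=> t ht; apply: hG; move: ht; lra.
- by move=> s t hs ht; apply: hp; move: hs ht; lra.
- by move=> t ht; apply: hG; move: ht; lra.
- by move=> s t hs ht; apply: hp; move: hs ht; lra.
Qed.

(** Discrete contour integral around the image under [g] of the square with corner (a, c) and side
    h: bottom, right, top and left edge in turn. *)
Definition boxsum (G : C -> C) (g : R -> R -> C) m (a c h : R) : C :=
  trap G (g ^~ c) m a h + trap G (g (a + h)) m c h
  - trap G (g ^~ (c + h)) m a h - trap G (g a) m c h.

(** Interior edges cancel in pairs. The quarter squares carry level [m] instead of [m.+1], so the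
    mesh is the same on both sides. *)
Lemma boxsum_split G g m a c h : boxsum G g m.+1 a c h =
  boxsum G g m a c (h / 2) + boxsum G g m (a + h / 2) c (h / 2)
  + boxsum G g m a (c + h / 2) (h / 2)
  + boxsum G g m (a + h / 2) (c + h / 2) (h / 2).
Proof. by rewrite /boxsum /= !halves; ring. Qed.

Lemma boxsumB_affine G g al be m a c h :
  boxsum (fun z => G z - (al + be * z)) g m a c h = boxsum G g m a c h.
Proof. by rewrite /boxsum !trapB !trap_affine; ring. Qed.

Lemma nested_point (u : nat -> R) :
  (forall k, u k <= u k.+1 <= u k + 2^-1 ^+ k.+1) ->
  exists s, forall k, u k <= s <= u k + 2^-1 ^+ k.
Proof.
move=> hu.
have mono j k : u j <= u (j + k)%N <= u j + 2^-1 ^+ j - 2^-1 ^+ (j + k)%N.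
  elim: k => [|k /andP[h1 h2]]; first by rewrite addn0 addrK lexx.
  have /andP[h3 h4] := hu (j + k)%N.
  rewrite addnS (le_trans h1 h3) /=; move: h4; rewrite exprS; lra.
have ub j k : u k <= u j + 2^-1 ^+ j.
  have p0 i : 0 < (2^-1 : R) ^+ i by rewrite exprn_gt0 ?invr_gt0.
  have [jk|/ltnW kj] := leqP j k.
    have := mono j (k - j)%N; rewrite subnKC//; have := p0 k; lra.
  by have := mono k (j - k)%N; rewrite subnKC//; have := p0 j; lra.
exists (sup (range u)) => k; apply/andP; split.
  apply: sup_upper_bound; last by exists k.
  by split; [exists (u 0%N); exists 0%N|exists (u 0%N + 2^-1 ^+ 0) => _ [i _ <-]].
by apply: ge_sup; [exists (u 0%N); exists 0%N|move=> _ [i _ <-]].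
Qed.

(* Trapezoidal sums are exact on affine functions, so Goursat's bisection argument runs on
   them directly, without integrals. *)
Theorem goursat (G : C -> C) (g : R -> R -> C) (K : R) : 0 <= K ->
  (forall s s' t t' : R, 0 <= s <= 1 -> 0 <= s' <= 1 -> 0 <= t <= 1 -> 0 <= t' <= 1 ->
     cabs (g s t - g s' t') <= K * (`|s - s'| + `|t - t'|)) ->
  (forall s t : R, 0 <= s <= 1 -> 0 <= t <= 1 -> cdiff G (g s t)) ->
  forall eps : R, 0 < eps ->
  exists k0, forall m, (k0 <= m)%N -> cabs (boxsum G g m 0 0 1) <= eps.
Proof.
move=> K0 hg hG eps eps0.
(* Good squares have contour sums eventually bounded by eps times their area; the threshold on [m]
   may depend on the square. Four good quarters make a good square. *)
pose good (p : R * R) (h : R) := exists k0, forall m, (k0 <= m)%N ->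
  cabs (boxsum G g m p.1 p.2 h) <= eps * h ^+ 2.
have good_split p h : good p (h / 2) -> good (p.1 + h / 2, p.2) (h / 2) ->
    good (p.1, p.2 + h / 2) (h / 2) ->
    good (p.1 + h / 2, p.2 + h / 2) (h / 2) -> good p h.
  move=> [k1 h1] [k2 h2] [k3 h3] [k4 h4].
  exists (maxn k1 (maxn k2 (maxn k3 k4))).+1 => -[//|m]; rewrite ltnS !geq_max.
  move=> /and4P[m1 m2 m3 m4]; rewrite boxsum_split.
  have := h1 _ m1; have := h2 _ m2; have := h3 _ m3; have := h4 _ m4 => /=.
  move=> e4 e3 e2 e1.
  have cD4 (z1 z2 z3 z4 : C) (v : R) : cabs z1 <= v -> cabs z2 <= v ->
      cabs z3 <= v -> cabs z4 <= v -> cabs (z1 + z2 + z3 + z4) <= 4 * v.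
    have := cabsD (z1 + z2 + z3) z4; have := cabsD (z1 + z2) z3.
    have := cabsD z1 z2; lra.
  apply: le_trans (cD4 _ _ _ _ _ e1 e2 e3 e4) _.
  by rewrite le_eqVlt; apply/orP; left; apply/eqP; field.
apply: contrapT => nG.
have bad0 : ~ good (0, 0) 1.
  move=> [k0 hk]; apply: nG; exists k0 => m /hk /=.
  by rewrite expr1n mulr1.
(* Badness appears as an implication so that the choice of a quarter is total and [choice] applies;
   starting from the bad unit square, every chosen square is bad. *)
have step (x : nat * (R * R)) : exists q : R * R,
    let h := 2^-1 ^+ x.1.+1 in
    (~ good x.2 (2^-1 ^+ x.1) -> ~ good q h) /\ (x.2.1 <= q.1 <= x.2.1 + h /\ x.2.2 <= q.2 <= x.2.2 + h).
  case: x => k p /=; set h := 2^-1 ^+ k.+1.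
  have h0 : 0 <= h by rewrite exprn_ge0// invr_ge0.
  have -> : 2^-1 ^+ k = 2 * h by rewrite /h exprS mulVKf.
  apply: contrapT => np.
  have all_good q : p.1 <= q.1 <= p.1 + h -> p.2 <= q.2 <= p.2 + h -> good q h.
    move=> q1 q2; apply: contrapT => bq; apply: np; exists q; split => //.
  have gp : good p (2 * h).
    have e : 2 * h / 2 = h by field.
    by apply: good_split; rewrite e; apply: all_good => /=; lra.
  by apply: np; exists p; split => //; lra.
have [nxt hn] := choice step.
pose sq := fix sq k := if k is n.+1 then nxt (n, sq n) else (0, 0) : R * R.
have bad k : ~ good (sq k) (2^-1 ^+ k).
  elim: k => [|k IH]; first by rewrite expr0.
  by have [h _] := hn (k, sq k); apply: h.
have [s0 hs0] : exists s, forall k, (sq k).1 <= s <= (sq k).1 + 2^-1 ^+ k.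
  by apply: nested_point => k; have [_ []] := hn (k, sq k).
have [t0 ht0] : exists s, forall k, (sq k).2 <= s <= (sq k).2 + 2^-1 ^+ k.
  by apply: nested_point => k; have [_ []] := hn (k, sq k).
have inbox k : [/\ 0 <= (sq k).1, (sq k).1 + 2^-1 ^+ k <= 1,
    0 <= (sq k).2 & (sq k).2 + 2^-1 ^+ k <= 1].
  elim: k => [|k [i1 i2 i3 i4]]; first by rewrite expr0 /= add0r lexx.
  have [_ /= []] := hn (k, sq k); rewrite -/(sq k.+1).
  have e : 2^-1 ^+ k = 2 * 2^-1 ^+ k.+1 :> R by rewrite exprS mulVKf.
  by rewrite e in i2 i4; split; lra.
have hs01 : 0 <= s0 <= 1 by have := hs0 0%N; have := inbox 0%N; rewrite expr0 /=; lra.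
have ht01 : 0 <= t0 <= 1 by have := ht0 0%N; have := inbox 0%N; rewrite expr0 /=; lra.
have [b hb] := hG _ _ hs01 ht01.
(* On a square of side h around the limit point, |H| <= e1 * 2(K + 1)h and each edge has length at
   most K h. The four edges give 8 e1 (K + 1)^2 h^2 = eps h^2. *)
pose e1 := eps / (8 * (K + 1) ^+ 2).
have K1 : 0 < K + 1 by lra.
have e10 : 0 < e1 by rewrite divr_gt0// mulr_gt0// exprn_gt0.
have [d d0 hd] := hb _ e10.
have [k hk] : exists k, 2 * (K + 1) * 2^-1 ^+ k < d.
  have v0 : 0 < d / (2 * (K + 1)) by rewrite divr_gt0// mulr_gt0.
  have hc : ((fun n : nat => (2^-1 : R) ^+ n) @ \oo --> (0 : R))%classic.
    by apply: cvg_expr; rewrite gtr0_norm ?invr_gt0// invf_lt1// ltr1n.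
  have /cvgrPdist_lt/(_ _ v0)[N _ hN] := hc.
  exists N; have := hN N (leqnn _).
  rewrite /= sub0r normrN ger0_norm ?exprn_ge0 ?invr_ge0//.
  by rewrite ltr_pdivlMr ?mulr_gt0// mulrC.
apply: (bad k); exists 0%N => m _.
set a := (sq k).1; set c := (sq k).2; set h := 2^-1 ^+ k.
have [a0 ah c0 ch] := inbox k; rewrite -/a -/c -/h in a0 ah c0 ch.
have sh := hs0 k; have th := ht0 k; rewrite -/a -/c -/h in sh th.
have h0 : 0 <= h by rewrite exprn_ge0// invr_ge0.
set z0 := g s0 t0.
rewrite -(boxsumB_affine _ _ (G z0 - b * z0) b).
set H := fun z => _.
have HE z : H z = G z - G z0 - b * (z - z0) by rewrite /H; ring.
have Hle s t : a <= s <= a + h -> c <= t <= c + h ->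
    cabs (H (g s t)) <= e1 * (2 * (K + 1) * h).
  move=> hs ht; rewrite HE.
  have dist : cabs (g s t - z0) <= 2 * (K + 1) * h.
    have : cabs (g s t - z0) <= K * (`|s - s0| + `|t - t0|) by apply: hg; lra.
    have : `|s - s0| <= h by rewrite ler_norml; lra.
    have : `|t - t0| <= h by rewrite ler_norml; lra.
    nra.
  apply: le_trans (hd _ (le_lt_trans dist hk)) _.
  by rewrite ler_pM2l.
have edge (p : R -> C) (a' : R) : (forall t : R, a' <= t <= a' + h -> cabs (H (p t)) <= e1 * (2 * (K + 1) * h)) ->
    (forall s t : R, a' <= s <= a' + h -> a' <= t <= a' + h -> cabs (p t - p s) <= K * `|t - s|) ->
    cabs (trap H p m a' h) <= 2 * e1 * (K + 1) ^+ 2 * h ^+ 2.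
  move=> h1 h2; have e2 : 0 <= e1 * (2 * (K + 1) * h) by rewrite mulr_ge0 ?(ltW e10)// mulr_ge0// mulr_ge0// ltW.
  have := trap_le m h0 e2 K0 h1 h2; move/le_trans; apply.
  rewrite (_ : 2 * e1 * (K + 1) ^+ 2 * h ^+ 2 = e1 * (2 * (K + 1) * h) * (K + 1) * h); last by ring.
  by rewrite ler_wpM2r// ler_wpM2l// lerDl.
have -> : eps * h ^+ 2 = 4 * (2 * e1 * (K + 1) ^+ 2 * h ^+ 2).
  by rewrite /e1; field; rewrite gt_eqF.
have B1 := edge (g ^~ c) a _ _.
have B2 := edge (g (a + h)) c _ _.
have B3 := edge (g ^~ (c + h)) a _ _.
have B4 := edge (g a) c _ _.
rewrite /boxsum.
have := cabsB (trap H (g^~ c) m a h + trap H (g (a + h)) m c h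
  - trap H (g^~ (c + h)) m a h) (trap H (g a) m c h).
have := cabsB (trap H (g^~ c) m a h + trap H (g (a + h)) m c h) (trap H (g^~ (c + h)) m a h).
have := cabsD (trap H (g^~ c) m a h) (trap H (g (a + h)) m c h).
have : cabs (trap H (g^~ c) m a h) <= 2 * e1 * (K + 1) ^+ 2 * h ^+ 2.
  apply: B1 => [t ht|s t hs ht]; first by apply: Hle => //; lra.
  by apply: le_trans (hg _ _ _ _ _ _ _ _) _; rewrite ?subrr ?normr0 ?addr0//; lra.
have : cabs (trap H (g (a + h)) m c h) <= 2 * e1 * (K + 1) ^+ 2 * h ^+ 2.
  apply: B2 => [t ht|s t hs ht]; first by apply: Hle => //; lra.
  by apply: le_trans (hg _ _ _ _ _ _ _ _) _; rewrite ?subrr ?normr0 ?add0r//; lra.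
have : cabs (trap H (g^~ (c + h)) m a h) <= 2 * e1 * (K + 1) ^+ 2 * h ^+ 2.
  apply: B3 => [t ht|s t hs ht]; first by apply: Hle => //; lra.
  by apply: le_trans (hg _ _ _ _ _ _ _ _) _; rewrite ?subrr ?normr0 ?addr0//; lra.
have : cabs (trap H (g a) m c h) <= 2 * e1 * (K + 1) ^+ 2 * h ^+ 2.
  apply: B4 => [t ht|s t hs ht]; first by apply: Hle => //; lra.
  by apply: le_trans (hg _ _ _ _ _ _ _ _) _; rewrite ?subrr ?normr0 ?add0r//; lra.
lra.
Qed.

End Goursat.

Section CauchyFormula.
Context {R : realType}.
Notation C := R[i].

Lemma cdiff_div (g : C -> C) w z : z != w -> cdiff g z ->
  cdiff (fun y => g y / (y - w)) z.
Proof.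
move=> zw [b hb]; have zw0 : z - w != 0 by rewrite subr_eq0.
pose q := g z / (z - w); pose b' := (b - q) / (z - w).
exists b' => eps eps0.
pose rho := cabs (z - w); have rho0 : 0 < rho by rewrite cabs_gt0.
have e10 : 0 < eps * rho / 4 by rewrite divr_gt0// mulr_gt0.
have [d d0 hd] := hb _ e10.
have b1 : 0 < cabs b' + 1 by have := cabs_ge0 b'; lra.
have e20 : 0 < eps * rho / 4 / (cabs b' + 1) by rewrite divr_gt0.
exists (Num.min d (Num.min (rho / 2) (eps * rho / 4 / (cabs b' + 1)))).
  by rewrite !lt_min d0 e20 divr_gt0.
move=> y; rewrite !lt_min => /and3P[/hd h1 h2 h3].
have yw : rho / 2 <= cabs (y - w).
  have := cabs_le_dist (z - w) (y - w).
  by rewrite (_ : z - w - (y - w) = - (y - z)) ?cabsN -/rho; [lra|ring].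
have yw0 : y - w != 0 by rewrite -cabs_gt0; lra.
(* Exact remainder of the quotient: that of [g], less a quadratic term, over a denominator kept at
   least rho/2 in modulus. *)
have E : g y / (y - w) - g z / (z - w) - b' * (y - z) =
    (g y - g z - b * (y - z) - b' * (y - z) ^+ 2) / (y - w).
  by rewrite /b' /q; field; rewrite yw0 zw0.
rewrite E cabsM cabsV ler_pdivrMr; last by lra.
apply: (le_trans (cabsB _ _)); rewrite cabsM cabsX.
move: h3; rewrite ltr_pdivlMr// => h3.
have t0 := cabs_ge0 (y - z); have b0 := cabs_ge0 b'.
have k1 : cabs b' * cabs (y - z) <= eps * rho / 4 by lra.
have k2 := ler_wpM2r t0 k1.
have k3 := ler_wpM2l (mulr_ge0 (ltW eps0) t0) yw.
move: h1 k2 k3; rewrite expr2 mulrA; lra.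
Qed.

Definition circle_root (m : nat) : C := cis (2 * pi / (2 ^ m)%:R).

(** Mean over the [2 ^ m]-th roots of unity, a discrete form of normalized arc length; the order is
    a power of 2 to match the bisections in [trap]. *)
Definition avg (m : nat) (F : C -> C) : C :=
  (2 ^ m)%:R^-1 * \sum_(j < 2 ^ m) F (circle_root m ^+ j).

Lemma pow2_neq0 m : (2 ^ m)%:R != 0 :> R.
Proof. by rewrite pnatr_eq0 expn_eq0. Qed.

Lemma cpow2_neq0 m : (2 ^ m)%:R != 0 :> C.
Proof. by rewrite -natc realc_eq0 pow2_neq0. Qed.

Lemma circle_rootX m : circle_root m ^+ (2 ^ m) = 1.
Proof. by rewrite -cisM mulrC mulfVK ?pow2_neq0// cis2pi. Qed.

Lemma cabs_circle_root m j : cabs (circle_root m ^+ j) = 1.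
Proof. by rewrite cabsX cabs_cis expr1n. Qed.

Lemma circle_root_neq0 m : circle_root m != 0.
Proof. exact: cis_neq0. Qed.

Lemma cabs_avg m F (A : R) : (forall e, cabs e = 1 -> cabs (F e) <= A) ->
  cabs (avg m F) <= A.
Proof.
move=> hF; rewrite cabsM cabsV cabs_nat mulrC ler_pdivrMr ?ltr0n ?expn_gt0//.
apply: (le_trans (cabs_sum _ _ _)).
apply: (@le_trans _ _ (\sum_(j < 2 ^ m) A)).
  by apply: ler_sum => j _; apply/hF/cabs_circle_root.
by rewrite big_const_ord iter_addr_0 mulr_natr.
Qed.

Lemma eq_avg m F G : (forall e, cabs e = 1 -> F e = G e) -> avg m F = avg m G.
Proof.
by move=> h; congr (_ * _); apply: eq_bigr => j _; apply/h/cabs_circle_root.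
Qed.

Lemma avgD m F G : avg m (fun e => F e + G e) = avg m F + avg m G.
Proof. by rewrite /avg big_split mulrDr. Qed.

Lemma avgZ m a F : avg m (fun e => a * F e) = a * avg m F.
Proof. by rewrite /avg -mulr_sumr mulrCA. Qed.

Lemma avg_cst m a : avg m (fun=> a) = a.
Proof.
by rewrite /avg big_const_ord iter_addr_0 -[a *+ _]mulr_natl mulrA mulVf ?mul1r//.
Qed.

Lemma sum_double (T : nat -> C) n :
  \sum_(j < n + n) T j = \sum_(j < n) T j + \sum_(j < n) T (n + j)%N.
Proof. exact: (big_split_ord (GRing.add : Monoid.law (0 : C))). Qed.

Lemma trap_sum (G : C -> C) p m a h : trap G p m a h =
  \sum_(j < 2 ^ m) trap G p 0 (a + j%:R * (h / (2 ^ m)%:R)) (h / (2 ^ m)%:R).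
Proof.
elim: m a h => [|m IH] a h; first by rewrite big_ord1 mul0r addr0 divr1.
rewrite expnS mul2n -addnn.
rewrite (sum_double (fun j => trap G p 0 (a + j%:R * _) _)) [LHS]/= !IH.
have e : h / 2 / (2 ^ m)%:R = h / (2 ^ m + 2 ^ m)%:R :> R.
  by rewrite natrD; field; rewrite ?pow2_neq0 ?andbT -natrD pnatr_eq0 addn_eq0 expn_eq0.
rewrite e; congr (_ + _); apply: eq_bigr => j _; congr (trap _ _ 0 _ _).
rewrite -!addrA; congr (_ + _); rewrite (natrD _ (2 ^ m) j) mulrDl; congr (_ + _).
by rewrite natrD; field; rewrite ?pow2_neq0 ?andbT -natrD pnatr_eq0 addn_eq0 expn_eq0.
Qed.

Lemma sum_shift (H : nat -> C) n : H n = H 0%N ->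
  \sum_(j < n) H j.+1 = \sum_(j < n) H j.
Proof.
move=> h; apply: (addrI (H 0%N)).
by rewrite -(big_ord_recl n (fun j : 'I_n.+1 => H j)) big_ord_recr /= h addrC.
Qed.

(* Summation by parts on the closed polygon replaces the increments of the path
   by a common factor, which cancels from the comparison of two circles. *)
Lemma trap_circle (G : C -> C) (c r : C) m :
  trap G (fun t => c + r * cis (2 * pi * t)) m 0 1 =
  (circle_root m - (circle_root m)^-1) / 2 * (2 ^ m)%:R *
  avg m (fun e => G (c + r * e) * (r * e)).
Proof.
rewrite trap_sum; set u := circle_root m; have u0 := circle_root_neq0 m.
pose F j := G (c + r * u ^+ j).
have uM : u ^+ (2 ^ m) = 1 by exact: circle_rootX.
have pE (j : nat) : cis (2 * pi * (j%:R * (1 / (2 ^ m)%:R))) = u ^+ j.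
  by rewrite -cisM; congr cis; field; rewrite pow2_neq0.
transitivity (\sum_(j < 2 ^ m) ((F j * u ^+ j) * (r * (u - 1) / 2) +
    (F j.+1 * u ^+ j.+1) * (r * (1 - u^-1) / 2))).
  apply: eq_bigr => j _ /=; rewrite add0r.
  have -> : j%:R * (1 / (2 ^ m)%:R) + 1 / (2 ^ m)%:R =
    j.+1%:R * (1 / (2 ^ m)%:R) :> R by rewrite -natr1; ring.
  by rewrite !pE -!/(F _) exprS; field.
rewrite big_split -!mulr_suml /=.
rewrite (@sum_shift (fun j => F j * u ^+ j)) ?/F ?uM ?expr0//.
rewrite /avg -/u [RHS]mulrA mulfK ?cpow2_neq0//.
transitivity ((\sum_(j < 2 ^ m) F j * u ^+ j) * (r * ((u - u^-1) / 2))).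
  by rewrite /F; field.
rewrite mulr_suml [RHS]mulr_sumr.
by apply: eq_bigr => j _; rewrite /F; ring.
Qed.

(** The factor is i * 2^m * sin(2 pi / 2^m), a discrete 2 pi i; a lower bound suffices to divide it
    out. [3 <= m] puts the angle t in [0, 1], where sin t >= t/2 makes the modulus at least pi. *)
Lemma circle_root_step m : (3 <= m)%N ->
  1 <= cabs ((circle_root m - (circle_root m)^-1) / 2 * (2 ^ m)%:R).
Proof.
move=> m3; pose t : R := 2 * pi / (2 ^ m)%:R.
have M0 : 0 < (2 ^ m)%:R :> R by rewrite ltr0n expn_gt0.
have M8 : 8 <= (2 ^ m)%:R :> R.
  by rewrite ler_nat (@leq_exp2l 2 3).
have t01 : 0 <= t <= 1.
  rewrite /t divr_ge0 ?mulr_ge0 ?pi_ge0 ?ler0n//= ler_pdivrMr// mul1r.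
  by have := @pihalf_lt2 R; lra.
have -> : (circle_root m - (circle_root m)^-1) / 2 = Complex 0 (sin t).
  rewrite /circle_root -/t -cisN /cis cosN sinN.
  have -> : Complex (cos t) (sin t) - Complex (cos t) (- sin t) = 2 * Complex 0 (sin t).
    by rewrite -(natc 2); simpc; congr Complex; ring.
  by rewrite mulrC mulKf// -natc realc_eq0.
rewrite cabsM cabs_nat.
have -> : cabs (Complex 0 (sin t)) = `|sin t|.
  by rewrite /cabs /abs2 /= expr0n add0r sqrtr_sqr.
have h1 := sin_ge_half t01.
have h2 := ler_norm (sin t).
have h3 : t / 2 * (2 ^ m)%:R = pi by rewrite /t; field; rewrite pow2_neq0.
have := @pi_ge2 R; rewrite -h3 => h4.
have := ler_wpM2r (ltW M0) (le_trans h1 h2); lra.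
Qed.

(** [goursat] is applied to g(z)/(z - w) along the straight homotopy [ga] from a small circle about
    [w] to the circle of radius [r] about 0. Each intermediate path is closed, so the edges t = 0
    and t = 1 cancel and the two circles are compared. On the small one the average is that of g(w +
    del e), close to g(w). *)
Theorem cauchy_formula (g : C -> C) (w : C) (r : R) : cabs w < r ->
  (forall z, cabs z <= r -> cdiff g z) -> forall eps : R, 0 < eps ->
  exists m0, forall m, (m0 <= m)%N ->
    cabs (avg m (fun e => g (r%:C%C * e) * (1 - w / (r%:C%C * e))^-1) - g w) <= eps.
Proof.
move=> wr hg eps eps0; have w0 := cabs_ge0 w.
have [b hb] := hg w (ltW wr).
have [d1 d10 hd1] := hb 1 ltr01.
(* [del] keeps the small circle inside radius [r], stays within the range [d1] where the first-order
   remainder of [g] is at most the distance to [w], and makes (|b| + 1) del <= eps/2. *)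
pose del := Num.min (Num.min (r - cabs w) d1 / 2) (eps / 2 / (cabs b + 1)).
have b1 : 0 < cabs b + 1 by have := cabs_ge0 b; lra.
have del0 : 0 < del.
  by rewrite lt_min !divr_gt0 ?lt_min ?subr_gt0 ?wr.
have [delr deld] : cabs w + del < r /\ del < d1.
  have : del <= Num.min (r - cabs w) d1 / 2 by rewrite ge_min lexx.
  have : Num.min (r - cabs w) d1 <= r - cabs w by rewrite ge_min lexx.
  have : Num.min (r - cabs w) d1 <= d1 by rewrite ge_min lexx orbT.
  by split; lra.
have dele : del * (cabs b + 1) <= eps / 2.
  by rewrite -ler_pdivlMr// ge_min lexx orbT.
pose ga (s t : R) : C := (1 - s)%:C%C * w + ((1 - s) * del + s * r)%:C%C * cis (2 * pi * t).
pose G z := g z / (z - w).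
have gaw s t : 0 <= s <= 1 -> 0 < cabs (ga s t - w).
  move=> s01.
  have -> : ga s t - w = ((1 - s) * del + s * r)%:C%C * cis (2 * pi * t) - s%:C%C * w.
    by rewrite /ga rmorphB rmorph1; ring.
  have := cabs_le_dist (((1 - s) * del + s * r)%:C%C * cis (2 * pi * t)) (s%:C%C * w).
  rewrite !cabsM !cabs_real cabs_cis !ger0_norm; nra.
have gar s t : 0 <= s <= 1 -> cabs (ga s t) <= r.
  move=> s01; apply: (le_trans (cabsD _ _)).
  rewrite !cabsM !cabs_real cabs_cis !ger0_norm; nra.
have Gdiff s t : 0 <= s <= 1 -> 0 <= t <= 1 -> cdiff G (ga s t).
  move=> s01 _; apply: cdiff_div; last by apply/hg/gar.
  by rewrite -subr_eq0 -cabs_gt0 gaw.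
pose K := (cabs w + del + r) * (4 * pi + 1).
have pi0 := @pi_ge0 R.
have K0 : 0 <= K by rewrite mulr_ge0//; lra.
have Glip s s' t t' : 0 <= s <= 1 -> 0 <= s' <= 1 -> 0 <= t <= 1 -> 0 <= t' <= 1 ->
     cabs (ga s t - ga s' t') <= K * (`|s - s'| + `|t - t'|).
  move=> hs hs' ht ht'.
  have -> : ga s t - ga s' t' = (s' - s)%:C%C * w
     + ((s - s') * (r - del))%:C%C * cis (2 * pi * t)
     + ((1 - s') * del + s' * r)%:C%C * (cis (2 * pi * t) - cis (2 * pi * t')).
    rewrite /ga !(rmorphD, rmorphB, rmorphM, rmorph1) /=; ring.
  have l1 := cis_lip (2 * pi * t') (2 * pi * t).
  rewrite -mulrBr normrM (ger0_norm (_ : 0 <= 2 * pi)) in l1; last by lra.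
  apply: (le_trans (cabsD _ _)).
  apply: (le_trans (lerD (cabsD _ _) (lexx _))).
  rewrite !cabsM !cabs_real cabs_cis normrM (distrC s' s).
  rewrite (ger0_norm (_ : 0 <= r - del)); last by lra.
  have q0 : 0 <= (1 - s') * del + s' * r by rewrite addr_ge0// mulr_ge0//; lra.
  rewrite (ger0_norm q0); move: q0.
  have : (1 - s') * del + s' * r <= del + r by nra.
  have := normr_ge0 (s - s'); have := normr_ge0 (t - t').
  move: l1; rewrite /K.
  set x := `|s - s'|; set y := `|t - t'|; set c := cabs _; set q := _ + _ * r.
  move=> l1 y0 x0 q1 q0.
  have c0 : 0 <= c by exact: cabs_ge0.
  have l2 : q * c <= (del + r) * (2 * (2 * pi * y)) by apply: ler_pM => //; lra.
  have r0 : 0 <= r by lra.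
  have W1 := mulr_ge0 pi0 (mulr_ge0 w0 x0).
  have W2 := mulr_ge0 pi0 (mulr_ge0 (ltW del0) x0).
  have W3 := mulr_ge0 pi0 (mulr_ge0 r0 x0).
  have W4 := mulr_ge0 pi0 (mulr_ge0 w0 y0).
  have W5 := mulr_ge0 w0 y0.
  have W6 := mulr_ge0 (ltW del0) y0.
  have W7 := mulr_ge0 r0 y0.
  have W8 := mulr_ge0 (ltW del0) x0.
  have : q * c <= (del + r) * (4 * pi) * y by rewrite -!mulrA; rewrite -!mulrA in l2; lra.
  lra.
have e20 : 0 < eps / 2 by lra.
have [k0 hk0] := goursat K0 Glip Gdiff e20.
exists (maxn k0 3) => m; rewrite geq_max => /andP[/hk0 + m3].
have mid s t : ga s 1 = ga s 0 by rewrite /ga mulr1 mulr0 cis2pi cis0.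
rewrite /boxsum !add0r.
have -> : trap G (ga ^~ 1) m 0 1 = trap G (ga ^~ 0) m 0 1.
  by congr (trap _ _ _ _ _); apply/funext => s; apply: mid.
rewrite [X in X - _]addrAC subrr add0r.
have -> : ga 1 = fun t => 0 + r%:C%C * cis (2 * pi * t).
  by apply/funext => t; rewrite /ga subrr !mul0r mul1r !add0r.
have -> : ga 0 = fun t => w + del%:C%C * cis (2 * pi * t).
  by apply/funext => t; rewrite /ga subr0 rmorph1 !mul1r mul0r addr0.
rewrite !trap_circle -mulrBr cabsM => bound.
pose Ai := avg m (fun e => G (w + del%:C%C * e) * (del%:C%C * e)).
pose Ao := avg m (fun e => G (0 + r%:C%C * e) * (r%:C%C * e)).
have -> : avg m (fun e => g (r%:C%C * e) / (1 - w / (r%:C%C * e))) = Ao.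
  apply: eq_avg => e e1; rewrite add0r /G.
  have re0 : r%:C%C * e != 0 by rewrite -cabs_gt0 cabsM cabs_real e1 mulr1 gtr0_norm; lra.
  have w1 : r%:C%C * e - w != 0.
    have := cabs_le_dist (r%:C%C * e) w.
    by rewrite -cabs_gt0 cabsM cabs_real e1 mulr1 gtr0_norm; lra.
  have [r1 e2] : r%:C%C != 0 :> C /\ e != 0 by apply/andP; rewrite -negb_or -mulf_eq0.
  by field; apply/and3P.
have h1 : cabs (Ao - Ai) <= eps / 2.
  have := circle_root_step m3; have := cabs_ge0 (Ao - Ai).
  move: bound; rewrite -/Ao -/Ai; set k := cabs (_ / 2 * _); nra.
have h2 : cabs (Ai - g w) <= eps / 2.
  rewrite -(avg_cst m (g w)) -mulN1r -avgZ -avgD; apply: cabs_avg => e e1.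
  have d0 : del%:C%C * e != 0.
    by rewrite -cabs_gt0 cabsM cabs_real e1 mulr1 gtr0_norm.
  rewrite /G addrAC subrr add0r mulfVK// mulN1r.
  have dd : cabs (w + del%:C%C * e - w) = del.
    by rewrite addrAC subrr add0r cabsM cabs_real e1 mulr1 gtr0_norm.
  have := hd1 (w + del%:C%C * e); rewrite dd => /(_ deld); rewrite mul1r => h3.
  have := cabs_le_dist (g (w + del%:C%C * e) - g w) (b * (w + del%:C%C * e - w)).
  rewrite cabsM dd; lra.
have := cabs_distD Ai Ao (g w); lra.
Qed.

End CauchyFormula.

(** * Ultrafilter limits and Taylor expansion in one variable *)

Section UltraLimit.
Context {R : realType}.
Notation C := R[i].

(* Limits along a fixed free ultrafilter exist for every bounded sequence and are linear;
   this makes the Taylor coefficients below linear functionals of the function. *)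
Definition umod : set_system nat :=
  projT1 (cid (ultraFilterLemma (eventually_filter))).

Lemma umod_ultra : UltraFilter umod.
Proof. by rewrite /umod; case: cid => F []. Qed.

#[global] Instance umod_proper : ProperFilter umod.
Proof. exact: (@ultra_proper _ _ umod_ultra). Qed.

Lemma umod_eventually (P : nat -> Prop) :
  (exists n0, forall n, (n0 <= n)%N -> P n) -> umod P.
Proof.
rewrite /umod; case: cid => F [_ +] /= [n0 h]; apply; exists n0 => //.
Qed.

Definition uconv (u : nat -> C) (l : C) :=
  forall eps : R, 0 < eps -> umod (fun n => cabs (u n - l) <= eps).

Lemma uconv_unique u l1 l2 : uconv u l1 -> uconv u l2 -> l1 = l2.
Proof.
move=> h1 h2; apply/subr0_eq/cabs_le_eps => eps e0.
have e20 : 0 < eps / 2 by rewrite divr_gt0.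
have [n [/= n1 n2]] := filter_ex (filterI (h1 _ e20) (h2 _ e20)).
have := cabs_distD (u n) l1 l2; rewrite (cabs_distC l1 (u n)); lra.
Qed.

Lemma uconvD u v l1 l2 : uconv u l1 -> uconv v l2 ->
  uconv (fun n => u n + v n) (l1 + l2).
Proof.
move=> h1 h2 eps e0; have e20 : 0 < eps / 2 by rewrite divr_gt0.
apply: filterS (filterI (h1 _ e20) (h2 _ e20)) => n [/= n1 n2].
have := cabsD (u n - l1) (v n - l2).
by rewrite (_ : u n - l1 + (v n - l2) = u n + v n - (l1 + l2)); [lra|ring].
Qed.

Lemma uconvZ a u l : uconv u l -> uconv (fun n => a * u n) (a * l).
Proof.
move=> h eps e0; have a1 : 0 < cabs a + 1 by have := cabs_ge0 a; lra.
have e20 : 0 < eps / (cabs a + 1) by rewrite divr_gt0.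
apply: filterS (h _ e20) => n /=; rewrite ler_pdivlMr// -mulrBr cabsM.
have := cabs_ge0 a; have := cabs_ge0 (u n - l); nra.
Qed.

Lemma uconv_le u l A : (forall n, cabs (u n) <= A) -> uconv u l -> cabs l <= A.
Proof.
move=> hA h; apply/ler_addgt0Pr => e e0.
have [n n1] := filter_ex (h _ e0); have := hA n.
have := cabs_le_dist l (u n); rewrite (cabs_distC l (u n)); lra.
Qed.

(** The limit is the supremum of the levels [x] with [x <= u n] for almost all [n]. A level above it
    fails this, and the ultrafilter then contains the complementary set. *)
Lemma real_uconv (u : nat -> R) A : (forall n, `|u n| <= A) ->
  exists l, forall eps : R, 0 < eps -> umod (fun n => `|u n - l| <= eps).
Proof.
move=> hA; pose S := [set x : R | umod (fun n => x <= u n)]%classic.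
have SA : S (- A) by apply: filterE => n; have := hA n; rewrite ler_norml => /andP[].
have Sub : ubound S A.
  move=> x xS; have [n n1] := filter_ex xS.
  by have := hA n; rewrite ler_norml => /andP[_]; exact: le_trans.
have hS : has_sup S by split; [exists (- A)|exists A].
exists (sup S) => eps e0.
have [x xS hx] := sup_adherent e0 hS.
have nS : ~ S (sup S + eps).
  by move=> /(sup_upper_bound hS); rewrite gerDl leNgt e0.
have [//|h] := @in_ultra_setVsetC _ _ [set n | sup S + eps <= u n]%classic umod_ultra.
apply: filterS (filterI xS h) => n [/= n1 /negP]; rewrite -ltNge => n2.
by rewrite ler_norml; lra.
Qed.

Lemma uconv_ex u A : (forall n, cabs (u n) <= A) -> exists l, uconv u l.
Proof.
move=> hA.
have [x hx] : exists l, forall eps : R, 0 < eps ->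
    umod (fun n => `|complex.Re (u n) - l| <= eps).
  by apply: (@real_uconv _ A) => n; apply: le_trans (hA n); exact: Re_le_cabs.
have [y hy] : exists l, forall eps : R, 0 < eps ->
    umod (fun n => `|complex.Im (u n) - l| <= eps).
  by apply: (@real_uconv _ A) => n; apply: le_trans (hA n); exact: Im_le_cabs.
exists (Complex x y) => eps e0; have e20 : 0 < eps / 2 by rewrite divr_gt0.
apply: filterS (filterI (hx _ e20) (hy _ e20)) => n [/= n1 n2].
apply: (le_trans (cabs_le_ReIm _)); rewrite ReB ImB /=; lra.
Qed.

Definition clim (u : nat -> C) : C := xget 0 (uconv u).

Lemma clim_eq u l : uconv u l -> clim u = l.
Proof. by move=> h; apply: xget_unique => // l' h'; apply: uconv_unique h' h. Qed.

Lemma climP u A : (forall n, cabs (u n) <= A) -> uconv u (clim u).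
Proof. by move=> /uconv_ex[l h]; rewrite (clim_eq h). Qed.

(** A substitute for the integral over the unit circle that is linear on all bounded functions,
    whether continuous or not. *)
Definition mean (F : C -> C) : C := clim (fun m => avg m F).

Lemma eq_mean F G : (forall e, cabs e = 1 -> F e = G e) -> mean F = mean G.
Proof. by move=> h; congr clim; apply/funext => m; apply: eq_avg. Qed.

Lemma mean_le F (A : R) : (forall e, cabs e = 1 -> cabs (F e) <= A) ->
  cabs (mean F) <= A.
Proof.
move=> hF; have hA m := cabs_avg m hF; exact: uconv_le hA (climP hA).
Qed.

Lemma mean_linear a F G A B : (forall e, cabs e = 1 -> cabs (F e) <= A) ->
  (forall e, cabs e = 1 -> cabs (G e) <= B) ->
  mean (fun e => a * F e + G e) = a * mean F + mean G.
Proof.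
move=> hF hG; apply: clim_eq.
under eq_fun do rewrite avgD avgZ.
apply: uconvD; first apply: uconvZ.
  exact: (climP (fun m => cabs_avg m hF)).
exact: (climP (fun m => cabs_avg m hG)).
Qed.

Lemma mean0 : mean (fun=> 0) = 0.
Proof.
apply: clim_eq => eps e0; apply: filterE => n.
by rewrite avg_cst subrr cabs0 ltW.
Qed.

Lemma meanZ a F A : (forall e, cabs e = 1 -> cabs (F e) <= A) ->
  mean (fun e => a * F e) = a * mean F.
Proof.
move=> hF; rewrite -[RHS]addr0 -mean0 -(mean_linear _ hF (B := 0)).
  by apply: eq_mean => e _; rewrite addr0.
by rewrite cabs0.
Qed.

Lemma mean_sum (I : Type) (s : seq I) (F : I -> C -> C) (A : I -> R) :
  (forall i e, cabs e = 1 -> cabs (F i e) <= A i) ->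
  mean (fun e => \sum_(i <- s) F i e) = \sum_(i <- s) mean (F i).
Proof.
move=> hF; elim: s => [|i s IH].
  by rewrite big_nil -[RHS]mean0; apply: eq_mean => e _; rewrite big_nil.
rewrite big_cons -IH -[mean (F i)]mul1r.
rewrite -(mean_linear 1 (hF i) (B := \sum_(j <- s) A j)).
  by apply: eq_mean => e _; rewrite big_cons mul1r.
move=> e e1; apply: (le_trans (cabs_sum _ _ _)); apply: ler_sum => j _.
exact: hF.
Qed.

Lemma cauchy_mean (g : C -> C) (w : C) (r : R) : cabs w < r ->
  (forall z, cabs z <= r -> cdiff g z) ->
  mean (fun e => g (r%:C%C * e) * (1 - w / (r%:C%C * e))^-1) = g w.
Proof.
move=> wr hg; apply: clim_eq => eps e0; apply: umod_eventually.
exact: cauchy_formula.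
Qed.

Lemma geo_series (x : C) N : x != 1 ->
  (1 - x)^-1 = \sum_(k < N) x ^+ k + x ^+ N * (1 - x)^-1.
Proof.
move=> x1; have x1' : 1 - x != 0 by rewrite subr_eq0 eq_sym.
apply: (mulfI x1'); rewrite mulrDr mulrCA divff// mulr1.
by rewrite -[X in _ = X + _]opprK -mulNr opprB -subrX1 opprB subrK.
Qed.

Definition coef (g : C -> C) (r : R) (k : nat) : C :=
  mean (fun e => g (r%:C%C * e) * (r%:C%C * e) ^- k).

Lemma cabs_geo_inv (x : C) q : cabs x <= q -> q < 1 ->
  cabs (1 - x)^-1 <= (1 - q)^-1.
Proof.
move=> xq q1; rewrite cabsV lef_pV2 ?posrE; first 1 last.
- by have := cabs_le_dist 1 x; rewrite cabs1; lra.
- by lra.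
by have := cabs_le_dist 1 x; rewrite cabs1; lra.
Qed.

(** The Cauchy kernel 1/(1 - x), x = w/(r e), is cut after [N] terms. Its tail x^N/(1 - x) is
    controlled by |x| = |w|/r, and the mean is linear. *)
Theorem taylor_bound (g : C -> C) (r A : R) (w : C) N : cabs w < r ->
  (forall z, cabs z <= r -> cdiff g z) ->
  (forall z, cabs z = r -> cabs (g z) <= A) ->
  cabs (g w - \sum_(k < N) coef g r k * w ^+ k) <=
    A * (cabs w / r) ^+ N / (1 - cabs w / r).
Proof.
move=> wr hg hA; have w0 := cabs_ge0 w; have r0 : 0 < r by lra.
set q := cabs w / r; have q0 : 0 <= q by rewrite divr_ge0// ltW.
have q1 : q < 1 by rewrite ltr_pdivrMr// mul1r.
have cre e : cabs e = 1 -> cabs (r%:C%C * e) = r.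
  by move=> e1; rewrite cabsM cabs_real e1 mulr1 gtr0_norm.
have xq e : cabs e = 1 -> cabs (w / (r%:C%C * e)) = q.
  by move=> e1; rewrite cabsM cabsV cre.
have hA' e : cabs e = 1 -> cabs (g (r%:C%C * e)) <= A by move=> e1; apply/hA/cre.
have A0 : 0 <= A by apply: le_trans (cabs_ge0 _) (hA' 1 _); rewrite cabs1.
rewrite -(cauchy_mean wr hg).
have -> : \sum_(k < N) coef g r k * w ^+ k =
    mean (fun e => \sum_(k < N) w ^+ k * (g (r%:C%C * e) * (r%:C%C * e) ^- k)).
  have hb (k : nat) e : cabs e = 1 -> cabs (g (r%:C%C * e) * (r%:C%C * e) ^- k) <= A / r ^+ k.
    by move=> e1; rewrite cabsM cabsV cabsX cre// ler_wpM2r ?hA'// invr_ge0 exprn_ge0// ltW.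
  rewrite (@mean_sum _ _ _ (fun k : 'I_N => cabs (w ^+ k) * (A / r ^+ k))).
    by apply: eq_bigr => k _; rewrite mulrC (meanZ _ (hb k)).
  by move=> k e e1; rewrite cabsM ler_wpM2l ?cabs_ge0// hb.
rewrite addrC -mulN1r.
have bd1 e : cabs e = 1 -> cabs (g (r%:C%C * e) * (1 - w / (r%:C%C * e))^-1) <= A * (1 - q)^-1.
  move=> e1; rewrite cabsM ler_pM ?cabs_ge0 ?hA'//.
  by apply: cabs_geo_inv => //; rewrite xq.
rewrite -(mean_linear _ (A := \sum_(k < N) cabs w ^+ k * (A / r ^+ k)) _ bd1).
  apply: mean_le => e e1.
  have x1 : w / (r%:C%C * e) != 1.
    by apply/eqP => x1; have := xq _ e1; rewrite x1 cabs1; lra.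
  have e0 : r%:C%C * e != 0 by rewrite -cabs_gt0 cre.
  rewrite (geo_series N x1) mulrDr.
  have -> : \sum_(k < N) w ^+ k * (g (r%:C%C * e) * (r%:C%C * e) ^- k) =
      g (r%:C%C * e) * \sum_(k < N) (w / (r%:C%C * e)) ^+ k.
    rewrite mulr_sumr; apply: eq_bigr => k _.
    by rewrite expr_div_n mulrCA.
  rewrite mulN1r addrA addNr add0r !cabsM cabsX xq// -mulrA.
  rewrite ler_pM ?mulr_ge0 ?exprn_ge0 ?cabs_ge0 ?hA'// ler_wpM2l ?exprn_ge0//.
  by apply: cabs_geo_inv => //; rewrite xq.
move=> e e1; apply: (le_trans (cabs_sum _ _ _)); apply: ler_sum => k _.
rewrite !cabsM !cabsX cabsV cabsX cre// ler_wpM2l ?exprn_ge0//.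
by rewrite ler_wpM2r ?hA'// invr_ge0 exprn_ge0// ltW.
Qed.

(** Strong induction on [k]: once the lower coefficients vanish, division by t^k leaves |c k| <=
    (|B| + S) t for small t. It serves to identify two expansions of the same slice obtained at
    different radii. *)
Lemma coef_unique (c : nat -> C) N (B s : R) : 0 < s ->
  (forall t : R, 0 < t <= s ->
     cabs (\sum_(k < N) c k * t%:C%C ^+ k) <= B * t ^+ N) ->
  forall k, (k < N)%N -> c k = 0.
Proof.
move=> s0 h; elim/ltn_ind => k IH kN; apply: cabs_le_eps => eps e0.
pose S : R := \sum_(j < N) cabs (c j); pose t := Num.min (Num.min s 1) (eps / (`|B| + S + 1)).
have S0 : 0 <= S by apply: sumr_ge0 => j _; exact: cabs_ge0.
have B1 : 0 < `|B| + S + 1 by have := normr_ge0 B; lra.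
have t0 : 0 < t by rewrite !lt_min s0 ltr01 divr_gt0.
have ts : t <= s by rewrite !ge_min lexx.
have t1 : t <= 1 by rewrite !ge_min lexx orbT.
have te : t * (`|B| + S + 1) <= eps by rewrite -ler_pdivlMr// ge_min lexx orbT.
have := h t; rewrite t0 ts => /(_ isT) hs.
have tk : 0 < t ^+ k by rewrite exprn_gt0.
rewrite -(ler_pM2r tk).
have E : c k * t%:C%C ^+ k = \sum_(j < N) c j * t%:C%C ^+ j
    - \sum_(j < N | j != Ordinal kN) c j * t%:C%C ^+ j.
  by rewrite (bigD1 (Ordinal kN))//= addrK.
have E2 : cabs (\sum_(j < N | j != Ordinal kN) c j * t%:C%C ^+ j) <= S * t ^+ k.+1.
  apply: (le_trans (cabs_sum _ _ _)); rewrite /S mulr_suml.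
  rewrite [leRHS](bigID (fun j => j != Ordinal kN))/= -[leLHS]addr0; apply: lerD.
    apply: ler_sum => j jk; rewrite cabsM cabsX cabs_real gtr0_norm//.
    have [jlt|jgt|jeq] := ltngtP j k.
    - by rewrite IH// cabs0 !mul0r.
    - by rewrite ler_wpM2l ?cabs_ge0// ler_wiXn2l// ltW.
    - by move: jk; rewrite -val_eqE /= jeq eqxx.
  by apply: sumr_ge0 => j _; rewrite mulr_ge0 ?cabs_ge0 ?exprn_ge0// ltW.
have E3 : B * t ^+ N <= `|B| * t ^+ k.+1.
  apply: (@le_trans _ _ (`|B| * t ^+ N)).
    by rewrite ler_wpM2r ?ler_norm// exprn_ge0// ltW.
  by rewrite ler_wpM2l// ler_wiXn2l// ltW.
have -> : cabs (c k) * t ^+ k = cabs (c k * t%:C%C ^+ k).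
  by rewrite cabsM cabsX cabs_real gtr0_norm.
rewrite E; apply: (le_trans (cabsB _ _)).
apply: (le_trans (lerD (le_trans hs E3) E2)).
by rewrite -mulrDl exprS mulrA ler_pM2r//; lra.
Qed.

End UltraLimit.

(** * Taylor polynomials in several variables *)

Section TorusMean.
Context {R : realType} {d : nat}.
Notation C := R[i].
Implicit Types (w z y : 'I_d -> C) (i : 'I_d) (s : seq 'I_d) (r : R)
  (F G f : ('I_d -> C) -> C).

Definition upd w i (x : C) : 'I_d -> C := fun k => if k == i then x else w k.

Lemma upd_id w i : upd w i (w i) = w.
Proof. by apply/funext => k; rewrite /upd; case: eqP => [->|]. Qed.

Lemma upd_upd w i (x x' : C) : upd (upd w i x) i x' = upd w i x'.
Proof. by apply/funext => k; rewrite /upd; case: eqP. Qed.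

Lemma upd_same w i (x : C) : upd w i x i = x.
Proof. by rewrite /upd eqxx. Qed.

(** Iterated mean over the torus in the coordinates listed in [s]; the other coordinates stay those
    of [w]. *)
Fixpoint tmean r s F w : C :=
  if s is i :: s' then mean (fun e => tmean r s' F (upd w i (r%:C%C * e)))
  else F w.

Definition on_torus r s w z :=
  forall k, if k \in s then cabs (z k) = r else z k = w k.

Lemma cabs_circle r (e : C) : 0 <= r -> cabs e = 1 -> cabs (r%:C%C * e) = r.
Proof. by move=> r0 e1; rewrite cabsM cabs_real e1 mulr1 ger0_norm. Qed.

Lemma on_torus_cons r i s w z (e : C) : 0 <= r -> cabs e = 1 ->
  on_torus r s (upd w i (r%:C%C * e)) z -> on_torus r (i :: s) w z.
Proof.
move=> r0 e1 h k; have := h k; rewrite inE /upd.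
by case: ifP => [_ ->|_ ->]; rewrite ?orbT// orbF; case: eqP => // _; exact: cabs_circle.
Qed.

Lemma tmean_le r s F w (A : R) : 0 <= r ->
  (forall z, on_torus r s w z -> cabs (F z) <= A) -> cabs (tmean r s F w) <= A.
Proof.
move=> r0; elim: s w => [|i s IH] w h /=; first exact: h.
by apply: mean_le => e e1; apply: IH => z /(on_torus_cons r0 e1); exact: h.
Qed.

Lemma eq_tmean r s F G w : 0 <= r ->
  (forall z, on_torus r s w z -> F z = G z) -> tmean r s F w = tmean r s G w.
Proof.
move=> r0; elim: s w => [|i s IH] w h /=; first exact: h.
by apply: eq_mean => e e1; apply: IH => z /(on_torus_cons r0 e1); exact: h.
Qed.

Lemma tmean_linear r s F G w a A B : 0 <= r ->
  (forall z, on_torus r s w z -> cabs (F z) <= A) ->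
  (forall z, on_torus r s w z -> cabs (G z) <= B) ->
  tmean r s (fun z => a * F z + G z) w = a * tmean r s F w + tmean r s G w.
Proof.
move=> r0; elim: s w => [//|i s IH] w hF hG /=.
have hF' e : cabs e = 1 -> forall z, on_torus r s (upd w i (r%:C%C * e)) z -> cabs (F z) <= A.
  by move=> e1 z /(on_torus_cons r0 e1); exact: hF.
have hG' e : cabs e = 1 -> forall z, on_torus r s (upd w i (r%:C%C * e)) z -> cabs (G z) <= B.
  by move=> e1 z /(on_torus_cons r0 e1); exact: hG.
rewrite -(@mean_linear _ _ _ _ A B).
- by apply: eq_mean => e e1; apply: IH; [exact: hF'|exact: hG'].
- by move=> e e1; apply: tmean_le => //; exact: hF'.
- by move=> e e1; apply: tmean_le => //; exact: hG'.
Qed.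

Lemma tmean0 r s w : 0 <= r -> tmean r s (fun=> 0) w = 0.
Proof.
move=> r0; apply/eqP; rewrite -cabs_eq0 eq_le cabs_ge0 andbT.
by apply: tmean_le => // z _; rewrite cabs0.
Qed.

Lemma tmeanZ r s F w a A : 0 <= r ->
  (forall z, on_torus r s w z -> cabs (F z) <= A) ->
  tmean r s (fun z => a * F z) w = a * tmean r s F w.
Proof.
move=> r0 hF; rewrite -[RHS]addr0 -(tmean0 s w r0).
rewrite -(tmean_linear _ r0 hF (B := 0)); last by move=> z _; rewrite cabs0.
by apply: eq_tmean => // z _; rewrite addr0.
Qed.

Lemma tmean_sum r s w (I : Type) (t : seq I) (P : pred I) (F : I -> ('I_d -> C) -> C) (A : I -> R) :
  0 <= r -> (forall j z, on_torus r s w z -> cabs (F j z) <= A j) ->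
  tmean r s (fun z => \sum_(j <- t | P j) F j z) w = \sum_(j <- t | P j) tmean r s (F j) w.
Proof.
move=> r0 hF; elim: t => [|j t IH].
  by rewrite big_nil -[RHS](tmean0 s w r0); apply: eq_tmean => // z _; rewrite big_nil.
rewrite big_cons -IH; case: ifP => Pj; last first.
  by apply: eq_tmean => // z _; rewrite big_cons Pj.
rewrite -[tmean r s (F j) w]mul1r -(tmean_linear 1 r0 (hF j) (B := \sum_(j <- t | P j) A j)).
  by apply: eq_tmean => // z _; rewrite big_cons Pj mul1r.
move=> z zt; apply: (le_trans (cabs_sum _ _ _)); apply: ler_sum => k _.
exact: hF.
Qed.

Lemma tmean_start r s F w y : (forall k, k \notin s -> w k = y k) ->
  tmean r s F w = tmean r s F y.
Proof.
elim: s w y => [|i s IH] w y h /=.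
  by congr F; apply/funext => k; apply: h.
apply: eq_mean => e e1; apply: IH => k ks; rewrite /upd.
by case: eqP => // /eqP ki; apply: h; rewrite inE negb_or ki.
Qed.

(** One-variable Cauchy formula in each coordinate of [s] in turn. The base point [y] is kept apart
    from [w] because coordinates already treated lie on the circle of radius [r]. *)
Theorem tmean_cauchy f r (A : R) s w y : 0 < r -> uniq s ->
  (forall z, (forall k, cabs (z k) <= r) -> cabs (f z) <= A) ->
  (forall z i, (forall k, cabs (z k) <= r) -> cdiff (fun x => f (upd z i x)) (z i)) ->
  (forall k, cabs (w k) < r) ->
  (forall k, cabs (y k) <= r) -> (forall k, k \in s -> y k = w k) ->
  tmean r s (fun z => f z * \prod_(i <- s) (1 - w i / z i)^-1) y = f y.
Proof.
move=> r0 + hA hd wr; have r0' := ltW r0.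
elim: s y => [|i s IH] y /=; first by rewrite big_nil mulr1.
move=> /andP[is_ us] yr yw.
have yi : y i = w i by apply: yw; rewrite mem_head.
have updr (x : C) : cabs x <= r -> forall k, cabs (upd y i x k) <= r.
  by move=> xr k; rewrite /upd; case: eqP.
transitivity (mean (fun e => f (upd y i (r%:C%C * e)) * (1 - w i / (r%:C%C * e))^-1)).
  apply: eq_mean => e e1; have er := cabs_circle r0' e1.
  rewrite -(IH (upd y i (r%:C%C * e)))//; first last.
  - move=> k ks; rewrite /upd; case: eqP => [ki|_]; first by rewrite -ki ks in is_.
    by apply: yw; rewrite inE ks orbT.
  - by apply: updr; rewrite er.
  rewrite [RHS]mulrC -(@tmeanZ _ _ _ _ _ (A * \prod_(i <- s) (1 - cabs (w i) / r)^-1))//.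
    apply: eq_tmean => // z /(_ i); rewrite (negbTE is_) upd_same big_cons => ->.
    by rewrite mulrCA.
  move=> z zt; rewrite cabsM cabs_prod; apply: ler_pM; first exact: cabs_ge0.
  - by apply: prodr_ge0 => *; exact: cabs_ge0.
  - apply: hA => k; have := zt k; case: ifP => [_ ->//|_ ->].
    by apply: updr; rewrite er.
  rewrite big_seq_cond [leRHS]big_seq_cond; apply: ler_prod => k /andP[ks _].
  rewrite cabs_ge0 /=; apply: cabs_geo_inv; last by rewrite ltr_pdivrMr// mul1r.
  by have := zt k; rewrite ks cabsM cabsV => ->.
rewrite (@cauchy_mean _ (fun x => f (upd y i x)))//.
  by rewrite -yi upd_id.
move=> x xr; have := hd _ i (updr _ xr); rewrite upd_same.
by under eq_fun do rewrite upd_upd.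
Qed.

End TorusMean.

Section MultiTaylor.
Context {R : realType} {d : nat}.
Notation C := R[i].
Implicit Types (w z u x : 'I_d -> C) (f : ('I_d -> C) -> C).

Definition mpow N (w : 'I_d -> C) (al : {ffun 'I_d -> 'I_N}) : C :=
  \prod_i w i ^+ al i.

Definition mdeg N (al : {ffun 'I_d -> 'I_N}) : nat := (\sum_i al i)%N.

Definition mcoef (f : ('I_d -> C) -> C) (r : R) N (al : {ffun 'I_d -> 'I_N}) : C :=
  tmean r (enum 'I_d) (fun z => f z * (mpow z al)^-1) (fun=> 0).

(** Total degree below [N] forces each exponent below [N], so exponents in ['I_N] lose no monomial
    and index a family of N^d of them. *)
Definition mtaylor (f : ('I_d -> C) -> C) (r : R) N (w : 'I_d -> C) : C :=
  \sum_(al : {ffun 'I_d -> 'I_N} | (mdeg al < N)%N) mcoef f r al * mpow w al.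

Lemma cabs_mpow_le N w (al : {ffun 'I_d -> 'I_N}) (q : R) :
  (forall i, cabs (w i) <= q) -> cabs (mpow w al) <= q ^+ mdeg al.
Proof.
move=> wq; rewrite cabs_prod /mdeg -prodrXr; apply: ler_prod => i _.
by rewrite cabs_ge0 /= cabsX lerXn2r ?nnegrE ?cabs_ge0// (le_trans _ (wq i))// cabs_ge0.
Qed.

Lemma cabs_mpow_eq N w (al : {ffun 'I_d -> 'I_N}) (q : R) :
  (forall i, cabs (w i) = q) -> cabs (mpow w al) = q ^+ mdeg al.
Proof.
move=> wq; rewrite cabs_prod /mdeg -prodrXr; apply: eq_bigr => i _.
by rewrite cabsX wq.
Qed.

Lemma prod_dist (I : eqType) (s : seq I) (a b : I -> C) (K eta : R) : 1 <= K ->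
  0 <= eta -> (forall i, cabs (a i) <= K) -> (forall i, cabs (b i) <= K) ->
  (forall i, cabs (a i - b i) <= eta) ->
  cabs (\prod_(i <- s) a i - \prod_(i <- s) b i) <= (size s)%:R * K ^+ size s * eta.
Proof.
move=> K1 eta0 ha hb hab; have K0 : 0 <= K by lra.
elim: s => [|i s IH]; first by rewrite !big_nil subrr cabs0 !mul0r.
rewrite !big_cons.
have -> : a i * \prod_(j <- s) a j - b i * \prod_(j <- s) b j =
   (a i - b i) * \prod_(j <- s) a j + b i * (\prod_(j <- s) a j - \prod_(j <- s) b j) by ring.
have pa : cabs (\prod_(j <- s) a j) <= K ^+ size s.
  rewrite cabs_prod; apply: (@le_trans _ _ (\prod_(j <- s) K)).
    by apply: ler_prod => j _; rewrite cabs_ge0 ha.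
  by rewrite big_const_seq count_predT iter_mulr_1.
apply: (le_trans (cabsD _ _)); rewrite !cabsM /= -natr1 exprS.
have h1 : cabs (a i - b i) * cabs (\prod_(j <- s) a j) <= eta * K ^+ size s.
  by rewrite ler_pM ?cabs_ge0.
have h2 : cabs (b i) * cabs (\prod_(j <- s) a j - \prod_(j <- s) b j) <=
    K * ((size s)%:R * K ^+ size s * eta) by rewrite ler_pM ?cabs_ge0.
have h3 : eta * K ^+ size s <= K * (eta * K ^+ size s).
  by rewrite ler_peMl// mulr_ge0// exprn_ge0.
lra.
Qed.

(** Truncating each geometric series at [N] costs O(q^N). The product of the truncations expands
    into all exponents below [N], and the unwanted ones have total degree at least [N]. [B] may
    depend on [N]: only the order of vanishing in [q] is used later. *)
Lemma prod_geo_bound N : exists2 B : R, 0 <= B & forall u (q : R), 0 <= q <= 1 / 2 ->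
  (forall i, cabs (u i) <= q) ->
  cabs (\prod_i (1 - u i)^-1 -
    \sum_(al : {ffun 'I_d -> 'I_N} | (mdeg al < N)%N) mpow u al) <= B * q ^+ N.
Proof.
pose B1 : R := (size (index_enum 'I_d))%:R * 4 ^+ size (index_enum 'I_d) * 2.
pose B2 : R := #|{ffun 'I_d -> 'I_N}|%:R.
exists (B1 + B2); first by rewrite addr_ge0// !mulr_ge0 ?exprn_ge0.
move=> u q /andP[q0 q12] uq.
have q1 : q <= 1 by lra.
have qN0 : 0 <= q ^+ N by rewrite exprn_ge0.
have qN1 : q ^+ N <= 1 by rewrite exprn_ile1.
pose S i := \sum_(k < N) u i ^+ k.
have gu i : cabs (1 - u i)^-1 <= 2.
  apply: (le_trans (cabs_geo_inv (uq i) _)); first by lra.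
  by rewrite -[leRHS]invrK lef_pV2 ?posrE ?invr_gt0//; lra.
have SE i : (1 - u i)^-1 - S i = u i ^+ N * (1 - u i)^-1.
  have u1 : u i != 1 by apply/eqP => u1; have := uq i; rewrite u1 cabs1; lra.
  apply/eqP; rewrite subr_eq [eqbRHS]addrC; apply/eqP; exact: geo_series.
have uN i : cabs (u i ^+ N) <= q ^+ N.
  by rewrite cabsX lerXn2r ?nnegrE ?cabs_ge0.
have dS i : cabs ((1 - u i)^-1 - S i) <= 2 * q ^+ N.
  by rewrite SE cabsM mulrC ler_pM ?cabs_ge0.
have S4 i : cabs (S i) <= 4.
  have := cabs_le_dist (S i) (1 - u i)^-1; rewrite cabs_distC.
  have := dS i; have := gu i; lra.
have PS : \prod_i S i = \sum_(al : {ffun 'I_d -> 'I_N}) mpow u al.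
  by rewrite /S bigA_distr_bigA.
have -> : \prod_i (1 - u i)^-1 - \sum_(al : {ffun 'I_d -> 'I_N} | (mdeg al < N)%N) mpow u al =
   (\prod_i (1 - u i)^-1 - \prod_i S i) +
   \sum_(al : {ffun 'I_d -> 'I_N} | ~~ (mdeg al < N)%N) mpow u al.
  by rewrite PS [in RHS](bigID (fun al : {ffun 'I_d -> 'I_N} => (mdeg al < N)%N)) /=; ring.
apply: (le_trans (cabsD _ _)); rewrite mulrDl; apply: lerD.
  rewrite /B1 -[leRHS]mulrA; apply: prod_dist => //.
  - by lra.
  - by rewrite mulr_ge0.
  - by move=> i; have := gu i; lra.
apply: (le_trans (cabs_sum _ _ _)).
apply: (@le_trans _ _ (\sum_(al : {ffun 'I_d -> 'I_N}) q ^+ N)); last first.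
  by rewrite sumr_const /B2 mulr_natl.
rewrite [leRHS](bigID (fun al : {ffun 'I_d -> 'I_N} => (mdeg al < N)%N)) /=.
rewrite -[leLHS]add0r; apply: lerD; first by apply: sumr_ge0.
apply: ler_sum => al; rewrite -leqNgt => Nal.
by apply: (le_trans (cabs_mpow_le _ uq)); rewrite ler_wiXn2l.
Qed.

Section fixed_function.
Context (f : ('I_d -> C) -> C) (r A : R)
  (r0 : 0 < r)
  (fA : forall z, (forall k, cabs (z k) <= r) -> cabs (f z) <= A)
  (fd : forall z i, (forall k, cabs (z k) <= r) -> cdiff (fun c => f (upd z i c)) (z i)).

(** Valid near 0 only and with no control of [B] in [N]: it identifies the homogeneous parts, while
    the quantitative error comes from slices. *)
Lemma mtaylor_small N : exists B : R, forall x (q : R), 0 <= q <= 1 / 2 ->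
  (forall i, cabs (x i) <= q * r) -> cabs (f x - mtaylor f r N x) <= B * q ^+ N.
Proof.
have [B B0 hB] := prod_geo_bound N; exists (A * B) => x q q01 xq.
have r0' := ltW r0; set s := enum 'I_d.
have full z : on_torus r s (fun=> 0) z -> forall k, cabs (z k) = r.
  by move=> zt k; have := zt k; rewrite mem_enum.
have fz z : on_torus r s (fun=> 0) z -> cabs (f z) <= A.
  by move=> /full zr; apply: fA => k; rewrite zr.
have ux z : on_torus r s (fun=> 0) z -> forall i, cabs (x i / z i) <= q.
  by move=> /full zr i; rewrite cabsM cabsV zr ler_pdivrMr.
have fx : f x = tmean r s (fun z => f z * \prod_i (1 - x i / z i)^-1) (fun=> 0).
  rewrite -(@tmean_cauchy _ _ f r A s x x)// ?enum_uniq//; last 2 first.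
  - by move=> k; apply: le_lt_trans (xq k) _; rewrite gtr_pMl//; lra.
  - by move=> k; apply: le_trans (xq k) _; rewrite ger_pMl//; lra.
  rewrite (@tmean_start _ _ _ _ _ _ (fun=> 0)); last by move=> k; rewrite mem_enum.
  by apply: eq_tmean => // z _; rewrite big_enum.
have tx : mtaylor f r N x = tmean r s (fun z => f z *
    \sum_(al : {ffun 'I_d -> 'I_N} | (mdeg al < N)%N) mpow (fun i => x i / z i) al) (fun=> 0).
  have hb (al : {ffun 'I_d -> 'I_N}) z : on_torus r s (fun=> 0) z ->
     cabs (f z * (mpow z al)^-1) <= A / r ^+ mdeg al.
    move=> zt; rewrite cabsM cabsV (cabs_mpow_eq _ (full _ zt)) ler_wpM2r ?fz//.
    by rewrite invr_ge0 exprn_ge0.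
  rewrite /mtaylor; under eq_bigr do rewrite mulrC -(tmeanZ _ r0' (hb _)).
  rewrite -(@tmean_sum _ _ _ _ _ _ _ _ _ (fun al => cabs (mpow x al) * (A / r ^+ mdeg al)))//.
    apply: eq_tmean => // z _; rewrite mulr_sumr; apply: eq_bigr => al _.
    rewrite mulrCA; congr (_ * _); rewrite /mpow -prodfV -big_split.
    by apply: eq_bigr => i _; rewrite expr_div_n.
  by move=> al z zt; rewrite cabsM ler_wpM2l ?cabs_ge0// hb.
rewrite fx tx addrC -mulN1r.
have bd1 z : on_torus r s (fun=> 0) z ->
    cabs (f z * \prod_i (1 - x i / z i)^-1) <= A * \prod_(i < d) 2.
  move=> zt; rewrite cabsM; apply: ler_pM; rewrite ?cabs_ge0 ?fz//.
  rewrite cabs_prod; apply: ler_prod => i _; rewrite cabs_ge0 /=.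
  apply: (le_trans (cabs_geo_inv (ux _ zt i) _)); first by lra.
  by rewrite -[leRHS]invrK lef_pV2 ?posrE ?invr_gt0//; lra.
have bd2 z : on_torus r s (fun=> 0) z ->
    cabs (f z * \sum_(al : {ffun 'I_d -> 'I_N} | (mdeg al < N)%N) mpow (fun i => x i / z i) al)
      <= A * \sum_(al : {ffun 'I_d -> 'I_N} | (mdeg al < N)%N) q ^+ mdeg al.
  move=> zt; rewrite cabsM; apply: ler_pM; rewrite ?cabs_ge0 ?fz//.
  apply: (le_trans (cabs_sum _ _ _)); apply: ler_sum => al _.
  by apply: cabs_mpow_le; exact: ux.
rewrite -(tmean_linear _ r0' bd2 bd1).
apply: tmean_le => // z zt.
rewrite mulN1r addrC -mulrBr cabsM -mulrA.
apply: ler_pM; rewrite ?cabs_ge0 ?fz//.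
by apply: hB => //; exact: ux.
Qed.

(* The homogeneous parts of the torus expansion at 0 are the Taylor coefficients of
   the slice [l |-> f (l w)], which converges on the whole disc where the slice lives. *)
Theorem mtaylor_bound N w (tau A' : R) : 1 < tau -> (forall k, cabs (w k) <= 1) ->
  (forall l, cabs l <= tau -> cdiff (fun l => f (fun k => l * w k)) l) ->
  (forall l, cabs l = tau -> cabs (f (fun k => l * w k)) <= A') ->
  cabs (f w - mtaylor f r N w) <= A' * tau^-1 ^+ N / (1 - tau^-1).
Proof.
move=> tau1 w1 gd gA; pose g l := f (fun k => l * w k).
have tau0 : 0 < tau by lra.
pose b (k : nat) := \sum_(al : {ffun 'I_d -> 'I_N} | mdeg al == k) mcoef f r al * mpow w al.
have tE (l : C) : mtaylor f r N (fun k => l * w k) = \sum_(k < N) b k * l ^+ k.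
  rewrite /b; under eq_bigr do rewrite mulr_suml.
  rewrite (exchange_big_dep predT)//= /mtaylor big_mkcond; apply: eq_bigr => al _.
  have [degN|Ndeg] := ltnP (mdeg al) N; last first.
    by rewrite big1// => k /eqP kd; move: (ltn_ord k); rewrite -kd ltnNge Ndeg.
  rewrite (big_pred1 (Ordinal degN)); last by move=> k; rewrite /= -val_eqE /= eq_sym.
  rewrite -mulrA; congr (_ * _); rewrite /mpow /=.
  under eq_bigr do rewrite exprMn.
  by rewrite big_split /= prodrXr mulrC.
(* Along t * w both polynomials in t agree with g(t) up to O(t^N): one by the expansion on the
   circle of radius [tau], the other by [mtaylor_small]. *)
have ab : forall k, (k < N)%N -> coef g tau k - b k = 0.
  have [B hB] := mtaylor_small N.
  (* t <= tau/2 bounds 1/(1 - t/tau) by 2, and t <= r/2 gives the ratio q = t/r <= 1/2 that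
     [mtaylor_small] asks for. *)
  pose s := Num.min (tau / 2) (r / 2).
  apply: (@coef_unique _ _ N (2 * A' * tau^-1 ^+ N + B * r^-1 ^+ N) s).
    by rewrite lt_min !divr_gt0.
  move=> t /andP[t0]; rewrite le_min => /andP[tt tr].
  have ct : cabs t%:C%C = t :> R by rewrite cabs_real gtr0_norm.
  have h1 := @taylor_bound _ g tau A' t%:C%C N.
  have h2 := hB (fun k => t%:C%C * w k) (t / r).
  rewrite ct in h1.
  have {}h2 : cabs (g t%:C%C - \sum_(k < N) b k * t%:C%C ^+ k) <= B * (t / r) ^+ N.
    rewrite -tE; apply: h2; first by rewrite divr_ge0 ?(ltW t0) ?(ltW r0)//= ler_pdivrMr//; lra.
    move=> k; rewrite divfK ?gt_eqF// cabsM ct ler_piMr// ltW//.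
  have {}h1 : cabs (g t%:C%C - \sum_(k < N) coef g tau k * t%:C%C ^+ k) <=
     2 * A' * (t / tau) ^+ N.
    apply: (le_trans (h1 _ _ _)) => //; first by lra.
    rewrite (mulrC 2) -!mulrA ler_wpM2l//.
      by apply: le_trans (cabs_ge0 _) (gA tau%:C%C _); rewrite cabs_real gtr0_norm.
    rewrite mulrC ler_wpM2r// ?exprn_ge0 ?divr_ge0 ?(ltW t0) ?(ltW tau0)//.
    have : t / tau <= 1 / 2 by rewrite ler_pdivrMr//; lra.
    by move=> h; rewrite -[leRHS]invrK lef_pV2 ?posrE ?invr_gt0//; lra.
  have -> : \sum_(k < N) (coef g tau k - b k) * t%:C%C ^+ k =
     (g t%:C%C - \sum_(k < N) b k * t%:C%C ^+ k)
     - (g t%:C%C - \sum_(k < N) coef g tau k * t%:C%C ^+ k).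
    under eq_bigr do rewrite mulrBl.
    by rewrite sumrB; ring.
  apply: (le_trans (cabsB _ _)); rewrite mulrDl -!mulrA -!exprMn.
  rewrite (mulrC tau^-1) (mulrC r^-1) addrC; apply: lerD => //.
  by rewrite mulrA.
have -> : mtaylor f r N w = \sum_(k < N) coef g tau k * 1 ^+ k.
  have -> : w = (fun k => 1 * w k) by apply/funext => k; rewrite mul1r.
  rewrite tE; apply: eq_bigr => k _; congr (_ * _).
  by apply/esym/subr0_eq/ab.
have -> : f w = g 1 by congr f; apply/funext => k; rewrite mul1r.
have := @taylor_bound _ g tau A' 1 N; rewrite cabs1 div1r; exact.
Qed.

End fixed_function.
End MultiTaylor.

(** * Geometry of the domain and Taylor approximation on it *)

Section BidiscGeometry.
Context {R : realType} {l1 l2 : nat}.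
Notation C := R[i].
Notation d := (l1 + l2)%N.
Implicit Types (z w h : pt R l1 l2) (f : Fn R l1 l2).

Lemma unorm2_ge0 z : 0 <= unorm2 z.
Proof. by apply: sumr_ge0 => i _; exact: abs2_ge0. Qed.

Lemma vnorm2_ge0 z : 0 <= vnorm2 z.
Proof. by apply: sumr_ge0 => i _; exact: abs2_ge0. Qed.

Lemma tnorm_ge0 z : 0 <= tnorm z.
Proof. by rewrite le_max sqrtr_ge0. Qed.

Lemma sqrt_le_sqr (x a : R) : 0 <= a -> (Num.sqrt x <= a) = (x <= a ^+ 2).
Proof.
by move=> a0; rewrite -{1}(ger0_norm a0) -sqrtr_sqr ler_sqrt// sqr_ge0.
Qed.

Lemma tnorm_leP z (a : R) : 0 <= a ->
  (tnorm z <= a) = (unorm2 z <= a ^+ 2) && (vnorm2 z <= a ^+ 2).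
Proof. by move=> a0; rewrite ge_max !sqrt_le_sqr. Qed.

Lemma OmegaP z : Omega z <-> unorm2 z < 1 /\ vnorm2 z < 1.
Proof.
have s1 (x : R) : (Num.sqrt x < 1) = (x < 1).
  by rewrite -{1}(sqrtr1 R) ltr_sqrt.
by rewrite /Omega /= gt_max !s1; split => [/andP|[-> ->]].
Qed.

Lemma tnorm_le_Omega z (a : R) : tnorm z <= a -> a < 1 -> Omega z.
Proof. exact: le_lt_trans. Qed.

Lemma cabs_coord_le z k (a : R) : 0 <= a -> tnorm z <= a -> cabs (z k) <= a.
Proof.
move=> a0; rewrite tnorm_leP// => /andP[ua va].
rewrite sqrt_le_sqr//; have [kl|lk] := ltnP k l1.
  by apply: le_trans ua; rewrite /unorm2 (bigD1 k)//= lerDl sumr_ge0// => *; exact: abs2_ge0.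
by apply: le_trans va; rewrite /vnorm2 (bigD1 k)//= lerDl sumr_ge0// => *; exact: abs2_ge0.
Qed.

Lemma unorm2_scale (l : C) z : unorm2 (fun k => l * z k) = cabs l ^+ 2 * unorm2 z.
Proof. by rewrite /unorm2 mulr_sumr; apply: eq_bigr => k _; rewrite !abs2E cabsM exprMn. Qed.

Lemma vnorm2_scale (l : C) z : vnorm2 (fun k => l * z k) = cabs l ^+ 2 * vnorm2 z.
Proof. by rewrite /vnorm2 mulr_sumr; apply: eq_bigr => k _; rewrite !abs2E cabsM exprMn. Qed.

Lemma tnorm_scale (l : C) z : tnorm (fun k => l * z k) = cabs l * tnorm z.
Proof.
rewrite /tnorm unorm2_scale vnorm2_scale !(sqrtrM _ (sqr_ge0 (cabs l))) sqrtr_sqr.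
by rewrite ger0_norm ?cabs_ge0// maxr_pMr// cabs_ge0.
Qed.

Lemma cnorm_scale (l : C) z : cnorm (fun k => l * z k) = cabs l * cnorm z.
Proof.
rewrite /cnorm; under eq_bigr do rewrite abs2E cabsM exprMn -(abs2E (z _)).
by rewrite -mulr_sumr (sqrtrM _ (sqr_ge0 (cabs l))) sqrtr_sqr ger0_norm ?cabs_ge0.
Qed.

Lemma cnorm_ge0 z : 0 <= cnorm z.
Proof. exact: sqrtr_ge0. Qed.

Lemma cnorm_sqr z : cnorm z ^+ 2 = \sum_i abs2 (z i).
Proof. by rewrite sqr_sqrtr// sumr_ge0// => *; exact: abs2_ge0. Qed.

Lemma coord_le_cnorm z k : cabs (z k) <= cnorm z.
Proof.
rewrite sqrt_le_sqr ?cnorm_ge0// cnorm_sqr (bigD1 k)//= lerDl sumr_ge0// => *.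
exact: abs2_ge0.
Qed.

Lemma unorm2_le_cnorm z : unorm2 z <= cnorm z ^+ 2.
Proof.
rewrite cnorm_sqr /unorm2 [leRHS](bigID (fun i : 'I_d => (i < l1)%N)) /= lerDl.
by apply: sumr_ge0 => *; exact: abs2_ge0.
Qed.

Lemma vnorm2_le_cnorm z : vnorm2 z <= cnorm z ^+ 2.
Proof.
rewrite cnorm_sqr /vnorm2 [leRHS](bigID (fun i : 'I_d => (l1 <= i)%N)) /= lerDl.
by apply: sumr_ge0 => *; exact: abs2_ge0.
Qed.

Lemma cnorm_le_sum z : cnorm z <= \sum_i cabs (z i).
Proof.
have s0 (s : seq 'I_d) : 0 <= \sum_(i <- s) cabs (z i).
  by apply: sumr_ge0 => *; exact: cabs_ge0.
rewrite sqrt_le_sqr//; elim: (index_enum _) => [|i s IH].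
  by rewrite !big_nil expr0n.
rewrite !big_cons abs2E sqrrD.
have := mulr_ge0 (cabs_ge0 (z i)) (s0 s); rewrite -mulr_natl; lra.
Qed.

(** Weighted form of 2|a||b| <= t|a|^2 + |b|^2/t. Summed over coordinates, it replaces the triangle
    inequality for the block norms. *)
Lemma abs2D_le (a b : C) (t : R) : 0 < t ->
  abs2 (a + b) <= (1 + t) * abs2 a + (1 + t^-1) * abs2 b.
Proof.
move=> t0; rewrite !abs2E.
apply: (@le_trans _ _ ((cabs a + cabs b) ^+ 2)).
  by rewrite lerXn2r ?nnegrE ?addr_ge0 ?cabs_ge0// cabsD.
rewrite -subr_ge0.
have -> : (1 + t) * cabs a ^+ 2 + (1 + t^-1) * cabs b ^+ 2 - (cabs a + cabs b) ^+ 2 =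
  t^-1 * (t * cabs a - cabs b) ^+ 2 by field; rewrite gt_eqF.
by rewrite mulr_ge0 ?sqr_ge0// invr_ge0 ltW.
Qed.

Lemma unorm2D_le z h (t : R) : 0 < t ->
  unorm2 (addp z h) <= (1 + t) * unorm2 z + (1 + t^-1) * unorm2 h.
Proof.
by move=> t0; rewrite /unorm2 !mulr_sumr -big_split; apply: ler_sum => i _; exact: abs2D_le.
Qed.

Lemma vnorm2D_le z h (t : R) : 0 < t ->
  vnorm2 (addp z h) <= (1 + t) * vnorm2 z + (1 + t^-1) * vnorm2 h.
Proof.
by move=> t0; rewrite /vnorm2 !mulr_sumr -big_split; apply: ler_sum => i _; exact: abs2D_le.
Qed.

(* The radius depends on z only through a bound on its norm, so that limits of points
   of a smaller bidisc stay in Omega. *)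
Lemma Omega_open (a : R) : 0 <= a -> a < 1 -> exists2 del : R, 0 < del &
  forall z h, tnorm z <= a -> cnorm h < del -> Omega (addp z h).
Proof.
move=> a0 a1; have a21 : a ^+ 2 < 1 by rewrite expr_lt1.
(* With a^2 = 1 - 2t, the bound (1 + t)a^2 + t^2 equals 1 - t - t^2 < 1. *)
pose t := (1 - a ^+ 2) / 2; have t0 : 0 < t by rewrite divr_gt0// subr_gt0.
pose K := 1 + t^-1; have K0 : 0 < K by rewrite addr_gt0// invr_gt0.
pose e := Num.min 1 (t ^+ 2 / K); have e0 : 0 < e by rewrite lt_min ltr01 divr_gt0// exprn_gt0.
exists e => // z h za hd; move: za; rewrite tnorm_leP// => /andP[ua va].
have h2 : K * cnorm h ^+ 2 <= t ^+ 2.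
  rewrite mulrC -ler_pdivlMr//; have e1 : e <= 1 by rewrite ge_min lexx.
  apply: (@le_trans _ _ e); last by rewrite ge_min lexx orbT.
  have := cnorm_ge0 h; nra.
have E : (1 + t) * a ^+ 2 + t ^+ 2 < 1.
  have : a ^+ 2 = 1 - 2 * t by rewrite /t; field.
  move=> ->; nra.
have hu : (1 + t) * unorm2 z <= (1 + t) * a ^+ 2 by rewrite ler_wpM2l//; lra.
have hv : (1 + t) * vnorm2 z <= (1 + t) * a ^+ 2 by rewrite ler_wpM2l//; lra.
have ku : K * unorm2 h <= K * cnorm h ^+ 2 by rewrite ler_wpM2l ?unorm2_le_cnorm// ltW.
have kv : K * vnorm2 h <= K * cnorm h ^+ 2 by rewrite ler_wpM2l ?vnorm2_le_cnorm// ltW.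
apply/OmegaP; split.
  by apply: le_lt_trans (unorm2D_le z h t0) _; rewrite -/K; lra.
by apply: le_lt_trans (vnorm2D_le z h t0) _; rewrite -/K; lra.
Qed.

Lemma holo_line f (a v : pt R l1 l2) (c : C) : holo f ->
  Omega (fun k => a k + c * v k) -> cdiff (fun c => f (fun k => a k + c * v k)) c.
Proof.
move=> hf; set z := (fun k => a k + c * v k) => zO.
have [L hL] := hf z zO; exists (\sum_j L j * v j) => eps eps0.
have v1 : 0 < cnorm v + 1 by have := cnorm_ge0 v; lra.
have e0 : 0 < eps / (cnorm v + 1) by rewrite divr_gt0.
have [d1 d10 h1] := hL _ e0.
have [d2 d20 h2] := Omega_open (tnorm_ge0 z) zO.
exists (Num.min d1 d2 / (cnorm v + 1)); first by rewrite divr_gt0// lt_min d10.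
move=> y; rewrite ltr_pdivlMr// => yd.
pose h : pt R l1 l2 := fun k => (y - c) * v k.
have hn : cnorm h = cabs (y - c) * cnorm v by rewrite cnorm_scale.
have hd : cnorm h < Num.min d1 d2.
  by apply: le_lt_trans yd; rewrite hn ler_wpM2l ?cabs_ge0// lerDl.
move: hd; rewrite lt_min => /andP[hd1 hd2].
have := h1 h (h2 z h (lexx _) hd2) hd1.
have -> : addp z h = (fun k => a k + y * v k).
  by apply/funext => k; rewrite /addp /z /h; ring.
have -> : \sum_j L j * h j = (\sum_j L j * v j) * (y - c).
  by rewrite mulr_suml; apply: eq_bigr => j _; rewrite /h; ring.
move=> /le_trans; apply; rewrite hn mulrCA [leRHS]mulrC ler_wpM2l ?cabs_ge0//.
rewrite mulrAC ler_pdivrMr//.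
by rewrite ler_wpM2l ?(ltW eps0)// lerDl.
Qed.

Lemma holo_continuous f z : holo f -> Omega z -> forall eps : R, 0 < eps ->
  exists2 del : R, 0 < del &
    forall h, cnorm h < del -> cabs (f (addp z h) - f z) <= eps.
Proof.
move=> hf zO eps eps0; have [L hL] := hf z zO.
have [d1 d10 h1] := hL _ ltr01.
have [d2 d20 h2] := Omega_open (tnorm_ge0 z) zO.
pose S : R := \sum_j cabs (L j) + 1.
have S0 : 0 < S.
  have : 0 <= \sum_j cabs (L j) :> R by apply: sumr_ge0 => *; exact: cabs_ge0.
  by rewrite /S; lra.
exists (Num.min (Num.min d1 d2) (eps / S)); first by rewrite !lt_min d10 d20 divr_gt0.
move=> h; rewrite !lt_min => /andP[/andP[hd1 hd2]]; rewrite ltr_pdivlMr// => hd3.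
have := h1 h (h2 z h (lexx _) hd2) hd1; rewrite mul1r => h3.
have h4 : cabs (\sum_j L j * h j) <= (\sum_j cabs (L j)) * cnorm h.
  apply: (le_trans (cabs_sum _ _ _)); rewrite mulr_suml; apply: ler_sum => j _.
  by rewrite cabsM ler_wpM2l ?cabs_ge0// coord_le_cnorm.
have := cabs_le_dist (f (addp z h) - f z) (\sum_j L j * h j).
by move: hd3; rewrite /S; lra.
Qed.

(** Compactness by ultrafilter: points [zs n] with |f| > n would converge coordinatewise along
    [umod] to a point of [Omega], and continuity there bounds |f| along the sequence. *)
Lemma holo_bounded f (a : R) : holo f -> 0 <= a -> a < 1 ->
  exists2 A : R, 0 <= A & forall z, tnorm z <= a -> cabs (f z) <= A.
Proof.
move=> hf a0 a1; apply: contrapT => nA.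
have /choice[zs hz] (n : nat) : exists z, tnorm z <= a /\ n%:R < cabs (f z).
  apply: contrapT => nz; apply: nA; exists n%:R => // z za.
  by rewrite leNgt; apply/negP => fz; apply: nz; exists z.
have /choice[l hl] (k : 'I_d) : exists l, uconv (fun n => zs n k) l.
  by apply: (@uconv_ex _ _ a) => n; apply: cabs_coord_le => //; have [] := hz n.
have near (del : R) : 0 < del ->
    umod (fun n => cnorm (fun k => l k - zs n k) < del).
  move=> del0; pose e := del / (d%:R + 1).
  have d1 : 0 < (d%:R + 1 : R) by rewrite ltr_wpDl.
  have e0 : 0 < e by rewrite divr_gt0.
  have hU : umod (fun n => forall k, cabs (zs n k - l k) <= e).
    by apply: filter_forall => k; exact: hl.
  apply: filterS hU => n hn; apply: le_lt_trans (cnorm_le_sum _) _.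
  apply: (@le_lt_trans _ _ (\sum_(k < d) e)).
    by apply: ler_sum => k _; rewrite cabs_distC.
  rewrite sumr_const card_ord -mulr_natl /e mulrCA gtr_pMr//.
  by rewrite ltr_pdivrMr// mul1r ltrDl.
have [d1 d10 h1] := Omega_open a0 a1.
have lO : Omega l.
  have [n hn] := filter_ex (near _ d10); have [za _] := hz n.
  have -> : l = addp (zs n) (fun k => l k - zs n k).
    by apply/funext => k; rewrite /addp subrKC.
  exact: h1.
have [d2 d20 h2] := holo_continuous hf lO ltr01.
have [N hN] : exists N : nat, cabs (f l) + 1 <= N%:R.
  exists (Num.truncn (cabs (f l) + 1)).+1.
  by apply/ltW/truncnS_gt.
have evN : umod (fun n => (N <= n)%N) by apply: umod_eventually; exists N.
have [n [/= n1 n2]] := filter_ex (filterI (near _ d20) evN).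
have [_ n3] := hz n.
have n4 : (N%:R : R) <= n%:R by rewrite ler_nat.
have := h2 (fun k => zs n k - l k).
have -> : cnorm (fun k => zs n k - l k) = cnorm (fun k => l k - zs n k).
  by congr Num.sqrt; apply: eq_bigr => k _; rewrite !abs2E cabs_distC.
have -> : addp l (fun k => zs n k - l k) = zs n.
  by apply/funext => k; rewrite /addp subrKC.
move=> /(_ n1) h3; have := cabs_le_dist (f (zs n)) (f l).
lra.
Qed.

(** Coordinates of modulus at most [rad0] add up to less than 1/2, so this polydisc lies well inside
    [Omega]. One radius for all functions is what makes [mcoef] linear in the function. *)
Definition rad0 : R := (2 * (d%:R + 1))^-1.

Lemma rad0_gt0 : 0 < rad0.
Proof. by rewrite invr_gt0 mulr_gt0// ltr_wpDl. Qed.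

Lemma polydisc_tnorm z : (forall k, cabs (z k) <= rad0) -> tnorm z <= 1 / 2.
Proof.
move=> zr; have r0 := ltW rad0_gt0.
have cz : cnorm z <= 1 / 2.
  apply: le_trans (cnorm_le_sum z) _; apply: (@le_trans _ _ (\sum_(k < d) rad0)).
    by apply: ler_sum.
  rewrite sumr_const card_ord -[_ *+ _]mulr_natl /rad0 ler_pdivrMr ?mulr_gt0 ?ltr_wpDl//.
  by lra.
have c2 : cnorm z ^+ 2 <= (1 / 2) ^+ 2 by rewrite lerXn2r ?nnegrE ?cnorm_ge0//; lra.
rewrite tnorm_leP; last by lra.
by rewrite (le_trans (unorm2_le_cnorm z)) ?(le_trans (vnorm2_le_cnorm z)).
Qed.

Lemma polydisc_Omega z : (forall k, cabs (z k) <= rad0) -> Omega z.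
Proof. by move=> /polydisc_tnorm zr; apply: tnorm_le_Omega zr _; lra. Qed.

Lemma polydisc_cdiff f z i : holo f -> (forall k, cabs (z k) <= rad0) ->
  cdiff (fun c => f (upd z i c)) (z i).
Proof.
move=> hf zr.
pose v : pt R l1 l2 := fun k => if k == i then 1 else 0.
have E c : upd z i c = (fun k => upd z i 0 k + c * v k).
  apply/funext => k; rewrite /upd /v; case: eqP => _; first by rewrite mulr1 add0r.
  by rewrite mulr0 addr0.
under eq_fun do rewrite E.
by apply: holo_line => //; rewrite -E upd_id; exact: polydisc_Omega.
Qed.

Lemma polydisc_bounded f : holo f -> exists A : R,
  forall z, (forall k, cabs (z k) <= rad0) -> cabs (f z) <= A.
Proof.
move=> hf; have [||A _ hA] := @holo_bounded f (1 / 2) hf; [by lra|by lra|].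
by exists A => z /polydisc_tnorm; exact: hA.
Qed.

Theorem taylor_Omega f (rho tau A : R) N w : holo f ->
  0 <= rho -> 1 < tau -> rho * tau < 1 ->
  (forall z, tnorm z <= rho * tau -> cabs (f z) <= A) -> tnorm w <= rho ->
  cabs (f w - mtaylor f rad0 N w) <= A * tau^-1 ^+ N / (1 - tau^-1).
Proof.
move=> hf rho0 tau1 rt hA wr.
(* [B] ensures that the means defining the coefficients are taken of bounded functions; the final
   estimate involves [A] alone. *)
have [B hB] := polydisc_bounded hf.
have slice_le l : cabs l <= tau -> tnorm (fun k => l * w k) <= rho * tau.
  by move=> lt; rewrite tnorm_scale mulrC ler_pM ?tnorm_ge0 ?cabs_ge0.
apply: (@mtaylor_bound _ _ f rad0 B rad0_gt0 hB) => //.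
- by move=> z i; exact: polydisc_cdiff.
- move=> k; apply: le_trans (cabs_coord_le k rho0 wr) _; nra.
- move=> l lt.
  have E c : (fun k => c * w k) = (fun k => 0 + c * w k) :> pt R l1 l2.
    by apply/funext => k; rewrite add0r.
  have -> : (fun c => f (fun k => c * w k)) = (fun c => f (fun k => 0 + c * w k)).
    by apply/funext => c; rewrite E.
  apply: (@holo_line f (fun=> 0)) => //; rewrite -E.
  exact: tnorm_le_Omega (slice_le _ lt) rt.
- by move=> l lt; apply/hA/slice_le; rewrite lt.
Qed.

Lemma mcoef_linear f g N (al : {ffun 'I_d -> 'I_N}) a : holo f -> holo g ->
  mcoef (fun z => a * f z + g z) rad0 al = a * mcoef f rad0 al + mcoef g rad0 al.
Proof.
move=> hf hg; have [A hA] := polydisc_bounded hf; have [B hB] := polydisc_bounded hg.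
have r0 := ltW rad0_gt0.
have bd (h : Fn R l1 l2) (D : R) : (forall z, (forall k, cabs (z k) <= rad0) -> cabs (h z) <= D) ->
   forall z, on_torus rad0 (enum 'I_d) (fun=> 0) z ->
     cabs (h z * (mpow z al)^-1) <= D / rad0 ^+ mdeg al.
  move=> hD z zt; have zr k : cabs (z k) = rad0 by have := zt k; rewrite mem_enum.
  rewrite cabsM cabsV (cabs_mpow_eq _ zr) ler_wpM2r ?invr_ge0 ?exprn_ge0// hD//.
  by move=> k; rewrite zr.
rewrite /mcoef -(tmean_linear _ r0 (bd _ _ hA) (bd _ _ hB)).
by apply: eq_tmean => // z _; rewrite mulrDl mulrA.
Qed.

End BidiscGeometry.

(** * Iterated Lebesgue integrals *)

Section OneDimIntegral.
Context {R : realType}.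
Local Open Scope ereal_scope.
Local Notation mu := (@lebesgue_measure R).

(** The integral of a nonnegative function is a supremum over simple functions below it, so it is
    monotone for arbitrary integrands. [iint] can thus be compared without measurability. *)
Lemma le_integral_nomeas (f g : R -> \bar R) : (forall x, 0 <= f x) ->
  (forall x, f x <= g x) -> \int[mu]_x f x <= \int[mu]_x g x.
Proof.
move=> f0 fg; have g0 x : 0 <= g x by apply: le_trans (fg x).
rewrite !ge0_integralTE//; apply: le_ereal_sup => _ [h /= hf <-].
by exists h => // x; apply: le_trans (fg x).
Qed.

Lemma integral_box_ge (f : R -> \bar R) (b e k : R) : (0 <= e)%R -> (0 <= k)%R ->
  (forall x, 0 <= f x) -> (forall x, (b <= x <= b + e)%R -> k%:E <= f x) ->
  (k * e)%:E <= \int[mu]_x f x.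
Proof.
move=> e0 k0 f0 fk.
have -> : (k * e)%:E = \int[mu]_x (k%:E * (\1_(`[b, b + e]%classic : set R) x)%:E).
  rewrite ge0_integralZl_EFin//; last 1 first.
  - exact/measurable_EFinP.
  rewrite integral_indic// setIT /= lebesgue_measure_itv /= lte_fin ltrDl.
  case: ltP => [_|]; first by rewrite EFinM -EFinD addrAC subrr add0r.
  by move=> e0'; have -> : e = 0%R by [apply/le_anti/andP]; rewrite mulr0 mule0.
apply: le_integral_nomeas => x; first by rewrite mule_ge0// lee_fin.
rewrite indicE; case: (boolP (x \in _)); rewrite ?inE ?mule1 ?mule0//=.
by rewrite in_itv /= => ?; exact: fk.
Qed.

(** The push-forward of Lebesgue measure by a translation has the right value on half-open
    intervals, hence is Lebesgue measure. *)
Lemma integral_translate (f : R -> \bar R) (a : R) : measurable_fun setT f ->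
  (forall x, 0 <= f x) -> \int[mu]_x f (x + a)%R = \int[mu]_x f x.
Proof.
move=> mf f0; pose tr : R -> measurableTypeR R := (fun x => x + a)%R.
have mtr : measurable_fun setT tr by apply: measurable_funD.
have E := @ge0_integral_pushforward _ _ (measurableTypeR R) (measurableTypeR R) R tr mtr
  [the measure _ _ of mu] setT f measurableT mf (fun y _ => f0 y).
rewrite preimage_setT in E; rewrite -[LHS]E.
apply: eq_measure_integral => A mA _; apply/esym/lebesgue_measure_unique => //.
move=> _ [[b c]] _ <- /=; rewrite /pushforward.
rewrite (_ : (tr @^-1` _)%classic = `](b - a)%R, (c - a)%R]%classic); last first.
  by apply/seteqP; split=> x /=; rewrite !in_itv /= /tr ltrBlDr lerBrDr.
rewrite !lebesgue_measure_itv /= !lte_fin ltrD2r; case: ifP => // _.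
by rewrite -!EFinD; congr EFin; ring.
Qed.

End OneDimIntegral.

Section PlaneRotation.
Context {R : realType}.
Local Open Scope ereal_scope.
Local Notation mu := (@lebesgue_measure R).
Implicit Types (F : R -> R -> \bar R).

Definition planar F := measurable_fun setT (fun p : R * R => F p.1 p.2) /\
  forall x y, 0 <= F x y.

Definition plint F : \bar R := \int[mu]_x \int[mu]_y F x y.

Lemma planar_comp F (f g : R * R -> R) : planar F -> measurable_fun setT f ->
  measurable_fun setT g -> planar (fun x y => F (f (x, y)) (g (x, y))).
Proof.
move=> [mF F0] mf mg; split => //.
have : measurable_fun setT (fun p : R * R => (f p, g p)) by exact: measurable_fun_pair.
move=> /(measurableT_comp mF); apply: eq_measurable_fun => -[x y] _ //.
Qed.

Lemma planar_row F x : planar F -> measurable_fun setT (F x).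
Proof.
move=> [mF _]; have : measurable_fun setT (fun y : R => (x, y)) by exact: measurable_fun_pair.
by move=> /(measurableT_comp mF).
Qed.

Lemma planar_col F y : planar F -> measurable_fun setT (F ^~ y).
Proof.
move=> [mF _]; have : measurable_fun setT (fun x : R => (x, y)) by exact: measurable_fun_pair.
by move=> /(measurableT_comp mF).
Qed.

Lemma plint_swap F : planar F -> plint F = \int[mu]_y \int[mu]_x F x y.
Proof.
move=> [mF F0].
have := @fubini_tonelli _ _ _ _ R lebesgue_measure lebesgue_measure _ mF.
by apply.
Qed.

Lemma plint_shear_y F (b : R) : planar F -> plint (fun x y => F x (y + b * x)%R) = plint F.
Proof.
move=> pF; apply: eq_integral => x _; apply: integral_translate; last by case: pF.
exact: planar_row.
Qed.

Lemma plint_shear_x F (a : R) : planar F -> plint (fun x y => F (x + a * y)%R y) = plint F.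
Proof.
move=> pF; have pG : planar (fun x y => F (x + a * y)%R y).
  apply: (planar_comp (f := (fun p => p.1 + a * p.2)%R) (g := snd)) => //.
  by apply: measurable_funD => //; apply: measurable_funM.
rewrite (plint_swap pG) (plint_swap pF); apply: eq_integral => y _.
apply: (integral_translate (f := F ^~ y)); last by case: pF.
exact: planar_col.
Qed.

(* A rotation with s != 0 is a product of three shears, and shears preserve the
   iterated integral by translation invariance in one variable. *)
Lemma plint_rotation_sin F (c s : R) : planar F -> (c ^+ 2 + s ^+ 2 = 1)%R ->
  s != 0%R -> plint (fun x y => F (c * x - s * y)%R (c * y + s * x)%R) = plint F.
Proof.
(* For the angle theta, [a] is -tan(theta/2), the slope of the two outer shears; the middle one has
   slope sin theta. *)
move=> pF cs s0; pose a := ((c - 1) / s)%R.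
have m1 : measurable_fun setT (fun p : R * R => p.1 + a * p.2)%R.
  by apply: measurable_funD => //; apply: measurable_funM.
have m2 : measurable_fun setT (fun p : R * R => p.2 + s * p.1)%R.
  by apply: measurable_funD => //; apply: measurable_funM.
pose F1 x y := F (x + a * y)%R y.
have p1 : planar F1 by exact: (@planar_comp _ (fun p => p.1 + a * p.2)%R snd).
pose F2 x y := F1 x (y + s * x)%R.
have p2 : planar F2 by exact: (@planar_comp _ fst (fun p => p.2 + s * p.1)%R).
rewrite -(plint_shear_x a pF) -/F1 -(plint_shear_y s p1) -/F2 -(plint_shear_x a p2).
congr plint; apply/funext => x; apply/funext => y; rewrite /F2 /F1.
have E : (s ^+ 2 = 1 - c ^+ 2)%R by rewrite -cs; ring.
congr F; last by rewrite /a; field.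
apply: (mulfI s0); rewrite /a.
transitivity (s * c * x - s ^+ 2 * y)%R; first by ring.
rewrite E; field.
exact: s0.
Qed.

Lemma plint_rotation F (c s : R) : planar F -> (c ^+ 2 + s ^+ 2 = 1)%R ->
  plint (fun x y => F (c * x - s * y)%R (c * y + s * x)%R) = plint F.
Proof.
move=> pF cs; have [s0|s0] := eqVneq s 0%R; last exact: plint_rotation_sin.
move: cs; rewrite s0 expr0n addr0 => /eqP; rewrite sqrf_eq1 => /orP[]/eqP ->.
  congr plint; apply/funext => x; apply/funext => y.
  by rewrite !mul1r !mul0r subr0 addr0.
(* The half turn has s = 0, out of reach of the shears; it is obtained as two quarter turns. *)
have p1 : planar (fun x y => F (0 * x - 1 * y)%R (0 * y + 1 * x)%R).
  apply: (planar_comp (f := (fun p => 0 * p.1 - 1 * p.2)%R)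
    (g := (fun p => 0 * p.2 + 1 * p.1)%R)) => //.
    by apply: measurable_funB; apply: measurable_funM.
  by apply: measurable_funD; apply: measurable_funM.
have cs1 : (0 ^+ 2 + 1 ^+ 2 = 1 :> R)%R by rewrite expr0n expr1n add0r.
have n1 : 1%R != 0%R :> R by exact: oner_neq0.
rewrite -(plint_rotation_sin pF cs1 n1) -(plint_rotation_sin p1 cs1 n1).
by congr plint; apply/funext => x; apply/funext => y; congr F; ring.
Qed.

End PlaneRotation.

Section IteratedIntegral.
Context {R : realType}.
Local Open Scope ereal_scope.
Local Notation mu := (@lebesgue_measure R).
Notation C := R[i].
Implicit Types (F G : (nat -> C) -> \bar R).

(* No sigma-algebra is put on sequences of complex numbers: joint measurability of G is
   tested on all measurable parametrisations of its arguments. *)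
Definition jmeas (dT : measure_display) (T : measurableType dT)
    (G : T -> (nat -> C) -> \bar R) :=
  forall (dS : measure_display) (S : measurableType dS) (p : S -> T) (a b : nat -> S -> R),
    measurable_fun setT p -> (forall k, measurable_fun setT (a k)) ->
    (forall k, measurable_fun setT (b k)) ->
    measurable_fun setT (fun t => G (p t) (fun k => Complex (a k t) (b k t))).

Definition mfun F := @jmeas _ unit (fun=> F).

Definition setc n (x y : R) (s : nat -> C) : nat -> C :=
  fun k => if k == n then Complex x y else s k.

Lemma jmeas_setc dT (T : measurableType dT) (G : T -> (nat -> C) -> \bar R) n : jmeas G ->
  jmeas (fun (q : T * R * R) s => G q.1.1 (setc n q.1.2 q.2 s)).
Proof.
move=> mG dS S p a b mp ma mb.
have := @mG _ S (fun t => (p t).1.1)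
  (fun k => if k == n then (fun t => (p t).1.2) else a k)
  (fun k => if k == n then (fun t => (p t).2) else b k).
have m1 : measurable_fun setT (fun t => (p t).1).
  exact: measurableT_comp measurable_fst mp.
move=> h; have {}h : measurable_fun setT _ := h _ _ _.
have : measurable_fun setT (fun t => G (p t).1.1 (fun k => Complex
    ((if k == n then fun t => (p t).1.2 else a k) t)
    ((if k == n then fun t => (p t).2 else b k) t))).
  apply: h.
  - exact: measurableT_comp measurable_fst m1.
  - move=> k; case: ifP => _ //; exact: measurableT_comp measurable_snd m1.
  - move=> k; case: ifP => _ //; exact: measurableT_comp measurable_snd mp.
apply: eq_measurable_fun => t _ /=; congr (G _ _); apply/funext => k.
by rewrite /setc; case: ifP.
Qed.

Lemma iint_ge0 n F : (forall s, 0 <= F s) -> 0 <= iint n F.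
Proof.
elim: n F => [|n IH] F F0 //=.
by apply: integral_ge0 => x _; apply: integral_ge0 => y _; exact: IH.
Qed.

Lemma iint_le n F G : (forall s, 0 <= F s) -> (forall s, F s <= G s) ->
  iint n F <= iint n G.
Proof.
elim: n F G => [|n IH] F G F0 FG //=.
apply: le_integral_nomeas => x.
  by apply: integral_ge0 => y _; exact: iint_ge0.
apply: le_integral_nomeas => y; first exact: iint_ge0.
exact: IH.
Qed.

Lemma measurable_int_snd dT (T : measurableType dT) (f : T * R -> \bar R) :
  measurable_fun setT f -> (forall q, 0 <= f q) ->
  measurable_fun setT (fun t => \int[mu]_y f (t, y)).
Proof.
by move=> mf f0; have := @measurable_fun_fubini_tonelli_F _ _ T _ R lebesgue_measure f mf f0.
Qed.

(** Induction on [n] moves the outermost complex coordinate into the parameter space, which is why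
    [T] is arbitrary; Tonelli then integrates it out. *)
Lemma iint_jmeas n dT (T : measurableType dT) (G : T -> (nat -> C) -> \bar R) :
  jmeas G -> (forall t s, 0 <= G t s) -> measurable_fun setT (fun t => iint n (G t)).
Proof.
elim: n dT T G => [|n IH] dT T G mG G0 /=.
  by apply: (mG _ T id (fun _ => cst 0%R) (fun _ => cst 0%R)).
have m3 := IH _ _ _ (jmeas_setc n mG) (fun q s => G0 _ _).
have m2 : measurable_fun setT (fun q : T * R =>
    \int[mu]_y iint n (fun s => G q.1 (setc n q.2 y s))).
  by apply: (measurable_int_snd m3) => q; exact: iint_ge0.
apply: (measurable_int_snd m2) => q.
by apply: integral_ge0 => y _; exact: iint_ge0.
Qed.

Lemma mfun_setc F n x y : mfun F -> mfun (fun s => F (setc n x y s)).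
Proof.
move=> mF dS S p a b mp ma mb.
have := jmeas_setc n mF (p := fun t => (tt, x, y)) _ ma mb; apply.
exact: measurable_cst.
Qed.

Lemma iint_planar F n : mfun F -> (forall s, 0 <= F s) ->
  planar (fun x y => iint n (fun s => F (setc n x y s))).
Proof.
move=> mF F0; split; last by move=> x y; exact: iint_ge0.
have mG := jmeas_setc n mF.
apply: (@iint_jmeas n _ _ (fun (p : R * R) s => F (setc n p.1 p.2 s))) => // dS S p a b mp ma mb.
have := mG _ S (fun t => (tt, (p t).1, (p t).2)) a b _ ma mb; apply.
apply: measurable_fun_pair; last exact: measurableT_comp measurable_snd mp.
apply: measurable_fun_pair => //; exact: measurableT_comp measurable_fst mp.
Qed.

Lemma iintSE n F : iint n.+1 F = plint (fun x y => iint n (fun s => F (setc n x y s))).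
Proof. by []. Qed.

Lemma planar_int_row (P : R -> R -> \bar R) : planar P ->
  measurable_fun setT (fun x => \int[mu]_y P x y).
Proof.
move=> [mP P0]; exact: (measurable_int_snd mP (fun q => P0 _ _)).
Qed.

Lemma iintD n F G : mfun F -> mfun G -> (forall s, 0 <= F s) -> (forall s, 0 <= G s) ->
  iint n (fun s => F s + G s) = iint n F + iint n G.
Proof.
elim: n F G => [//|n IH] F G mF mG F0 G0; rewrite !iintSE /plint.
have pF := iint_planar n mF F0; have pG := iint_planar n mG G0.
rewrite -ge0_integralD//; first 1 last.
- by move=> x _; apply: integral_ge0 => y _; exact: iint_ge0.
- exact: planar_int_row.
- by move=> x _; apply: integral_ge0 => y _; exact: iint_ge0.
- exact: planar_int_row.
apply: eq_integral => x _; rewrite -ge0_integralD//; first 1 last.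
- by move=> y _; exact: iint_ge0.
- exact: (planar_row x pF).
- by move=> y _; exact: iint_ge0.
- exact: (planar_row x pG).
by apply: eq_integral => y _; apply: IH => //; exact: mfun_setc.
Qed.

Lemma iintZ n F (c : R) : (0 <= c)%R -> mfun F -> (forall s, 0 <= F s) ->
  iint n (fun s => c%:E * F s) = c%:E * iint n F.
Proof.
move=> c0; elim: n F => [//|n IH] F mF F0; rewrite !iintSE /plint.
have pF := iint_planar n mF F0.
rewrite -ge0_integralZl_EFin//; first 1 last.
- by move=> x _; apply: integral_ge0 => y _; exact: iint_ge0.
- exact: planar_int_row.
apply: eq_integral => x _; rewrite -ge0_integralZl_EFin//; first 1 last.
- by move=> y _; exact: iint_ge0.
- exact: (planar_row x pF).
by apply: eq_integral => y _; apply: IH => //; exact: mfun_setc.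
Qed.

Lemma mfunD F G : mfun F -> mfun G -> mfun (fun s => F s + G s).
Proof.
move=> mF mG dS S p a b mp ma mb; apply: emeasurable_funD.
  exact: (mF _ S p a b).
exact: (mG _ S p a b).
Qed.

Lemma mfun0 : mfun (fun=> 0).
Proof. by move=> dS S p a b mp ma mb; exact: measurable_cst. Qed.

Lemma iint0 n : iint n (fun=> 0 : \bar R) = 0.
Proof.
elim: n => [//|n IH] /=; under eq_integral do under eq_integral do rewrite IH.
by under eq_integral do rewrite integral0; rewrite integral0.
Qed.

Lemma iint_sum n (I : Type) (t : seq I) (F : I -> (nat -> C) -> \bar R) :
  (forall j, mfun (F j)) -> (forall j s, 0 <= F j s) ->
  iint n (fun s => \sum_(j <- t) F j s) = \sum_(j <- t) iint n (F j).
Proof.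
move=> mF F0; suff : mfun (fun s => \sum_(j <- t) F j s) /\
  iint n (fun s => \sum_(j <- t) F j s) = \sum_(j <- t) iint n (F j) by case.
elim: t => [|j t [IHm IH]].
  rewrite big_nil; under eq_fun do rewrite big_nil.
  by split; [exact: mfun0|exact: iint0].
rewrite big_cons -IH; under eq_fun do rewrite big_cons.
split; first exact: mfunD.
by apply: iintD => // s; apply: sume_ge0.
Qed.

Definition rotc (u : nat -> C) (s : nat -> C) : nat -> C := fun k => (u k * s k)%R.

Lemma mfun_rotc F u : mfun F -> mfun (fun s => F (rotc u s)).
Proof.
move=> mF dS S p a b mp ma mb.
have := mF _ S p
  (fun k t => complex.Re (u k) * a k t - complex.Im (u k) * b k t)%R
  (fun k t => complex.Re (u k) * b k t + complex.Im (u k) * a k t)%R mp.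
move=> h; have {}h : measurable_fun setT _ := h _ _.
have : measurable_fun setT (fun t => F (fun k => Complex
   (complex.Re (u k) * a k t - complex.Im (u k) * b k t)%R
   (complex.Re (u k) * b k t + complex.Im (u k) * a k t)%R)).
  apply: h => k.
    by apply: measurable_funB; apply: measurable_funM.
  by apply: measurable_funD; apply: measurable_funM.
apply: eq_measurable_fun => t _; congr (F _); apply/funext => k.
by rewrite /rotc; case: (u k) => c s /=; simpc; congr Complex; ring.
Qed.

(** Multiplication by a unimodular number is a plane rotation of the outermost coordinate; the inner
    ones follow by induction. *)
Lemma iint_rotc n F (u : nat -> C) : mfun F -> (forall s, 0 <= F s) ->
  (forall k, cabs (u k) = 1%R) -> iint n (fun s => F (rotc u s)) = iint n F.
Proof.
move=> + + u1; elim: n F => [|n IH] F mF F0 /=.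
  by congr F; apply/funext => k; rewrite /rotc mulr0.
pose P x y := iint n (fun s => F (setc n x y s)).
have pP : planar P := iint_planar n mF F0.
have cs : (complex.Re (u n) ^+ 2 + complex.Im (u n) ^+ 2 = 1)%R.
  by have := abs2E (u n); rewrite u1 expr1n.
rewrite -[RHS]/(plint P) -(plint_rotation pP cs).
apply: eq_integral => x _; apply: eq_integral => y _.
rewrite /P -[RHS]IH//; last exact: mfun_setc.
congr (iint n _); apply/funext => s; congr (F _); apply/funext => k.
rewrite /rotc /setc; case: eqP => [->|//].
by case: (u n) => c d /=; simpc; congr Complex; ring.
Qed.

(** [iint n] evaluates its integrand only at sequences that vanish from index [n] on, whence the
    second branch. *)
Definition inbox n (b : nat -> R) (e : R) (s : nat -> C) :=
  forall k, if (k < n)%N then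
    [&& (b k <= complex.Re (s k) <= b k + e)%R & (0 <= complex.Im (s k) <= e)%R]
  else s k == 0%R.

Lemma iint_box_ge n F (b : nat -> R) (e kap : R) : (0 <= e)%R -> (0 <= kap)%R ->
  (forall s, 0 <= F s) -> (forall s, inbox n b e s -> kap%:E <= F s) ->
  (kap * (e ^+ 2) ^+ n)%:E <= iint n F.
Proof.
move=> e0 k0; elim: n F => [|n IH] F F0 FB.
  by rewrite expr0 mulr1; apply: FB => k /=.
rewrite exprSr expr2 !mulrA; apply: (@integral_box_ge _ _ (b n)) => //.
- by rewrite !mulr_ge0// exprn_ge0// mulr_ge0.
- by move=> x; apply: integral_ge0 => y _; exact: iint_ge0.
move=> x xb.
apply: (@integral_box_ge _ _ 0%R) => //.
- by rewrite !mulr_ge0// exprn_ge0// mulr_ge0.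
- by move=> y; exact: iint_ge0.
move=> y; rewrite add0r => yb; rewrite -expr2; apply: (IH (fun s => F (setc n x y s))) => // s sb.
apply: FB => k; rewrite /setc; have [->|kn] := eqVneq k n.
  by rewrite ltnSn /= xb yb.
by have := sb k; rewrite ltnS (leq_eqVlt k) (negbTE kn).
Qed.

End IteratedIntegral.

(** * Discrete Cauchy formula on grids of roots of unity *)

Section GridCauchy.
Context {R : realType} {d : nat}.
Notation C := R[i].
Implicit Types (w z : 'I_d -> C).

Lemma circle_rootX_neq1 m k : (0 < k < 2 ^ m)%N -> (circle_root m : C) ^+ k != 1.
Proof.
move=> /andP[k0 km]; rewrite -cisM; set x := k%:R * _.
have M0 : 0 < (2 ^ m)%:R :> R by rewrite ltr0n expn_gt0.
have hx : 0 < x / 2 < pi.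
  have -> : x / 2 = pi * (k%:R / (2 ^ m)%:R) by rewrite /x; field; rewrite pow2_neq0.
  apply/andP; split; first by rewrite mulr_gt0 ?pi_gt0 ?divr_gt0 ?ltr0n ?expn_gt0.
  rewrite gtr_pMr ?pi_gt0//.
  by rewrite ltr_pdivrMr// mul1r ltr_nat.
apply/eqP => /(congr1 (@complex.Re R)) /=.
have -> : x = x / 2 *+ 2 by rewrite -mulr_natr; field.
rewrite cos_mulr2n cos2sin2 -mulr_natr.
have := sin_gt0_pi hx; set s := sin _ => s0 h.
have : s ^+ 2 = 0 by lra.
by move/eqP; rewrite sqrf_eq0 gt_eqF.
Qed.

Lemma root_orthogonality m (a b : 'I_(2 ^ m)) :
  \sum_(j < 2 ^ m) (circle_root m : C) ^+ (j * a) * (circle_root m : C) ^- (j * b) =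
  if a == b then (2 ^ m)%:R else 0.
Proof.
set u := (circle_root m : C); have u0 : u != 0 by exact: circle_root_neq0.
have [->|ab] := eqVneq a b.
  under eq_bigr do rewrite divff ?expf_neq0//.
  by rewrite sumr_const card_ord.
pose v := u ^+ a * u ^- b.
under eq_bigr do rewrite mulnC exprM (mulnC _ b) exprM -exprVn -exprMn.
rewrite -/v.
have v1 : v != 1.
  have uX n : u ^+ n != 0 by rewrite expf_neq0.
  have key (x y : 'I_(2 ^ m)) : (x < y)%N -> u ^+ x != u ^+ y.
    move=> xy; rewrite -(subnKC (ltnW xy)) exprD -subr_eq0 -{1}[u ^+ x]mulr1 -mulrBr.
    rewrite mulf_neq0 ?uX// subr_eq0 eq_sym circle_rootX_neq1// subn_gt0 xy /=.
    by rewrite (leq_ltn_trans (leq_subr _ _)).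
  have : u ^+ a != u ^+ b.
    by have := ab; rewrite -val_eqE /= neq_ltn => /orP[/key|/key //]; rewrite // eq_sym.
  by apply: contra => /eqP h; rewrite -[u ^+ a](mulfVK (uX b)) -/v h mul1r.
have vM : v ^+ (2 ^ m) = 1.
  by rewrite /v exprMn exprVn -!exprM !(mulnC _ (2 ^ m)%N) !exprM circle_rootX !expr1n invr1 mulr1.
apply/eqP; have := subrX1 v (2 ^ m); rewrite vM subrr => /esym/eqP.
by rewrite mulf_eq0 subr_eq0 (negbTE v1).
Qed.

Definition gridrot m (j : {ffun 'I_d -> 'I_(2 ^ m)}) (i : 'I_d) : C :=
  circle_root m ^+ j i.

(** By orthogonality of characters, averaging against the geometric kernel truncated at [2 ^ m]
    terms reproduces each monomial with exponents below [2 ^ m] exactly. No limit is involved. *)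
Lemma grid_cauchy m N (c : {ffun 'I_d -> 'I_N} -> C) (P : pred {ffun 'I_d -> 'I_N}) w z :
  (N <= 2 ^ m)%N -> (forall i, z i != 0) ->
  (#|{ffun 'I_d -> 'I_(2 ^ m)}|)%:R * (\sum_(al | P al) c al * mpow w al) =
  \sum_(j : {ffun 'I_d -> 'I_(2 ^ m)})
    (\sum_(al | P al) c al * mpow (fun i => gridrot j i * z i) al) *
    \prod_i \sum_(b < 2 ^ m) (w i / (gridrot j i * z i)) ^+ b.
Proof.
move=> NM z0.
under [RHS]eq_bigr do rewrite mulr_suml.
rewrite exchange_big /= mulr_sumr; apply: eq_bigr => al _.
under [RHS]eq_bigr do rewrite -mulrA.
rewrite -mulr_sumr mulrCA; congr (_ * _).
rewrite /mpow; under [RHS]eq_bigr do rewrite -big_split /=.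
pose T i (j : 'I_(2 ^ m)) := (circle_root m ^+ j * z i) ^+ al i *
   \sum_(b < 2 ^ m) (w i / (circle_root m ^+ j * z i)) ^+ b.
rewrite -[RHS]/(\sum_(j : {ffun 'I_d -> 'I_(2 ^ m)}) \prod_i T i (j i)).
rewrite -(bigA_distr_bigA T) card_ffun card_ord card_ord natrX.
have -> : ((2 ^ m)%:R : C) ^+ d = \prod_(i < d) (2 ^ m)%:R.
  by rewrite prodr_const card_ord.
rewrite -big_split /=; apply: eq_bigr => i _.
have aM : (al i < 2 ^ m)%N by apply: leq_trans NM.
rewrite /T; under [RHS]eq_bigr do rewrite mulr_sumr.
rewrite exchange_big /= (bigD1 (Ordinal aM)) //= [X in _ = _ + X]big1 ?addr0.
  transitivity (w i ^+ al i * \sum_(j < 2 ^ m) (circle_root m : C) ^+ (j * Ordinal aM) * (circle_root m : C) ^- (j * Ordinal aM)).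
    by rewrite root_orthogonality eqxx mulrC.
  rewrite mulr_sumr; apply: eq_bigr => j _ /=.
  have u0 : (circle_root m : C) ^+ j != 0 by rewrite expf_neq0// circle_root_neq0.
  rewrite !exprM divff ?expf_neq0 ?circle_root_neq0// mulr1 -exprMn mulrC divfK//.
  by rewrite mulf_neq0.
move=> b bal; transitivity (z i ^+ al i * (w i / z i) ^+ b *
   \sum_(j < 2 ^ m) (circle_root m : C) ^+ (j * Ordinal aM) * (circle_root m : C) ^- (j * b)).
  rewrite mulr_sumr; apply: eq_bigr => j _ /=.
  rewrite !exprM !exprMn !invfM !exprMn !exprVn.
  by ring.
by rewrite root_orthogonality eq_sym (negbTE bal) mulr0.
Qed.

Lemma sqr_mean_le (I : finType) (a : I -> R) :
  (\sum_i a i) ^+ 2 <= #|I|%:R * \sum_i a i ^+ 2.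
Proof.
have [I0|I0] := posnP #|I|.
  by rewrite !big1 ?expr0n ?mulr0// => i; have := fintype0 i I0.
have n0 : 0 < (#|I|%:R : R) by rewrite ltr0n.
pose m := (\sum_i a i) / #|I|%:R.
have : 0 <= \sum_i (a i - m) ^+ 2 by apply: sumr_ge0 => i _; exact: sqr_ge0.
under eq_bigr do rewrite sqrrB.
rewrite big_split sumrB /= sumr_const -[_ *+ _]mulr_natl.
under [X in _ - X]eq_bigr do rewrite -mulr_natl (mulrC _ m) mulrA.
rewrite -mulr_sumr => h; have E : \sum_i a i = m * #|I|%:R by rewrite divfK ?gt_eqF.
move: h; rewrite E; set Q := \sum_i _; set n := #|I|%:R in n0 *.
move=> h; nra.
Qed.

(** The truncated kernel has modulus at most (1 - lam)^-d, and Cauchy-Schwarz passes to squares.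
    After division by the grid size the constant is free of [m], so the grid may grow with the
    degree. *)
Lemma grid_mean_square m N (c : {ffun 'I_d -> 'I_N} -> C) (P : pred {ffun 'I_d -> 'I_N}) w z (lam : R) :
  (N <= 2 ^ m)%N -> (forall i, z i != 0) -> 0 <= lam < 1 ->
  (forall i, cabs (w i) <= lam * cabs (z i)) ->
  (#|{ffun 'I_d -> 'I_(2 ^ m)}|)%:R * ((1 - lam) ^+ d) ^+ 2 *
     abs2 (\sum_(al | P al) c al * mpow w al) <=
  \sum_(j : {ffun 'I_d -> 'I_(2 ^ m)})
    abs2 (\sum_(al | P al) c al * mpow (fun i => gridrot j i * z i) al).
Proof.
move=> NM z0 /andP[l0 l1] wz.
pose J := {ffun 'I_d -> 'I_(2 ^ m)}; pose n : R := #|{: J}|%:R.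
have n0 : 0 < n by rewrite ltr0n card_ffun card_ord expn_gt0 expn_gt0.
pose p x := \sum_(al | P al) c al * mpow x al.
pose a (j : J) := cabs (p (fun i => gridrot j i * z i)).
have cg (j : J) i : cabs (gridrot j i) = 1 by exact: cabs_circle_root.
have K1 (x : C) : cabs x <= lam -> cabs (\sum_(b < 2 ^ m) x ^+ b) <= (1 - lam)^-1.
  move=> xl; apply: (le_trans (cabs_sum _ _ _)).
  apply: (@le_trans _ _ (\sum_(b < 2 ^ m) lam ^+ b)).
    by apply: ler_sum => b _; rewrite cabsX lerXn2r ?nnegrE ?cabs_ge0.
  have := subrX1 lam (2 ^ m); rewrite -[leRHS]mul1r ler_pdivlMr ?subr_gt0//.
  by have := exprn_ge0 (2 ^ m) l0; nra.
have H : n * cabs (p w) <= (\sum_j a j) * (1 - lam)^-1 ^+ d.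
  rewrite /n -(cabs_nat #|{: J}|) -cabsM /J (grid_cauchy c P w NM z0) mulr_suml.
  apply: (le_trans (cabs_sum _ _ _)); apply: ler_sum => j _.
  rewrite cabsM ler_wpM2l ?cabs_ge0// cabs_prod.
  apply: (@le_trans _ _ (\prod_(i < d) (1 - lam)^-1)); last by rewrite prodr_const card_ord.
  apply: ler_prod => i _; rewrite cabs_ge0 /=; apply: K1.
  rewrite cabsM cabsV cabsM cg mul1r ler_pdivrMr// cabs_gt0; exact: z0.
have q0 : 0 < (1 - lam) ^+ d by rewrite exprn_gt0// subr_gt0.
move: H; rewrite exprVn ler_pdivlMr// => H.
have H2 : (n * cabs (p w) * (1 - lam) ^+ d) ^+ 2 <= (\sum_j a j) ^+ 2.
  rewrite lerXn2r// nnegrE.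
    by rewrite !mulr_ge0 ?cabs_ge0// ltW.
  by apply: sumr_ge0 => j _; exact: cabs_ge0.
have := le_trans H2 (sqr_mean_le a); rewrite -/n -/J.
under [X in _ <= n * X]eq_bigr do rewrite -abs2E.
rewrite -/(p w) abs2E !exprMn => H3.
rewrite -(ler_pM2l n0); apply: le_trans H3.
by rewrite le_eqVlt; apply/orP; left; apply/eqP; ring.
Qed.

End GridCauchy.

(** * Measurability of the integrands of the spherical mean *)

Section ComplexMeasurability.
Context {R : realType} {dT : measure_display} {T : measurableType dT}.
Notation C := R[i].
Implicit Types (Q : T -> C).

Definition cmeas (Q : T -> C) := measurable_fun setT (fun t => complex.Re (Q t)) /\
  measurable_fun setT (fun t => complex.Im (Q t)).

Lemma cmeas_cst (a : C) : cmeas (fun=> a).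
Proof. by split; exact: measurable_cst. Qed.

Lemma cmeasD Q1 Q2 : cmeas Q1 -> cmeas Q2 -> cmeas (fun t => Q1 t + Q2 t).
Proof.
move=> [r1 i1] [r2 i2]; split.
  by under eq_fun do rewrite ReD; exact: measurable_funD.
by under eq_fun do rewrite ImD; exact: measurable_funD.
Qed.

Lemma cmeasM Q1 Q2 : cmeas Q1 -> cmeas Q2 -> cmeas (fun t => Q1 t * Q2 t).
Proof.
have ReM (x y : C) : complex.Re (x * y) =
    complex.Re x * complex.Re y - complex.Im x * complex.Im y by case: x y => ? ? [].
have ImM (x y : C) : complex.Im (x * y) =
    complex.Re x * complex.Im y + complex.Im x * complex.Re y by case: x y => ? ? [].
move=> [r1 i1] [r2 i2]; split.
  by under eq_fun do rewrite ReM; apply: measurable_funB; exact: measurable_funM.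
by under eq_fun do rewrite ImM; apply: measurable_funD; exact: measurable_funM.
Qed.

Lemma cmeas_scale (a : T -> R) Q : measurable_fun setT a -> cmeas Q ->
  cmeas (fun t => cscale (a t) (Q t)).
Proof. by move=> ma [r1 i1]; split => /=; exact: measurable_funM. Qed.

Lemma cmeasX Q n : cmeas Q -> cmeas (fun t => Q t ^+ n).
Proof.
move=> mQ; elim: n => [|n IH]; first exact: cmeas_cst.
by under eq_fun do rewrite exprS; exact: cmeasM.
Qed.

Lemma cmeas_prod (I : Type) (s : seq I) (Q : I -> T -> C) : (forall i, cmeas (Q i)) ->
  cmeas (fun t => \prod_(i <- s) Q i t).
Proof.
move=> mQ; elim: s => [|i s IH].
  by under eq_fun do rewrite big_nil; exact: cmeas_cst.
by under eq_fun do rewrite big_cons; exact: cmeasM.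
Qed.

Lemma cmeas_sum (I : Type) (s : seq I) (P : pred I) (Q : I -> T -> C) :
  (forall i, cmeas (Q i)) -> cmeas (fun t => \sum_(i <- s | P i) Q i t).
Proof.
move=> mQ; elim: s => [|i s IH].
  by under eq_fun do rewrite big_nil; exact: cmeas_cst.
under eq_fun do rewrite big_cons.
by case: (P i) => //; exact: cmeasD.
Qed.

Lemma measurable_abs2 Q : cmeas Q -> measurable_fun setT (fun t => abs2 (Q t)).
Proof. by move=> [r1 i1]; apply: measurable_funD; exact: measurable_funX. Qed.

Lemma measurable_inv_sqrt (g : T -> R) : measurable_fun setT g -> (forall t, 0 <= g t) ->
  measurable_fun setT (fun t => (Num.sqrt (g t))^-1).
Proof.
move=> mg g0.
have -> : (fun t => (Num.sqrt (g t))^-1) = (fun t => g t `^ (- 2^-1)).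
  by apply/funext => t; rewrite powRN powR12_sqrt.
exact: measurableT_comp (measurable_powR _) mg.
Qed.

End ComplexMeasurability.

Section SphereIntegrand.
Context {R : realType} {l1 l2 : nat}.
Notation C := R[i].
Notation d := (l1 + l2)%N.
Local Notation rad := (@rad0 R l1 l2).
Implicit Types (z w : pt R l1 l2) (f g : Fn R l1 l2).

Lemma measurable_unorm2 dT (T : measurableType dT) (Z : T -> pt R l1 l2) :
  (forall k, cmeas (fun t => Z t k)) -> measurable_fun setT (fun t => unorm2 (Z t)).
Proof.
move=> mZ; rewrite /unorm2; under eq_fun do rewrite big_mkcond.
apply: measurable_sum => k; case: (k < l1)%N; last exact: measurable_cst.
exact: measurable_abs2.
Qed.

Lemma measurable_vnorm2 dT (T : measurableType dT) (Z : T -> pt R l1 l2) :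
  (forall k, cmeas (fun t => Z t k)) -> measurable_fun setT (fun t => vnorm2 (Z t)).
Proof.
move=> mZ; rewrite /vnorm2; under eq_fun do rewrite big_mkcond.
apply: measurable_sum => k; case: (l1 <= k)%N; last exact: measurable_cst.
exact: measurable_abs2.
Qed.

Lemma indic_Omega z : \1_(@Omega R l1 l2) z =
  if (unorm2 z < 1) && (vnorm2 z < 1) then 1 else 0 :> R.
Proof.
rewrite indicE; case: (boolP (z \in _)); rewrite ?inE ?notin_setE.
  by move=> /OmegaP[-> ->].
by case: ifP => // /andP h nO; case: nO; apply/OmegaP.
Qed.

Lemma indic_Omega_ge0 z : 0 <= \1_(@Omega R l1 l2) z :> R.
Proof. by rewrite indicE ler0n. Qed.

Lemma measurable_indic_Omega dT (T : measurableType dT) (Z : T -> pt R l1 l2) :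
  (forall k, cmeas (fun t => Z t k)) ->
  measurable_fun setT (fun t => \1_(@Omega R l1 l2) (Z t) : R).
Proof.
move=> mZ; under eq_fun do rewrite indic_Omega.
apply: measurable_fun_ifT; [|exact: measurable_cst..].
apply: measurable_and; apply: measurable_fun_ltr; try exact: measurable_cst.
  exact: measurable_unorm2.
exact: measurable_vnorm2.
Qed.

Lemma cmeas_radproj dT (T : measurableType dT) (Z : T -> pt R l1 l2) :
  (forall k, cmeas (fun t => Z t k)) -> forall k, cmeas (fun t => radproj (Z t) k).
Proof.
move=> mZ k; apply: cmeas_scale => //; case: (k < l1)%N; apply: measurable_inv_sqrt.
- exact: measurable_unorm2.
- by move=> t; exact: unorm2_ge0.
- exact: measurable_vnorm2.
- by move=> t; exact: vnorm2_ge0.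
Qed.

(** An inequality because of x = 0, where the inverse is 0: a zero block is projected to 0 and not
    to the sphere. *)
Lemma invsqrt_sqr_le1 (x : R) : 0 <= x -> (Num.sqrt x)^-1 ^+ 2 * x <= 1.
Proof.
move=> x0; rewrite exprVn sqr_sqrtr//.
by have [->|x1] := eqVneq x 0; rewrite ?mulr0// mulVf.
Qed.

Lemma tnorm_radproj z : tnorm (radproj z) <= 1.
Proof.
rewrite tnorm_leP// expr1n; apply/andP; split.
  have -> : unorm2 (radproj z) = (Num.sqrt (unorm2 z))^-1 ^+ 2 * unorm2 z.
    rewrite {2}/unorm2 mulr_sumr; apply: eq_bigr => k kl.
    rewrite /radproj kl !abs2E cabs_scale exprMn ger0_norm ?invr_ge0 ?sqrtr_ge0//.
  exact/invsqrt_sqr_le1/unorm2_ge0.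
have -> : vnorm2 (radproj z) = (Num.sqrt (vnorm2 z))^-1 ^+ 2 * vnorm2 z.
  rewrite {2}/vnorm2 mulr_sumr; apply: eq_bigr => k; rewrite leqNgt => /negbTE kl.
  rewrite /radproj kl !abs2E cabs_scale exprMn ger0_norm ?invr_ge0 ?sqrtr_ge0//.
exact/invsqrt_sqr_le1/vnorm2_ge0.
Qed.

Lemma dilE (r : R) z : dil r z = (fun k => r%:C%C * z k).
Proof. by apply/funext => k; rewrite /dil cscaleE. Qed.

Lemma tnorm_dil (r : R) z : 0 <= r -> tnorm (dil r z) = r * tnorm z.
Proof. by move=> r0; rewrite dilE tnorm_scale cabs_real ger0_norm. Qed.

(** Tested on parametrizations with values in the closed unit bidisc, which contains the range of
    [radproj] and is mapped into [Omega] by [dil r] when 0 < r < 1. *)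
Definition smeas (g : Fn R l1 l2) := forall dT (T : measurableType dT) (Z : T -> pt R l1 l2),
  (forall k, cmeas (fun t => Z t k)) -> (forall t, tnorm (Z t) <= 1) ->
  measurable_fun setT (fun t => abs2 (g (Z t))).

Lemma smeas_mtaylor f (r0 r : R) N : smeas (fun z => mtaylor f r0 N (dil r z)).
Proof.
move=> dT T Z mZ _; apply: measurable_abs2; apply: cmeas_sum => al.
apply: cmeasM; first exact: cmeas_cst.
apply: cmeas_prod => k; apply: cmeasX; apply: cmeas_scale => //.
Qed.

Lemma abs2_dist_le (a b : C) : `|abs2 a - abs2 b| <= cabs (a - b) * (2 * cabs b + cabs (a - b)).
Proof.
have h1 := cabs_le_dist a b; have h2 := cabs_le_dist b a.
rewrite (cabs_distC b a) in h2; rewrite !abs2E.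
have ga := cabs_ge0 a; have gb := cabs_ge0 b; have gab := cabs_ge0 (a - b).
rewrite ler_norml; apply/andP; split; nra.
Qed.

Lemma geo_small (tau K eps : R) : 1 < tau -> 0 < eps -> exists N0, forall N, (N0 <= N)%N ->
  K * tau^-1 ^+ N <= eps.
Proof.
move=> tau1 eps0; have tau0 : 0 < tau by lra.
have K1 : 0 < `|K| + 1 by have := normr_ge0 K; lra.
have v0 : 0 < eps / (`|K| + 1) by rewrite divr_gt0.
have hc : ((fun n : nat => tau^-1 ^+ n) @ \oo --> (0 : R))%classic.
  by apply: cvg_expr; rewrite gtr0_norm ?invr_gt0// invf_lt1.
have /cvgrPdist_lt/(_ _ v0)[N0 _ hN] := hc.
exists N0 => N /hN /=; rewrite sub0r normrN ger0_norm ?exprn_ge0 ?invr_ge0 ?(ltW tau0)//.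
rewrite ltr_pdivlMr// => h; have := ler_norm K.
have := exprn_ge0 N (_ : 0 <= tau^-1); rewrite invr_ge0 => /(_ (ltW tau0)).
nra.
Qed.

Lemma taylor_uniform f (r eps : R) : holo f -> 0 < r < 1 -> 0 < eps ->
  exists N0, forall N, (N0 <= N)%N -> forall z, tnorm z <= r ->
    cabs (f z - mtaylor f rad N z) <= eps.
Proof.
move=> hf /andP[r0 r1] eps0.
(* Midpoint of 1 and 1/r, so that r * tau = (1 + r)/2 < 1. *)
pose tau := (1 + r^-1) / 2.
have ri : 1 < r^-1 by rewrite invf_gt1.
have tau1 : 1 < tau by rewrite /tau; lra.
have rt : r * tau < 1.
  by have : r * r^-1 = 1 by [rewrite divff ?gt_eqF]; rewrite /tau; nra.
have rt0 : 0 <= r * tau by rewrite mulr_ge0//; lra.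
have [A A0 hA] := holo_bounded hf rt0 rt.
have [N0 hN] := @geo_small tau (A / (1 - tau^-1)) eps tau1 eps0.
exists N0 => N NN z zr.
have := taylor_Omega N hf (ltW r0) tau1 rt hA zr => /le_trans; apply.
by rewrite mulrAC; exact: hN.
Qed.

(** On the dilated bidisc |f|^2 is the pointwise limit of |T_N f|^2, and polynomials are measurable
    in the coordinates. *)
Lemma smeas_holo f (r : R) : holo f -> 0 < r < 1 -> smeas (fun z => f (dil r z)).
Proof.
move=> hf r01 dT T Z mZ Z1; have /andP[r0 r1] := r01.
apply: (@measurable_fun_cvg _ _ _ _ (fun N t => abs2 (mtaylor f rad N (dil r (Z t))))).
  by move=> N; exact: smeas_mtaylor.
move=> t _; apply/cvgrPdist_le => eps eps0.
set b := f _; pose K := 2 * cabs b + 1.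
have K0 : 0 < K by have := cabs_ge0 b; rewrite /K; lra.
have e0 : 0 < Num.min 1 (eps / K) by rewrite lt_min ltr01 divr_gt0.
have [N0 hN] := taylor_uniform hf r01 e0.
exists N0 => // N /= NN; set a := mtaylor _ _ _ _.
have zr : tnorm (dil r (Z t)) <= r by rewrite tnorm_dil ?(ltW r0)// ger_pMr.
have := hN N NN _ zr; rewrite -/a -/b cabs_distC le_min => /andP[ab1].
rewrite ler_pdivlMr// => ab2; rewrite distrC; apply: (le_trans (abs2_dist_le a b)).
apply: le_trans ab2; rewrite ler_wpM2l ?cabs_ge0// /K; lra.
Qed.

Definition sphere_integrand g (s : nat -> C) : \bar R :=
  let z : pt R l1 l2 := fun i => s (nat_of_ord i) in
  (\1_(@Omega R l1 l2) z * abs2 (g (radproj z)))%:E.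

Lemma sphere_integrand_ge0 g s : (0 <= sphere_integrand g s)%E.
Proof. by rewrite lee_fin mulr_ge0 ?abs2_ge0// indic_Omega_ge0. Qed.

Lemma mfun_sphere g : smeas g -> mfun (sphere_integrand g).
Proof.
move=> mg dS S p a b mp ma mb; apply/measurable_EFinP; apply: measurable_funM.
  by apply: measurable_indic_Omega => k; split; [exact: ma|exact: mb].
apply: mg => [|t]; last exact: tnorm_radproj.
by apply: cmeas_radproj => k; split; [exact: ma|exact: mb].
Qed.

Lemma mfun_Omega : mfun (fun s : nat -> C =>
  (\1_(@Omega R l1 l2) (fun i : 'I_d => s i))%:E).
Proof.
move=> dS S p a b mp ma mb; apply/measurable_EFinP.
by apply: measurable_indic_Omega => k; split; [exact: ma|exact: mb].
Qed.

End SphereIntegrand.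

(** * Point evaluation on the Hardy space *)

Section PointEvaluation.
Context {R : realType} {l1 l2 : nat}.
Notation C := R[i].
Notation d := (l1 + l2)%N.
Local Notation rad := (@rad0 R l1 l2).
Implicit Types (z w : pt R l1 l2) (f g : Fn R l1 l2).

Lemma unorm2_rot (u : 'I_d -> C) z : (forall i, cabs (u i) = 1) ->
  unorm2 (fun i => u i * z i) = unorm2 z.
Proof. by move=> u1; apply: eq_bigr => i _; rewrite !abs2E cabsM u1 mul1r. Qed.

Lemma vnorm2_rot (u : 'I_d -> C) z : (forall i, cabs (u i) = 1) ->
  vnorm2 (fun i => u i * z i) = vnorm2 z.
Proof. by move=> u1; apply: eq_bigr => i _; rewrite !abs2E cabsM u1 mul1r. Qed.

Lemma radproj_rot (u : 'I_d -> C) z : (forall i, cabs (u i) = 1) ->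
  radproj (fun i => u i * z i) = (fun i => u i * radproj z i).
Proof.
move=> u1; apply/funext => i; rewrite /radproj unorm2_rot// vnorm2_rot//.
by rewrite !cscaleE mulrCA.
Qed.

(** [iint] works on sequences indexed by all natural numbers; families indexed by ['I_d] are
    extended by [x0]. *)
Definition extc (T : Type) (x0 : T) (v : 'I_d -> T) (k : nat) : T := oapp v x0 (insub k).

Lemma extcE (T : Type) (x0 : T) (v : 'I_d -> T) (i : 'I_d) : extc x0 v i = v i.
Proof. by rewrite /extc valK. Qed.

(* A point z of the box has coordinates slightly larger than those of w / (2 rho), but
   both its blocks have norm at most 1/2, so its projection dominates w coordinatewise. *)
Lemma box_point w (rho s eps : R) (sq : nat -> C) : 0 < rho -> tnorm w <= rho ->
  0 < s < 1 -> eps = (1 - s ^+ 2) / (48 * (d%:R + 1)) ->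
  inbox d (extc 0 (fun i => s * (cabs (w i) / rho) / 2 + eps)) eps sq ->
  let z : pt R l1 l2 := fun i => sq (nat_of_ord i) in
  Omega z /\ forall i, radproj z i != 0 /\ s * cabs (w i) / rho <= cabs (radproj z i).
Proof.
move=> rho0 wr /andP[s0 s1] epsE sqb z.
pose a i := cabs (w i) / rho.
have D0 : 1 <= (d%:R + 1 : R) by rewrite lerDr.
have s21 : s ^+ 2 < 1 by rewrite expr_lt1// ltW.
have s20 : 0 <= s ^+ 2 by exact: sqr_ge0.
have eps0 : 0 < eps by rewrite epsE divr_gt0 ?mulr_gt0//; lra.
(* 48 = 4 * 12: the errors [12 * eps] per coordinate add up to at most (1 - s^2)/4, the room between
   s^2/4 and (1/2)^2. *)
have epsD : 48 * (d%:R + 1) * eps = 1 - s ^+ 2.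
  by rewrite epsE mulrC divfK// mulf_neq0// gt_eqF//; lra.
have eps1 : eps <= 1 / 48.
  have : 48 * eps <= 48 * (d%:R + 1) * eps by rewrite ler_wpM2r ?(ltW eps0)//; lra.
  lra.
have a0 i : 0 <= a i by rewrite divr_ge0 ?cabs_ge0// ltW.
have a1 i : a i <= 1.
  by rewrite ler_pdivrMr// mul1r; apply: cabs_coord_le wr; exact: ltW.
have zb i : s * a i / 2 + eps <= complex.Re (z i) <= s * a i / 2 + eps + eps /\
     0 <= complex.Im (z i) <= eps.
  by have := sqb i; rewrite ltn_ord extcE => /andP[].
have zlow i : s * a i / 2 + eps <= cabs (z i).
  have [/andP[h _] _] := zb i; apply: le_trans h _.
  by apply: le_trans (Re_le_cabs (z i)); exact: ler_norm.
have zup i : cabs (z i) <= s * a i / 2 + 3 * eps.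
  have [/andP[h1 h2] /andP[h3 h4]] := zb i.
  have sa : 0 <= s * a i by rewrite mulr_ge0// ltW.
  apply: le_trans (cabs_le_ReIm _) _.
  rewrite (ger0_norm h3) ger0_norm; [lra|lra].
have zsq i : abs2 (z i) <= s ^+ 2 / 4 * a i ^+ 2 + 12 * eps.
  rewrite abs2E; have sa : 0 <= s * a i by rewrite mulr_ge0// ltW.
  have sa1 : s * a i <= 1 by rewrite mulr_ile1// ltW.
  have := zup i; have := cabs_ge0 (z i) => c0 c1.
  have h : cabs (z i) ^+ 2 <= (s * a i / 2 + 3 * eps) ^+ 2.
    by rewrite lerXn2r ?nnegrE//; lra.
  apply: le_trans h _; rewrite -subr_ge0.
  have -> : s ^+ 2 / 4 * a i ^+ 2 + 12 * eps - (s * a i / 2 + 3 * eps) ^+ 2 =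
    eps * (3 * (1 - s * a i) + 9 * (1 - eps)) by field.
  by rewrite mulr_ge0 ?(ltW eps0)//; lra.
have key (P : pred 'I_d) : \sum_(i < d | P i) abs2 (w i) <= rho ^+ 2 ->
    \sum_(i < d | P i) abs2 (z i) <= (1 / 2) ^+ 2.
  move=> wP; apply: (@le_trans _ _ (\sum_(i < d | P i) (s ^+ 2 / 4 * a i ^+ 2 + 12 * eps))).
    exact: ler_sum.
  rewrite big_split /= -mulr_sumr.
  have h1 : \sum_(i < d | P i) a i ^+ 2 <= 1.
    have -> : \sum_(i < d | P i) a i ^+ 2 = (\sum_(i < d | P i) abs2 (w i)) / rho ^+ 2.
      by rewrite mulr_suml; apply: eq_bigr => i _; rewrite abs2E expr_div_n.
    by rewrite ler_pdivrMr ?exprn_gt0// mul1r.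
  have h2 : \sum_(i < d | P i) 12 * eps <= d%:R * (12 * eps).
    rewrite [leRHS](_ : _ = \sum_(i < d) 12 * eps); last first.
      by rewrite sumr_const card_ord mulr_natl.
    by rewrite [leRHS](bigID P) /= lerDl; apply: sumr_ge0 => *; rewrite mulr_ge0// ltW.
  have h3 : s ^+ 2 / 4 * \sum_(i < d | P i) a i ^+ 2 <= s ^+ 2 / 4.
    by rewrite ler_piMr// divr_ge0.
  rewrite expr2; nra.
have r2 : 0 <= (1 / 2 : R) by rewrite divr_ge0.
have := wr; rewrite tnorm_leP ?(ltW rho0)// => /andP[/key uz /key vz].
split; first by apply/OmegaP; split; [apply: le_lt_trans uz _|apply: le_lt_trans vz _]; rewrite expr2; lra.
have big (n : R) i : abs2 (z i) <= n -> n <= (1 / 2) ^+ 2 ->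
    cscale (Num.sqrt n)^-1 (z i) != 0 /\ s * cabs (w i) / rho <= cabs (cscale (Num.sqrt n)^-1 (z i)).
  move=> zn n2.
  have zi0 : 0 < cabs (z i) by have := mulr_ge0 (ltW s0) (a0 i); have := zlow i; lra.
  have sn0 : 0 < Num.sqrt n.
    by rewrite sqrtr_gt0; apply: lt_le_trans zn; rewrite abs2E exprn_gt0.
  have sn2 : Num.sqrt n <= 1 / 2 by rewrite sqrt_le_sqr.
  have i2 : 2 <= (Num.sqrt n)^-1.
    by rewrite -[leLHS]invrK lef_pV2 ?posrE ?invr_gt0//; lra.
  have cE : cabs (cscale (Num.sqrt n)^-1 (z i)) = (Num.sqrt n)^-1 * cabs (z i).
    by rewrite cabs_scale gtr0_norm// invr_gt0.
  split; first by rewrite -cabs_gt0 cE mulr_gt0// invr_gt0.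
  rewrite cE -mulrA -/(a i); apply: (@le_trans _ _ (2 * cabs (z i))).
    by have := zlow i; lra.
  by rewrite ler_wpM2r// ltW.
move=> i; rewrite /radproj; case: ifPn => [il|]; last rewrite -leqNgt => il.
  apply: big => //; rewrite /unorm2 (bigD1 i)//= lerDl; apply: sumr_ge0 => *; exact: abs2_ge0.
apply: big => //; rewrite /vnorm2 (bigD1 i)//= lerDl; apply: sumr_ge0 => *; exact: abs2_ge0.
Qed.

(** Summing the integrand over all grid rotations multiplies the integral by the grid size. On the
    box of [box_point] that sum is bounded below by [grid_mean_square]. The box moves with [w], but
    its side [eps] depends only on [rho], [r] and d, so [kap] is uniform in [f], [N] and [w]. *)
Theorem poly_point_bound (rho r : R) : 0 < rho < r -> exists2 kap : R, 0 < kap &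
  forall f N w, tnorm w <= rho -> ((kap * abs2 (mtaylor f rad N w))%:E <=
    cint (fun z => (\1_(@Omega R l1 l2) z * abs2 (mtaylor f rad N (dil r (radproj z))))%:E))%E.
Proof.
move=> /andP[rho0 rhor]; have r0 : 0 < r by exact: lt_trans rhor.
have qr : rho / r < 1 by rewrite ltr_pdivrMr// mul1r.
have q0 : 0 < rho / r by rewrite divr_gt0.
pose lam := (1 + rho / r) / 2; have lam01 : 0 < lam < 1 by rewrite /lam; lra.
have /andP[lam0 lam1] := lam01.
have lr : rho < lam * r.
  have -> : lam * r = (r + rho) / 2 by rewrite /lam; field; rewrite gt_eqF.
  by lra.
have lr0 : 0 < lam * r by rewrite mulr_gt0.
(* Chosen so that lam * r * s / rho = 1: the lower bound s|w i|/rho for |radproj z i| becomes |w i|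
   <= lam |r * radproj z i|. *)
pose s := rho / (lam * r); have s01 : 0 < s < 1.
  by rewrite divr_gt0//= ltr_pdivrMr// mul1r.
pose eps := (1 - s ^+ 2) / (48 * (d%:R + 1)) : R.
have eps0 : 0 < eps.
  have /andP[s0 s1] := s01.
  apply: divr_gt0; first by rewrite subr_gt0 expr_lt1// ltW.
  by rewrite mulr_gt0// ltr_wpDl.
exists (((1 - lam) ^+ d) ^+ 2 * (eps ^+ 2) ^+ d).
  by rewrite mulr_gt0 ?exprn_gt0// subr_gt0.
move=> f N w wr; pose p := mtaylor f rad N.
pose g : Fn R l1 l2 := fun z => p (dil r z).
have mg : mfun (sphere_integrand g) by apply: mfun_sphere; exact: smeas_mtaylor.
have -> : cint (fun z => (\1_(@Omega R l1 l2) z * abs2 (mtaylor f rad N (dil r (radproj z))))%:E)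
   = iint d (sphere_integrand g) by [].
(* Grid order [2 ^ N]: all exponents are below N <= 2^N, as [grid_cauchy] requires. *)
pose u (j : {ffun 'I_d -> 'I_(2 ^ N)}) := extc 1 (gridrot j) : nat -> C.
have cg (j : {ffun 'I_d -> 'I_(2 ^ N)}) i : cabs (gridrot j i : C) = 1 by exact: cabs_circle_root.
have u1 j k : cabs (u j k) = 1.
  by rewrite /u /extc; case: insub => [i|] /=; [exact: cg|exact: cabs1].
pose n : R := #|{ffun 'I_d -> 'I_(2 ^ N)}|%:R.
have n0 : 0 < n by rewrite ltr0n card_ffun card_ord expn_gt0 expn_gt0.
have tot : iint d (fun sq => \sum_(j : {ffun 'I_d -> 'I_(2 ^ N)}) sphere_integrand g (rotc (u j) sq))%E
   = (n%:E * iint d (sphere_integrand g))%E.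
  rewrite (@iint_sum _ d _ _ (fun j sq => sphere_integrand g (rotc (u j) sq))); first last.
  - by move=> j sq; exact: sphere_integrand_ge0.
  - by move=> j; exact: mfun_rotc.
  under eq_bigr do rewrite (iint_rotc _ mg (sphere_integrand_ge0 g) (u1 _)).
  by rewrite sumr_const mule_natl.
have low : ((n * ((1 - lam) ^+ d) ^+ 2 * abs2 (p w) * (eps ^+ 2) ^+ d)%:E <=
   iint d (fun sq => \sum_(j : {ffun 'I_d -> 'I_(2 ^ N)}) sphere_integrand g (rotc (u j) sq)))%E.
  apply: (@iint_box_ge _ _ _ (extc 0 (fun i => s * (cabs (w i) / rho) / 2 + eps))).
  - exact: ltW.
  - by rewrite mulr_ge0 ?abs2_ge0// mulr_ge0 ?sqr_ge0// ltW.
  - by move=> sq; apply: sume_ge0 => j _; exact: sphere_integrand_ge0.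
  move=> sq sqb.
  have [zO zw] := box_point rho0 wr s01 (erefl _) sqb.
  set z : pt R l1 l2 := fun i => sq i in zO zw.
  have E j : sphere_integrand g (rotc (u j) sq) =
     (abs2 (p (fun i => gridrot j i * (r%:C%C * radproj z i))))%:E.
    rewrite /sphere_integrand.
    have -> : (fun i : 'I_d => rotc (u j) sq i) = (fun i => gridrot j i * z i).
      by apply/funext => i; rewrite /rotc /u extcE.
    rewrite indic_Omega unorm2_rot// vnorm2_rot// -indic_Omega indicE mem_set// mul1r.
    congr (EFin (abs2 (p _))); rewrite radproj_rot// dilE.
    by apply/funext => i; rewrite mulrCA.
  under eq_bigr do rewrite E.
  rewrite sumEFin lee_fin; apply: grid_mean_square.
  - exact/ltnW/ltn_expl.
  - by move=> i; apply: mulf_neq0; [rewrite realc_eq0 gt_eqF|have [] := zw i].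
  - by rewrite lam1 ltW.
  - move=> i; rewrite cabsM cabs_real gtr0_norm// mulrA.
    have [_] := zw i; rewrite -(ler_pM2l lr0); apply: le_trans.
    rewrite le_eqVlt; apply/orP; left; apply/eqP; rewrite /s; field.
    by rewrite !gt_eqF.
move: low; rewrite tot.
have -> : (n * ((1 - lam) ^+ d) ^+ 2 * abs2 (p w) * (eps ^+ 2) ^+ d)%:E =
  (n%:E * (((1 - lam) ^+ d) ^+ 2 * (eps ^+ 2) ^+ d * abs2 (p w))%:E)%E.
  by rewrite -EFinM; congr EFin; ring.
by rewrite lee_pmul2l// ?lte_fin.
Qed.

End PointEvaluation.

Section HardyBounds.
Context {R : realType} {l1 l2 : nat}.
Notation C := R[i].
Notation d := (l1 + l2)%N.
Local Notation rad := (@rad0 R l1 l2).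
Local Notation V := (fine (volOmega R l1 l2)).
Implicit Types (z w h : pt R l1 l2) (f g : Fn R l1 l2).

Lemma volOmega_ge0 : (0 <= volOmega R l1 l2)%E.
Proof. by apply: iint_ge0 => s; rewrite lee_fin indic_Omega_ge0. Qed.

Lemma vol_ge0 : 0 <= V.
Proof. exact/fine_ge0/volOmega_ge0. Qed.

(** [fine] sends infinite values to 0, so a nonzero [V] also says that the volume is finite. *)
Lemma volE : V != 0 -> volOmega R l1 l2 = V%:E.
Proof. by case: volOmega => //=; rewrite eqxx. Qed.

Lemma H2sq_bounded g (A : R) : 0 <= A -> (forall z, Omega z -> abs2 (g z) <= A) ->
  (H2sq g <= A%:E)%E.
Proof.
move=> A0 gA; apply: ge_ereal_sup => _ [r /= /andP[r0 r1] <-].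
rewrite /sphere_mean; have [V0|V0] := eqVneq V 0.
  by rewrite V0 invr0 mul0e lee_fin.
have Vp : 0 < V by rewrite lt_neqAle eq_sym V0 vol_ge0.
rewrite lee_pdivrMl// -EFinM.
have -> : (V * A)%:E = iint d (fun s => A%:E * (\1_(@Omega R l1 l2) (fun i : 'I_d => s i))%:E)%E.
  rewrite (iintZ _ A0 mfun_Omega).
    by rewrite -/(cint (fun z => (\1_(@Omega R l1 l2) z)%:E)) -/(volOmega R l1 l2) volE// -EFinM mulrC.
  by move=> s; rewrite lee_fin indic_Omega_ge0.
apply: iint_le => s; first by rewrite lee_fin mulr_ge0 ?abs2_ge0// indic_Omega_ge0.
rewrite -EFinM lee_fin mulrC ler_wpM2r ?indic_Omega_ge0//; apply: gA.
apply: (@tnorm_le_Omega _ _ _ _ r) => //.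
by rewrite tnorm_dil ?(ltW r0)// ger_pMr// tnorm_radproj.
Qed.

(** The inverse of 0 is 0, so every spherical mean vanishes. This settles the degenerate value of
    [V] without computing the volume. *)
Lemma H2sq_null g : V = 0 -> (H2sq g <= 0)%E.
Proof. by move=> V0; apply: ge_ereal_sup => _ [r _ <-]; rewrite /sphere_mean V0 invr0 mul0e. Qed.

Lemma H2norm_le g (A : R) : 0 <= A -> (H2sq g <= (A ^+ 2)%:E)%E -> (H2norm g <= A%:E)%E.
Proof.
move=> A0; rewrite /H2norm; case: (H2sq g) => [x||] //=.
  by rewrite !lee_fin sqrt_le_sqr.
by rewrite sqrtr0 lee_fin.
Qed.

Lemma H2sq_le1 f : H2 f -> (H2norm f <= 1)%E -> (H2sq f <= 1)%E.
Proof.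
move=> [_]; rewrite /H2norm; case: (H2sq f) => [x||] //= _.
  by rewrite !lee_fin sqrt_le_sqr// expr1n.
by rewrite leNye.
Qed.

(** [poly_point_bound] is applied to a Taylor polynomial within 1 of [f] on radius [r]. Its degree
    depends on [f], but [kap] does not depend on the degree, so [K] serves the whole unit ball. *)
Theorem point_evaluation (rho : R) : 0 < rho < 1 -> V != 0 -> exists2 K : R, 0 <= K &
  forall f, holo f -> (H2sq f <= 1)%E -> forall w, tnorm w <= rho -> cabs (f w) <= K.
Proof.
move=> /andP[rho0 rho1] V0.
have Vp : 0 < V by rewrite lt_neqAle eq_sym V0 vol_ge0.
pose r := (1 + rho) / 2; have r01 : 0 < r < 1 by rewrite /r; lra.
have rhor : 0 < rho < r by rewrite /r; lra.
have [kap kap0 hk] := @poly_point_bound R l1 l2 rho r rhor.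
exists (1 + Num.sqrt (4 * V / kap)); first by rewrite addr_ge0 ?sqrtr_ge0.
move=> f hf f1 w wr.
have [N hN] := taylor_uniform hf r01 ltr01.
have {hN}hN := hN N (leqnn N).
pose p := mtaylor f rad N.
have /andP[r0 r1] := r01.
have mf : mfun (sphere_integrand (fun z => f (dil r z))).
  by apply: mfun_sphere; exact: smeas_holo.
have ff : (cint (fun z => (\1_(@Omega R l1 l2) z * abs2 (f (dil r (radproj z))))%:E) <= V%:E)%E.
  have : (sphere_mean (fun xi : pt R l1 l2 => abs2 (f (dil r xi))) <= 1)%E.
    by apply: le_trans f1; apply: ereal_sup_ubound; exists r.
  by rewrite /sphere_mean lee_pdivrMl// mule1.
have pf : (cint (fun z => (\1_(@Omega R l1 l2) z * abs2 (p (dil r (radproj z))))%:E) <= (4 * V)%:E)%E.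
  (* From |p| <= |f| + 1 follows |p|^2 <= 2|f|^2 + 2; the integrals of |f|^2 and of 1 are each at
     most V. *)
  have -> : (4 * V)%:E = (2%:E * V%:E + 2%:E * volOmega R l1 l2)%E.
    by rewrite volE// -!EFinM -EFinD; congr EFin; ring.
  pose F1 := sphere_integrand (fun z => f (dil r z)).
  pose F2 (s : nat -> C) : \bar R := (\1_(@Omega R l1 l2) (fun i : 'I_d => s i))%:E.
  have F10 s : (0 <= F1 s)%E by exact: sphere_integrand_ge0.
  have F20 s : (0 <= F2 s)%E by rewrite lee_fin indic_Omega_ge0.
  apply: (@le_trans _ _ (iint d (fun s => 2%:E * F1 s + 2%:E * F2 s)%E)); last first.
    have mF2 : mfun F2 := mfun_Omega.
    have mZ F : mfun F -> mfun (fun s => 2%:E * F s)%E.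
      by move=> mF dS S q a b mq ma mb; apply: measurable_funeM; exact: (mF _ S q a b).
    rewrite iintD; first 1 last.
    - exact: mZ.
    - exact: mZ.
    - by move=> s; rewrite mule_ge0.
    - by move=> s; rewrite mule_ge0.
    rewrite !iintZ//; apply: leeD; last by [].
    by rewrite lee_pmul2l.
  apply: iint_le => s; first by rewrite lee_fin mulr_ge0 ?abs2_ge0 ?indic_Omega_ge0.
  rewrite /F1 /F2 /sphere_integrand -!EFinM -EFinD lee_fin.
  set z : pt R l1 l2 := fun i => s i; set o := \1_ _ z; set x := dil r (radproj z).
  have o0 : 0 <= o by exact: indic_Omega_ge0.
  have xr : tnorm x <= r by rewrite tnorm_dil ?(ltW r0)// ger_pMr// tnorm_radproj.
  have -> : 2 * (o * abs2 (f x)) + 2 * o = o * (2 * abs2 (f x) + 2) by ring.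
  rewrite ler_wpM2l// !abs2E.
  have := hN x xr; rewrite -/(p x) cabs_distC => h1.
  have h2 : cabs (p x) <= cabs (f x) + 1 by have := cabs_le_dist (p x) (f x); lra.
  have h3 : cabs (p x) ^+ 2 <= (cabs (f x) + 1) ^+ 2.
    by rewrite lerXn2r ?nnegrE ?addr_ge0 ?cabs_ge0.
  apply: le_trans h3 _; rewrite -subr_ge0.
  rewrite (_ : _ - _ = (cabs (f x) - 1) ^+ 2) ?sqr_ge0//; ring.
have pw := le_trans (hk f N w wr) pf; rewrite lee_fin in pw.
have pw2 : cabs (p w) <= Num.sqrt (4 * V / kap).
  rewrite -(ger0_norm (cabs_ge0 (p w))) -sqrtr_sqr ler_sqrt -?abs2E.
    by rewrite ler_pdivlMr// mulrC.
  by rewrite divr_ge0 ?mulr_ge0 ?(ltW kap0)// ltW.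
have wr' : tnorm w <= r by have /andP[_ ?] := rhor; apply: le_trans wr _; exact: ltW.
have := cabs_le_dist (f w) (p w); have := hN w wr'; rewrite -/(p w); lra.
Qed.

End HardyBounds.

(** * Sums and products of holomorphic functions *)

Section HoloAlgebra.
Context {R : realType} {l1 l2 : nat}.
Notation C := R[i].
Notation d := (l1 + l2)%N.
Implicit Types (z w h : pt R l1 l2) (f g : Fn R l1 l2).

Lemma holo_cst (a : C) : holo (fun _ : pt R l1 l2 => a).
Proof.
move=> z _; exists (fun=> 0) => eps eps0; exists 1 => // h _ _.
rewrite subrr big1 => [|j _]; last by rewrite mul0r.
by rewrite subr0 cabs0 mulr_ge0 ?cnorm_ge0// ltW.
Qed.

Lemma holoD f g : holo f -> holo g -> holo (fun z => f z + g z).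
Proof.
move=> hf hg z zO; have [Lf hLf] := hf z zO; have [Lg hLg] := hg z zO.
exists (fun j => Lf j + Lg j) => eps eps0; have e0 : 0 < eps / 2 by rewrite divr_gt0.
have [d1 d10 h1] := hLf _ e0; have [d2 d20 h2] := hLg _ e0.
exists (Num.min d1 d2); first by rewrite lt_min d10.
move=> h hO; rewrite lt_min => /andP[/(h1 h hO) k1 /(h2 h hO) k2].
have -> : \sum_j (Lf j + Lg j) * h j = \sum_j Lf j * h j + \sum_j Lg j * h j.
  by rewrite -big_split; apply: eq_bigr => j _; rewrite mulrDl.
rewrite (_ : _ - _ = (f (addp z h) - f z - \sum_j Lf j * h j) +
   (g (addp z h) - g z - \sum_j Lg j * h j)); last by ring.
by apply: le_trans (cabsD _ _) _; lra.
Qed.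

Lemma holoM f g : holo f -> holo g -> holo (fun z => f z * g z).
Proof.
move=> hf hg z zO; have [Lf hLf] := hf z zO; have [Lg hLg] := hg z zO.
exists (fun j => Lf j * g z + f z * Lg j) => eps eps0.
pose S : R := \sum_j cabs (Lf j).
have S0 : 0 <= S by apply: sumr_ge0 => *; exact: cabs_ge0.
(* [Q] adds up the factors of the three error terms of the product rule, each of size eps/Q times
   the norm of [h]. *)
pose Q := cabs (g z) + 1 + S + cabs (f z).
have f0 := cabs_ge0 (f z); have g0 := cabs_ge0 (g z).
have Q0 : 0 < Q by rewrite /Q; lra.
have e0 : 0 < eps / Q by rewrite divr_gt0.
have [d1 d10 h1] := hLf _ e0; have [d2 d20 h2] := hLg _ e0.
have m0 : 0 < Num.min 1 (eps / Q) by rewrite lt_min ltr01.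
have [d3 d30 h3] := holo_continuous hg zO m0.
exists (Num.min (Num.min d1 d2) d3); first by rewrite !lt_min d10 d20.
move=> h hO; rewrite !lt_min => /andP[/andP[/(h1 h hO) k1 /(h2 h hO) k2] /h3].
rewrite le_min => /andP[k3 k4].
pose lf := \sum_j Lf j * h j; pose lg := \sum_j Lg j * h j.
have -> : \sum_j (Lf j * g z + f z * Lg j) * h j = lf * g z + f z * lg.
  rewrite /lf /lg mulr_suml mulr_sumr -big_split; apply: eq_bigr => j _ /=; ring.
rewrite (_ : _ - _ = (f (addp z h) - f z - lf) * g (addp z h) +
   lf * (g (addp z h) - g z) + f z * (g (addp z h) - g z - lg)); last by ring.
have n0 := cnorm_ge0 h.
have b1 : cabs ((f (addp z h) - f z - lf) * g (addp z h)) <= eps / Q * cnorm h * (cabs (g z) + 1).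
  rewrite cabsM ler_pM ?cabs_ge0//.
  by have := cabs_le_dist (g (addp z h)) (g z); lra.
have b2 : cabs (lf * (g (addp z h) - g z)) <= S * cnorm h * (eps / Q).
  rewrite cabsM ler_pM ?cabs_ge0// /lf /S mulr_suml.
  apply: (le_trans (cabs_sum _ _ _)); apply: ler_sum => j _.
  by rewrite cabsM ler_wpM2l ?cabs_ge0// coord_le_cnorm.
have b3 : cabs (f z * (g (addp z h) - g z - lg)) <= cabs (f z) * (eps / Q * cnorm h).
  by rewrite cabsM ler_wpM2l.
have E : eps * cnorm h = eps / Q * cnorm h * (cabs (g z) + 1) + S * cnorm h * (eps / Q)
   + cabs (f z) * (eps / Q * cnorm h).
  by rewrite (_ : eps / Q * cnorm h * (cabs (g z) + 1) + S * cnorm h * (eps / Q)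
   + cabs (f z) * (eps / Q * cnorm h) = eps / Q * cnorm h * Q); [field; rewrite gt_eqF|rewrite /Q; ring].
rewrite E; apply: le_trans (cabsD _ _) _; apply: lerD => //.
by apply: le_trans (cabsD _ _) _; apply: lerD.
Qed.

Lemma holo_sum (I : Type) (s : seq I) (P : pred I) (F : I -> Fn R l1 l2) :
  (forall i, holo (F i)) -> holo (fun z => \sum_(i <- s | P i) F i z).
Proof.
move=> hF; elim: s => [|i s IH].
  by under eq_fun do rewrite big_nil; exact: holo_cst.
under eq_fun do rewrite big_cons.
by case: (P i) => //; exact: holoD.
Qed.

Lemma holo_prod (I : Type) (s : seq I) (F : I -> Fn R l1 l2) :
  (forall i, holo (F i)) -> holo (fun z => \prod_(i <- s) F i z).
Proof.
move=> hF; elim: s => [|i s IH].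
  by under eq_fun do rewrite big_nil; exact: holo_cst.
by under eq_fun do rewrite big_cons; exact: holoM.
Qed.

Lemma holoX f n : holo f -> holo (fun z => f z ^+ n).
Proof.
move=> hf; elim: n => [|n IH]; first exact: holo_cst.
by under eq_fun do rewrite exprS; exact: holoM.
Qed.

End HoloAlgebra.

(** * Finite rank and error of the Taylor operators *)

Section TaylorOperator.
Context {R : realType} {l1 l2 : nat}.
Notation C := R[i].
Notation d := (l1 + l2)%N.
Local Notation rad := (@rad0 R l1 l2).
Local Notation V := (fine (volOmega R l1 l2)).
Context (phi : pt R l1 l2 -> pt R l1 l2)
  (phi_holo : forall i, holo (fun z => phi z i))
  (phiO : forall z, Omega z -> Omega (phi z)).
Implicit Types (f g : Fn R l1 l2).

Definition taylor_op N f : Fn R l1 l2 := fun z => mtaylor f rad N (phi z).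

Lemma taylor_op_H2 N f : H2 (taylor_op N f).
Proof.
split.
  apply: holo_sum => al; apply: holoM; first exact: holo_cst.
  by apply: holo_prod => i; exact: holoX.
pose A : R := \sum_(al : {ffun 'I_d -> 'I_N} | (mdeg al < N)%N) cabs (mcoef f rad al).
have A0 : 0 <= A by apply: sumr_ge0 => *; exact: cabs_ge0.
apply: (@le_lt_trans _ _ (A ^+ 2)%:E); last exact: ltry.
apply: H2sq_bounded => [|z zO]; first exact: sqr_ge0.
rewrite abs2E lerXn2r ?nnegrE ?cabs_ge0//.
apply: (le_trans (cabs_sum _ _ _)); apply: ler_sum => al _.
rewrite cabsM ler_piMr ?cabs_ge0//.
apply: le_trans (cabs_mpow_le al (q := 1) _) _; last by rewrite expr1n.
by move=> i; apply: cabs_coord_le => //; exact/ltW/phiO.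
Qed.

(** [finrank_op m] takes exactly [m] generators; the N^d monomials are listed as [Some al], and
    indices past the list read [None], which stands for the zero function. *)
Lemma sum_nth_pad (T : Type) (x0 : T) (L : seq T) (G : T -> C) m :
  (size L <= m)%N -> G x0 = 0 -> \sum_(k < m) G (nth x0 L k) = \sum_(x <- L) G x.
Proof.
move=> sLm G0; rewrite (big_nth x0) big_mkord.
rewrite (big_ord_widen m (fun k => G (nth x0 L k)) sLm) [in RHS]big_mkcond.
apply: eq_bigr => k _; case: ltnP => // Lk.
by rewrite nth_default.
Qed.

Lemma taylor_op_finrank N m : (N ^ d <= m)%N -> finrank_op m (taylor_op N).
Proof.
move=> Nm; split.
- by move=> f _; exact: taylor_op_H2.
- move=> a f g [hf _] [hg _] z _; rewrite /taylor_op /mtaylor mulr_sumr -big_split.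
  by apply: eq_bigr => al _ /=; rewrite mcoef_linear// mulrDl mulrA.
pose L := map Some (enum {ffun 'I_d -> 'I_N}).
pose gs (k : 'I_m) : Fn R l1 l2 := fun z =>
  oapp (fun al => mpow (phi z) al) 0 (nth None L k).
exists gs => f _.
exists (fun k => oapp (fun al => if (mdeg al < N)%N then mcoef f rad al else 0) 0 (nth None L k)).
move=> z _; rewrite /gs.
have sL : (size L <= m)%N.
  by rewrite size_map -cardE card_ffun !card_ord.
rewrite (sum_nth_pad (G := fun o => oapp (fun al => if (mdeg al < N)%N then mcoef f rad al else 0) 0 o *
   oapp (fun al => mpow (phi z) al) 0 o) sL); last by rewrite /= mul0r.
rewrite big_map big_enum /= /taylor_op /mtaylor big_mkcond.
by apply: eq_bigr => al _; case: ifP => // _; rewrite mul0r.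
Qed.

Lemma taylor_op_error (rho : R) : 0 < rho < 1 ->
  (forall z, Omega z -> tnorm (phi z) <= rho) ->
  exists B tau : R, [/\ 0 <= B, 1 < tau & forall N,
    (opnorm (fun f z => (Cphi phi f z - taylor_op N f z)%R) <= (B * tau^-1 ^+ N)%:E)%E].
Proof.
move=> /andP[rho0 rho1] phirho.
(* Midpoint of 1 and 1/rho, so rho * tau = (1 + rho)/2 stays below 1 and point evaluation applies on
   that radius. *)
pose tau := (1 + rho^-1) / 2.
have ri : 1 < rho^-1 by rewrite invf_gt1.
have tau1 : 1 < tau by rewrite /tau; lra.
have ti : tau^-1 < 1 by rewrite invf_lt1//; lra.
have ti0 : 0 <= tau^-1 by rewrite invr_ge0; lra.
have rt : 0 < rho * tau < 1.
  have : rho * rho^-1 = 1 by rewrite divff ?gt_eqF.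
  by rewrite /tau mulr_gt0//=; nra.
(* If V = 0, every [H2norm] is at most 0 by [H2sq_null], and B = 0 works. *)
have [V0|V0] := eqVneq V 0.
  exists 0, tau; split => // N; rewrite mul0r; apply: ge_ereal_sup => _ [f _ <-].
  by apply: H2norm_le => //; rewrite expr0n; exact: H2sq_null.
have [K K0 hK] := point_evaluation rt V0.
exists (K / (1 - tau^-1)), tau; split => //; first by rewrite divr_ge0// subr_ge0 ltW.
move=> N; apply: ge_ereal_sup => _ [f [fH f1] <-].
have B0 : 0 <= K / (1 - tau^-1) * tau^-1 ^+ N.
  by rewrite mulr_ge0 ?exprn_ge0// divr_ge0// subr_ge0 ltW.
apply: H2norm_le => //; apply: H2sq_bounded => [|z zO]; first exact: sqr_ge0.
rewrite abs2E lerXn2r ?nnegrE ?cabs_ge0//.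
have /andP[_ rt1] := rt; have [hf _] := fH.
have := taylor_Omega N hf (ltW rho0) tau1 rt1 (hK f hf (H2sq_le1 fH f1)) (phirho z zO).
by rewrite mulrAC.
Qed.

End TaylorOperator.

(* With N the integer part of (n - 1)^(1/d), the Taylor operator of order N has rank at
   most n - 1 and its error decays like tau^-(N + 1) <= tau^-(n^(1/d)). *)
Lemma root_bracket (R : realType) (d n : nat) : (0 < d)%N -> (0 < n)%N ->
  exists N, (N ^ d <= n.-1)%N /\ (n%:R : R) `^ (d%:R)^-1 <= N.+1%:R.
Proof.
move=> d0 n0.
have ex0 : exists N, (N ^ d <= n.-1)%N by exists 0%N; rewrite exp0n.
have bnd N : (N ^ d <= n.-1)%N -> (N <= n.-1)%N.
  move=> h; apply: leq_trans h; case: N => // N.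
  by have := leq_pexp2l (ltn0Sn N) d0; rewrite expn1.
case: (ex_maxnP ex0 bnd) => N NP Nmax; exists N; split => //.
have nN : (n <= N.+1 ^ d)%N.
  rewrite leqNgt; apply/negP => h; have := Nmax N.+1; rewrite ltnn.
  by move=> H; have : false by apply: H; rewrite -ltnS prednK.
have dR : d%:R != 0 :> R by rewrite pnatr_eq0 -lt0n.
have -> : N.+1%:R = ((N.+1 ^ d)%:R : R) `^ (d%:R)^-1.
  by rewrite natrX -powR_mulrn// -powRrM mulfV// powRr1.
by apply: ge0_ler_powR; rewrite ?nnegrE ?invr_ge0 ?ler0n// ler_nat.
Qed.

Unset Implicit Arguments.

Theorem theorem5p2 (R : realType) (l1 l2 : nat) (phi : pt R l1 l2 -> pt R l1 l2) :
  (1 <= l1)%N -> (1 <= l2)%N ->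
  schur_map phi -> truly_d_dim phi -> compact_Cphi phi -> supnorm_lt1 phi ->
  exists c C : R, [/\ 0 < c, c <= C &
    forall n : nat, (1 <= n)%N ->
      (approx_num (Cphi phi) n <= (C * expR (- c * (n%:R `^ ((l1 + l2)%:R)^-1)))%:E)%E].
Proof.
move=> l1p _ [phiH phiO _] _ _ [rho0 [rho01 phirho]].
(* The given bound may be zero or negative; the maximum with 1/2 is positive and still below 1. *)
pose rho := Num.max rho0 2^-1.
have rho1 : 0 < rho < 1 by rewrite lt_max gt_max rho01 invr_gt0 ltr0n invf_lt1 ?ltr1n ?orbT.
have phir z : Omega z -> tnorm (phi z) <= rho.
  by move=> /phirho /le_trans; apply; rewrite le_max lexx.
have [B [tau [B0 tau1 hop]]] := taylor_op_error rho1 phir.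
have tau0 : 0 < tau by exact: lt_trans tau1.
have c0 : 0 < ln tau by exact: ln_gt0.
(* The rate is ln tau. [B * tau] absorbs the shift from N to N + 1, and the maximum secures c <=
   C. *)
exists (ln tau), (Num.max (ln tau) (B * tau)); split; [exact: c0|by rewrite le_max lexx|].
move=> n n1; set q := _ `^ _.
have [|N [Nn qN]] := @root_bracket R (l1 + l2) n _ n1; first by rewrite addn_gt0 l1p.
apply: (@le_trans _ _ (B * tau^-1 ^+ N)%:E).
  apply: le_trans (hop N); apply: ereal_inf_lbound.
  by exists (taylor_op phi N) => //; exact: (taylor_op_finrank phiH phiO Nn).
rewrite lee_fin; apply: (@le_trans _ _ (B * tau * expR (- ln tau * q))); last first.
  by rewrite ler_wpM2r ?expR_ge0// le_max lexx orbT.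
rewrite -mulrA ler_wpM2l//.
(* [root_bracket] bounds n^(1/d) by N + 1, hence one factor [tau] is split off. *)
have E : tau^-1 ^+ N = tau * expR (- ln tau * N.+1%:R).
  rewrite [- ln tau * _]mulrC expRM_natl expRN lnK ?posrE// exprS mulrA.
  by rewrite divff ?gt_eqF// mul1r.
rewrite E ler_pM2l// ler_expR !mulNr lerN2 ler_pM2l//.
Qed.
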